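(* Let $K$ be a field and let $E$ and $F$ be finite directed graphs with no sinks. Write $\mathcal L(E)$ and $\mathcal L(F)$ for the Leavitt path algebras of $E$ and $F$ over $K$. Suppose that there is an order preserving isomorphism of $\mathbb Z[x,x^{-1}]$-modules $K_0^{\mathrm{gr}}(\mathcal L(E)) \to K_0^{\mathrm{gr}}(\mathcal L(F))$ sending $[\mathcal L(E)]$ to $[\mathcal L(F)]$. Then there is an isomorphism of groups $K_0(\mathcal L(E)) \to K_0(\mathcal L(F))$ sending $[\mathcal L(E)]$ to $[\mathcal L(F)]$.
   Context: A directed graph $E=(E^0,E^1,r,s)$ consists of a set of vertices $E^0$, a set of edges $E^1$, and range and source maps $r,s:E^1\to E^0$. It is finite if $E^0$ and $E^1$ are finite. A sink is a vertex $v$ with $s^{-1}(v)=\emptyset$. For a finite graph $E$, the Leavitt path algebra $\mathcal L(E)$ over a fixed field $K$ is the unital associative $K$-algebra generated by $E^0\cup E^1\cup\{\alpha^*\mid \alpha\in E^1\}$ subject to: (1) $uv=\delta_{u,v}u$ for $u,v\in E^0$; (2) $s(\alpha)\alpha=\alpha r(\alpha)=\alpha$ and $r(\alpha)\alpha^*=\alpha^*s(\alpha)=\alpha^*$ for $\alpha\in E^1$; (3) $\alpha^*\beta=\delta_{\alpha,\beta}\,r(\alpha)$ for $\alpha,\beta\in E^1$; (4) $v=\sum_{\{\alpha\in E^1\mid s(\alpha)=v\}}\alpha\alpha^*$ for every $v\in E^0$ that is not a sink. Its identity is $\sum_{v\in E^0}v$. It is $\mathbb Z$-graded by $\deg v=0$,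 $\deg\alpha=1$, $\deg\alpha^*=-1$ for $v\in E^0$, $\alpha\in E^1$. All modules are right modules. For a $\mathbb Z$-graded unital ring $A$, $\mathcal V^{\mathrm{gr}}(A)$ is the commutative monoid of graded isomorphism classes $[P]$ of graded finitely generated projective $A$-modules under direct sum, where graded isomorphisms are degree-preserving, and $K_0^{\mathrm{gr}}(A)$ is its group completion. For a graded module $P$ and $i\in\mathbb Z$, the shifted module $P(i)$ is $P$ with grading $P(i)_n=P_{i+n}$. The group $K_0^{\mathrm{gr}}(A)$ is a $\mathbb Z[x,x^{-1}]$-module via $x^j[P]=[P(j)]$. It is preordered with positive cone the image of $\mathcal V^{\mathrm{gr}}(A)$; an order preserving homomorphism is one mapping positive cone into positive cone. $K_0(A)$ is the usual (ungraded) Grothendieck group of finitely generated projective $A$-modules. $[A]$ denotes the class of $A$ as a (graded) module over itself. *)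

(* Defs.v *)
From HB Require Import structures.
From mathcomp Require Import all_boot all_order all_algebra.
From mathcomp Require Import boolp classical_sets finmap.

Set Implicit Arguments.
Unset Strict Implicit.
Unset Printing Implicit Defensive.

Import GRing.Theory.
Local Open Scope ring_scope.
Local Open Scope quotient_scope.
Local Open Scope classical_set_scope.

(** * Group completion of a commutative monoid *)

Section GroupCompletion.
Variable M : nmodType.

Definition gc_rel (x y : M * M) : bool :=
  `[< exists k, x.1 + y.2 + k = y.1 + x.2 + k >].

Lemma gc_rel_refl : reflexive gc_rel.
Proof. by move=> x; apply/asboolP; exists 0. Qed.

Lemma gc_rel_sym : symmetric gc_rel.
Proof. by move=> x y; apply/asboolP/asboolP => -[k e]; exists k; rewrite e. Qed.

Lemma gc_rel_trans : transitive gc_rel.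
Proof.
move=> y x z /asboolP[k e] /asboolP[l e']; apply/asboolP.
exists (y.1 + y.2 + k + l).
rewrite [LHS](AC (2*4) ((1*4*5)*(3*2*6))) /= e e'.
by rewrite [LHS](AC (3*3) ((4*2)*(1*5*3*6))).
Qed.

Canonical gc_rel_equiv := EquivRel gc_rel gc_rel_refl gc_rel_sym gc_rel_trans.

Definition group_completion := {eq_quot gc_rel}.
HB.instance Definition _ := EqQuotient.on group_completion.
HB.instance Definition _ := Choice.on group_completion.

Implicit Types z : group_completion.

Definition gc_zero : group_completion := \pi_group_completion (0, 0).
Definition gc_opp z : group_completion := \pi_group_completion ((repr z).2, (repr z).1).
Definition gc_add z1 z2 : group_completion :=
  \pi_group_completion ((repr z1).1 + (repr z2).1, (repr z1).2 + (repr z2).2).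

Lemma gcP x y : reflect (exists k, x.1 + y.2 + k = y.1 + x.2 + k)
  (\pi_group_completion x == \pi_group_completion y).
Proof. by rewrite piE; apply: asboolP. Qed.

Lemma gc_surj z : exists x, z = \pi_group_completion x.
Proof. by exists (repr z); rewrite reprK. Qed.

Lemma gc_reprP x :
  exists k, (repr (\pi_group_completion x)).1 + x.2 + k =
            x.1 + (repr (\pi_group_completion x)).2 + k.
Proof. by apply/gcP; rewrite reprK. Qed.

Lemma gc_addE x y : gc_add (\pi_group_completion x) (\pi_group_completion y) = \pi_group_completion (x.1 + y.1, x.2 + y.2).
Proof.
apply/eqP/gcP => /=.
have [k e] := gc_reprP x; have [l e'] := gc_reprP y; exists (k + l).
rewrite [LHS](AC (2*2*2) ((1*3*5)*(2*4*6))) /= e e'.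
by rewrite [LHS](AC (3*3) ((1*4)*(2*5)*(3*6))).
Qed.

Lemma gc_oppE x : gc_opp (\pi_group_completion x) = \pi_group_completion (x.2, x.1).
Proof.
apply/eqP/gcP => /=; have [k e] := gc_reprP x; exists k.
by rewrite [RHS](AC 3 (2*1*3)) /= e [RHS](AC 3 (2*1*3)).
Qed.

Lemma gc_addA : associative gc_add.
Proof.
move=> z1 z2 z3; have [x ->] := gc_surj z1; have [y ->] := gc_surj z2.
by have [z ->] := gc_surj z3; rewrite !gc_addE /= !addrA.
Qed.

Lemma gc_addC : commutative gc_add.
Proof.
move=> z1 z2; have [x ->] := gc_surj z1; have [y ->] := gc_surj z2.
by rewrite !gc_addE [x.1 + _]addrC [x.2 + _]addrC.
Qed.

Lemma gc_add0 : left_id gc_zero gc_add.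
Proof.
by move=> z; have [x ->] := gc_surj z; rewrite gc_addE /= !add0r -surjective_pairing.
Qed.

Lemma gc_addN : left_inverse gc_zero gc_opp gc_add.
Proof.
move=> z; have [x ->] := gc_surj z; rewrite gc_oppE gc_addE; apply/eqP/gcP; exists 0 => /=.
by rewrite !addr0 add0r addrC.
Qed.

HB.instance Definition _ :=
  GRing.isZmodule.Build group_completion gc_addA gc_addC gc_add0 gc_addN.

Definition gc_of (a : M) : group_completion := \pi_group_completion (a, 0).

Lemma gc_ofD a b : gc_of (a + b) = gc_of a + gc_of b.
Proof. by rewrite [RHS]gc_addE /= addr0. Qed.

Lemma gc_of0 : gc_of 0 = 0. Proof. by []. Qed.

Lemma gc_ofP a b : gc_of a = gc_of b <-> exists k, a + k = b + k.
Proof.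
split=> [/eqP/gcP[k /=]|[k e]]; first by rewrite !addr0; exists k.
by apply/eqP/gcP; exists k; rewrite /= !addr0.
Qed.

Lemma gc_ind (P : group_completion -> Prop) :
  (forall a b, P (gc_of a - gc_of b)) -> forall z, P z.
Proof.
move=> H z; have [[a b] ->] := gc_surj z.
suff -> : \pi_group_completion (a, b) = gc_of a - gc_of b by [].
by rewrite [- _]gc_oppE [RHS]gc_addE /= addr0 add0r.
Qed.

End GroupCompletion.

Definition gc_map (M N : nmodType) (f : {additive M -> N})
  (z : group_completion M) : group_completion N :=
  gc_of (f (repr z).1) - gc_of (f (repr z).2).

Section GroupCompletionMap.
Variables (M N : nmodType) (f : {additive M -> N}).

Lemma gc_map_pi (x : M * M) :
  gc_map f (\pi_(group_completion M) x) = gc_of (f x.1) - gc_of (f x.2).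
Proof.
have [k e] := gc_reprP x.
apply/eqP; rewrite subr_eq addrAC eq_sym subr_eq -!gc_ofD; apply/eqP/gc_ofP.
by exists (f k); rewrite -!raddfD e.
Qed.

Lemma gc_map_of a : gc_map f (gc_of a) = gc_of (f a).
Proof. by rewrite gc_map_pi /= raddf0 subr0. Qed.

Lemma gc_map_is_nmod_morphism : nmod_morphism (gc_map f).
Proof.
split; first by rewrite -gc_of0 gc_map_of raddf0.
move=> z1 z2; have [x ->] := gc_surj z1; have [y ->] := gc_surj z2.
rewrite [X in gc_map f X]gc_addE !gc_map_pi /=.
by rewrite !raddfD !gc_ofD opprD addrACA.
Qed.

HB.instance Definition _ :=
  GRing.isNmodMorphism.Build _ _ (gc_map f) gc_map_is_nmod_morphism.

End GroupCompletionMap.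

(** * Monoids of isomorphism classes *)

(* Modules form a type too large for the class of one to be the set of modules
   isomorphic to it. Instead, [icode] assigns to each object a set of elements
   of a small type determining the object exactly up to isomorphism, and
   [icode P] represents the isomorphism class of P. *)
Record isoData := IsoData {
  iobj :> Type;
  iiso : iobj -> iobj -> Prop;
  isum : iobj -> iobj -> iobj;
  izero : iobj;
  ishape : Type;
  icode : iobj -> set ishape;
  icodeP : forall P Q, icode P = icode Q <-> iiso P Q;
  isum_iso : forall P P' Q Q', iiso P P' -> iiso Q Q' ->
    iiso (isum P Q) (isum P' Q');
  isumA : forall P Q S, iiso (isum P (isum Q S)) (isum (isum P Q) S);
  isumC : forall P Q, iiso (isum P Q) (isum Q P);
  isum0 : forall P, iiso (isum izero P) P
}.

Definition isoclass (C : isoData) : Type :=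
  {X : set (ishape C) | `[< exists P : C, icode P = X >]}.

Section IsoClass.
Variable C : isoData.
Implicit Types (P Q : C) (X Y : isoclass C).

HB.instance Definition _ := Choice.on (isoclass C).

Lemma icode_in P : `[< exists Q : C, icode Q = icode P >].
Proof. by apply/asboolP; exists P. Qed.

Definition iclass P : isoclass C := Sub (icode P) (icode_in P).

Definition irepr X : C := projT1 (cid (asboolP _ (valP X))).

Lemma ireprK X : iclass (irepr X) = X.
Proof. by apply: val_inj => /=; rewrite /irepr; case: cid. Qed.

Lemma iclassP P Q : iclass P = iclass Q <-> iiso P Q.
Proof.
by split=> [/(congr1 val)/icodeP //|/icodeP e]; apply: val_inj.
Qed.

Definition iadd X Y := iclass (isum (irepr X) (irepr Y)).

Lemma iaddE P Q : iadd (iclass P) (iclass Q) = iclass (isum P Q).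
Proof. by apply/iclassP/isum_iso; apply/iclassP; rewrite ireprK. Qed.

Lemma iaddA : associative iadd.
Proof.
move=> X Y Z; rewrite -[X]ireprK -[Y]ireprK -[Z]ireprK !iaddE.
exact/iclassP/isumA.
Qed.

Lemma iaddC : commutative iadd.
Proof. by move=> X Y; apply/iclassP/isumC. Qed.

Lemma iadd0 : left_id (iclass (izero C)) iadd.
Proof. by move=> X; rewrite -[X]ireprK iaddE; apply/iclassP/isum0. Qed.

HB.instance Definition _ :=
  GRing.isNmodule.Build (isoclass C) iaddA iaddC iadd0.

End IsoClass.

(** * Finitely generated projective modules *)

(* Modules over R are left modules here. Right A-modules are left modules over
   the converse ring A^c, with v . a := (a : A^c) *: v; in particular (A^c)^o is
   A as a right module over itself. *)

Section Modules.
Variable R : pzRingType.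

Definition finitely_generated (P : lmodType R) : Prop :=
  exists (n : nat) (x : 'I_n -> P),
    forall v, exists a : 'I_n -> R, v = \sum_i a i *: x i.

Definition projective (P : lmodType R) : Prop :=
  forall (M N : lmodType R) (g : {linear M -> N}) (f : {linear P -> N}),
    (forall y, exists x, g x = y) ->
    exists h : {linear P -> M}, forall v, g (h v) = f v.

Definition mod_iso (P Q : lmodType R) : Prop :=
  exists (f : {linear P -> Q}) (g : {linear Q -> P}), cancel f g /\ cancel g f.

Definition mklinear (U V : lmodType R) (f : U -> V) (hf : linear f) :
  {linear U -> V} := HB.pack f (GRing.isLinear.Build R U V *:%R f hf).

Lemma fg_sum (P Q : lmodType R) : finitely_generated P ->
  finitely_generated Q -> finitely_generated (P * Q)%type.
Proof.
move=> [m [x hx]] [n [y hy]]; exists (m + n)%N.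
exists (fun i => match split i with inl j => (x j, 0) | inr k => (0, y k) end).
move=> [p q]; have [a ->] := hx p; have [b ->] := hy q.
exists (fun i => match split i with inl j => a j | inr k => b k end).
rewrite big_split_ord /=.
have sl (i : 'I_m) : split (lshift n i) = inl i := unsplitK (inl i).
have sr (i : 'I_n) : split (rshift m i) = inr i := unsplitK (inr i).
under [X in _ = X + _]eq_bigr => i _ do rewrite sl.
under [X in _ = _ + X]eq_bigr => i _ do rewrite sr.
apply/pair_equal_spec; rewrite /= !raddf_sum /=; split.
- by rewrite [X in _ + X]big1 ?addr0 // => i _; rewrite scaler0.
- by rewrite [X in X + _]big1 ?add0r // => i _; rewrite scaler0.
Qed.

Lemma projective_sum (P Q : lmodType R) :
  projective P -> projective Q -> projective (P * Q)%type.
Proof.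
move=> hP hQ M N g f gs.
have l1 : linear (fun p : P => f (p, 0)).
  by move=> a u v; rewrite -linearP; congr (f (_, _)); rewrite /= ?scaler0 ?addr0.
have l2 : linear (fun q : Q => f (0, q)).
  by move=> a u v; rewrite -linearP; congr (f (_, _)); rewrite /= ?scaler0 ?addr0.
have [h1 e1] := hP _ _ g (mklinear l1) gs.
have [h2 e2] := hQ _ _ g (mklinear l2) gs.
have l : linear (fun z : P * Q => h1 z.1 + h2 z.2).
  by move=> a u v; rewrite !linearP scalerDr addrACA.
exists (mklinear l) => -[p q] /=; rewrite raddfD /= e1 e2 /= -raddfD /=.
by congr (f (_, _)); rewrite /= ?addr0 ?add0r.
Qed.

Lemma fg_zero : finitely_generated 'rV[R]_0.
Proof.
exists 0%N, (fun=> 0) => v; exists (fun=> 0).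
by rewrite big_ord0; apply/rowP => -[].
Qed.

Lemma projective_zero : projective 'rV[R]_0.
Proof.
move=> M N g f gs.
have l : linear (fun _ : 'rV[R]_0 => 0 : M) by move=> a u v; rewrite scaler0 addr0.
exists (mklinear l) => v /=; rewrite raddf0.
by have -> : v = 0 by [apply/rowP => -[]]; rewrite raddf0.
Qed.

Lemma fg_regular : finitely_generated R^o.
Proof.
by exists 1%N, (fun=> 1 : R^o) => v; exists (fun=> v); rewrite big_ord1 [RHS]mulr1.
Qed.

Lemma projective_regular : projective R^o.
Proof.
move=> M N g f gs; have [m em] := gs (f 1).
have l : linear (fun r : R^o => (r : R) *: m).
  by move=> a u v; rewrite scalerDl scalerA.
exists (mklinear l) => v /=.
by rewrite linearZ em -linearZ /=; congr (f _); apply: mulr1.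
Qed.

Lemma fgproj_embed (P : lmodType R) : finitely_generated P -> projective P ->
  exists n (phi : {linear P -> 'rV[R]_n}), injective phi.
Proof.
move=> [n [x hx]] hP; exists n.
have l : linear (fun a : 'rV[R]_n => \sum_i a 0 i *: x i).
  move=> c u v; rewrite scaler_sumr -big_split; apply: eq_bigr => i _ /=.
  by rewrite !mxE scalerDl scalerA.
have lid : linear (@id P) by [].
have [|h hK] := hP _ _ (mklinear l) (mklinear lid).
  move=> p; have [a ->] := hx p; exists (\row_i a i) => /=.
  by apply: eq_bigr => i _; rewrite mxE.
by exists h => u v e; rewrite -[u](hK u) -[v](hK v) e.
Qed.

Lemma embed_iso (P Q V : lmodType R) (phi : {linear P -> V})
    (psi : {linear Q -> V}) : injective phi -> injective psi ->
  range phi = range psi ->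
  exists (f : {linear P -> Q}) (g : {linear Q -> P}),
    [/\ cancel f g, cancel g f, forall p, psi (f p) = phi p &
        forall q, phi (g q) = psi q].
Proof.
move=> iphi ipsi e.
have [F eF] : {F : P -> Q & forall p, psi (F p) = phi p}.
  apply: (@choice P Q (fun p q => psi q = phi p)) => p; have : range phi (phi p) by [].
  by rewrite e => -[q _ <-]; exists q.
have [G eG] : {G : Q -> P & forall q, phi (G q) = psi q}.
  apply: (@choice Q P (fun q p => phi p = psi q)) => q; have : range psi (psi q) by [].
  by rewrite -e => -[p _ <-]; exists p.
have lF : linear F by move=> a u v; apply: ipsi; rewrite linearP !eF linearP.
have lG : linear G by move=> a u v; apply: iphi; rewrite linearP !eG linearP.
exists (mklinear lF), (mklinear lG); split => // [p|q] /=.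
- by apply: iphi; rewrite eG eF.
- by apply: ipsi; rewrite eF eG.
Qed.

Record fgproj := FGProj {
  fgproj_mod :> lmodType R;
  fgproj_fg : finitely_generated fgproj_mod;
  fgproj_proj : projective fgproj_mod
}.

Arguments fgproj_fg : clear implicits.
Arguments fgproj_proj : clear implicits.

Definition fgproj_sum (P Q : fgproj) : fgproj :=
  FGProj (fg_sum (fgproj_fg P) (fgproj_fg Q))
         (projective_sum (fgproj_proj P) (fgproj_proj Q)).

Definition fgproj_zero : fgproj := FGProj fg_zero projective_zero.

Definition fgproj_regular : fgproj := FGProj fg_regular projective_regular.

(* The submodules of the modules R^n that are isomorphic to P; there is one if P
   is finitely generated projective. *)
Definition fgproj_code (P : fgproj) : set {n : nat & set 'rV[R]_n} :=
  [set c | exists phi : {linear P -> 'rV[R]_(tag c)},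
             injective phi /\ range phi = tagged c].

Lemma mod_iso_embed (P Q V : lmodType R) (f : {linear P -> Q})
    (g : {linear Q -> P}) (phi : {linear P -> V}) :
  cancel f g -> cancel g f -> injective phi ->
  exists psi : {linear Q -> V}, [/\ injective psi, range psi = range phi &
     forall q, psi q = phi (g q)].
Proof.
move=> fK gK iphi.
have l : linear (fun q => phi (g q)) by move=> a u v; rewrite !linearP.
exists (mklinear l); split=> // [u v /iphi/(can_inj gK)//|].
by apply/seteqP; split=> _ [q _ <-] /=; [exists (g q)|exists (f q); rewrite //= fK].
Qed.

Lemma fgproj_codeP (P Q : fgproj) : fgproj_code P = fgproj_code Q <-> mod_iso P Q.
Proof.
split=> [e|[f [g [fK gK]]]].
  have [n [phi iphi]] := fgproj_embed (fgproj_fg P) (fgproj_proj P).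
  have : fgproj_code P (existT _ n (range phi)) by exists phi.
  rewrite e => -[psi /= [ipsi epsi]].
  by have [f [g [? ? _ _]]] := embed_iso iphi ipsi (esym epsi); exists f, g.
apply/seteqP; split=> -[n U] [phi /= [iphi <-]].
- by have [psi [? ? _]] := mod_iso_embed fK gK iphi; exists psi.
- by have [psi [? ? _]] := mod_iso_embed gK fK iphi; exists psi.
Qed.

Lemma fgproj_sum_iso (P P' Q Q' : fgproj) : mod_iso P P' -> mod_iso Q Q' ->
  mod_iso (fgproj_sum P Q) (fgproj_sum P' Q').
Proof.
move=> [f [g [fK gK]]] [f' [g' [fK' gK']]].
have l1 : linear (fun z : P * Q => (f z.1, f' z.2)).
  by move=> a u v; rewrite !linearP.
have l2 : linear (fun z : P' * Q' => (g z.1, g' z.2)).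
  by move=> a u v; rewrite !linearP.
exists (mklinear l1), (mklinear l2).
by split=> -[u v] /=; rewrite ?fK ?fK' ?gK ?gK'.
Qed.

Lemma fgproj_sumA (P Q S : fgproj) :
  mod_iso (fgproj_sum P (fgproj_sum Q S)) (fgproj_sum (fgproj_sum P Q) S).
Proof.
have l1 : linear (fun z : P * (Q * S) => ((z.1, z.2.1), z.2.2)) by [].
have l2 : linear (fun z : P * Q * S => (z.1.1, (z.1.2, z.2))) by [].
by exists (mklinear l1), (mklinear l2); split=> [[? []]|[[]]].
Qed.

Lemma fgproj_sumC (P Q : fgproj) :
  mod_iso (fgproj_sum P Q) (fgproj_sum Q P).
Proof.
have l1 : linear (fun z : P * Q => (z.2, z.1)) by [].
have l2 : linear (fun z : Q * P => (z.2, z.1)) by [].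
by exists (mklinear l1), (mklinear l2); split=> -[].
Qed.

Lemma fgproj_sum0 (P : fgproj) : mod_iso (fgproj_sum fgproj_zero P) P.
Proof.
have l1 : linear (fun z : 'rV[R]_0 * P => z.2) by [].
have l2 : linear (fun p : P => (0 : 'rV[R]_0, p)).
  by move=> a u v; congr (_, _); rewrite /= scaler0 addr0.
exists (mklinear l1), (mklinear l2); split=> //= -[u v] /=.
by congr (_, _); apply/rowP => -[].
Qed.

Definition fgproj_isoData : isoData :=
  IsoData fgproj_codeP fgproj_sum_iso fgproj_sumA fgproj_sumC fgproj_sum0.

End Modules.

Arguments fgproj_fg {R} f : rename.
Arguments fgproj_proj {R} f : rename.

(** * The Grothendieck group of finitely generated projective right modules *)

Definition Vmon (R : pzRingType) : nmodType := isoclass (fgproj_isoData R^c).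

Definition K0 (R : pzRingType) : zmodType := group_completion (Vmon R).

Definition K0_class (R : pzRingType) (P : fgproj R^c) : K0 R :=
  gc_of (iclass (P : fgproj_isoData R^c)).

Definition K0_unit (R : pzRingType) : K0 R := K0_class (fgproj_regular R^c).

(** * Graded rings and graded modules *)

(* V is the internal direct sum of the subgroups G n, n : int. *)
Definition is_grading (V : zmodType) (G : int -> set V) : Prop :=
  [/\ forall n, G n 0 /\ (forall u v, G n u -> G n v -> G n (u - v)),
      forall v, exists l : seq (int * V),
        {in l, forall x, G x.1 x.2} /\ v = \sum_(x <- l) x.2
    & forall (s : seq int) (f : int -> V), uniq s -> (forall n, G n (f n)) ->
        \sum_(n <- s) f n = 0 -> {in s, forall n, f n = 0}].

Record gradedRing := GradedRing {
  gring :> pzRingType;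
  gcomp : int -> set gring;
  gcomp_grading : is_grading gcomp;
  gcomp1 : gcomp 0 1;
  gcompM : forall m n a b, gcomp m a -> gcomp n b -> gcomp (m + n) (a * b)
}.

Section GradedModules.
Variable A : gradedRing.

(* Graded right A-modules whose underlying module is finitely generated
   projective; [a *: v] is the right action of [a] on [v]. *)
Record grproj := GrProj {
  grproj_mod :> fgproj A^c;
  grdeg : int -> set grproj_mod;
  grdeg_grading : is_grading grdeg;
  grdegZ : forall m n (v : grproj_mod) (a : A),
    grdeg m v -> gcomp n a -> grdeg (m + n) ((a : A^c) *: v)
}.

Definition gr_iso (P Q : grproj) : Prop :=
  exists (f : {linear P -> Q}) (g : {linear Q -> P}),
    [/\ cancel f g, cancel g f,
        forall n v, grdeg n v -> grdeg n (f v)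
      & forall n v, grdeg n v -> grdeg n (g v)].

Lemma is_grading_sum (U V : zmodType) (G : int -> set U) (H : int -> set V) :
  is_grading G -> is_grading H ->
  is_grading (fun n => [set w : U * V | G n w.1 /\ H n w.2]).
Proof.
move=> [G0 GE GU] [H0 HE HU]; split.
- move=> n; have [a b] := G0 n; have [c d] := H0 n.
  by split=> // u v [? ?] [? ?]; split; [apply: b|apply: d].
- move=> [u v]; have [l [hl ->]] := GE u; have [k [hk ->]] := HE v.
  exists ([seq (x.1, (x.2, 0)) | x <- l] ++ [seq (x.1, (0, x.2)) | x <- k]).
  split=> [x|].
    rewrite mem_cat => /orP[] /mapP[y yl ->] /=.
    - by split; [apply: hl|case: (H0 y.1)].
    - by split; [case: (G0 y.1)|apply: hk].
  rewrite big_cat !big_map /=; apply/pair_equal_spec.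
  rewrite /= !raddf_sum /=; split.
  - by rewrite [X in _ + X]big1 ?addr0.
  - by rewrite [X in X + _]big1 ?add0r.
- move=> s f us hf e n ns.
  have e1 : (f n).1 = 0.
    apply: (GU s (fun n => (f n).1)) => // [m|]; first by case: (hf m).
    by rewrite -(raddf_sum (@fst U V)) e.
  have e2 : (f n).2 = 0.
    apply: (HU s (fun n => (f n).2)) => // [m|]; first by case: (hf m).
    by rewrite -(raddf_sum (@snd U V)) e.
  by rewrite [f n]surjective_pairing e1 e2.
Qed.

Program Definition gr_sum (P Q : grproj) : grproj :=
  @GrProj (fgproj_sum P Q) (fun n => [set w : P * Q | grdeg n w.1 /\ grdeg n w.2])
    (is_grading_sum (grdeg_grading P) (grdeg_grading Q)) _.
Next Obligation. by split; apply: grdegZ. Qed.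

Program Definition gr_zero : grproj :=
  @GrProj (fgproj_zero A^c) (fun=> setT) _ _.
Next Obligation.
have z (v : 'rV[A^c]_0) : v = 0 by apply/rowP => -[].
split=> // [v|s f _ _ _ n _]; last exact: z.
by exists [::]; rewrite big_nil; split=> //; apply: z.
Qed.

Program Definition gr_regular : grproj :=
  @GrProj (fgproj_regular A^c) (@gcomp A) (gcomp_grading A) _.
Next Obligation. exact: gcompM. Qed.

(* The shift P(j), with P(j)_n = P_(j + n). *)
Program Definition gr_shift (j : int) (P : grproj) : grproj :=
  @GrProj P (fun n => grdeg (j + n)) _ _.
Next Obligation.
have [G0 GE GU] := grdeg_grading P; split=> [n|v|s f us hf e n ns] //.
- have [l [hl ->]] := GE v; exists [seq (x.1 - j, x.2) | x <- l].
  rewrite big_map; split=> // _ /mapP[x xl ->] /=.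
  by rewrite addrC subrK; apply: hl.
- have H := GU [seq j + m | m <- s] (fun m => f (m - j)).
  have -> : f n = f (j + n - j) by rewrite addrAC subrr add0r.
  apply: H; last by apply: map_f.
  + by rewrite map_inj_uniq //; apply: addrI.
  + by move=> m; have := hf (m - j); rewrite addrC subrK.
  + by rewrite big_map -[RHS]e; apply: eq_bigr => m _; rewrite addrAC subrr add0r.
Qed.
Next Obligation. by rewrite addrA; apply: grdegZ. Qed.

(* The graded submodules, with arbitrary gradings, of the modules A^n that are
   graded isomorphic to P. *)
Definition gr_code (P : grproj) :
    set {n : nat & (set 'rV[A^c]_n * (int -> set 'rV[A^c]_n))%type} :=
  [set c | exists phi : {linear P -> 'rV[A^c]_(tag c)},
     [/\ injective phi, range phi = (tagged c).1
       & forall n, phi @` grdeg n = (tagged c).2 n]].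

Lemma gr_code_sub (P Q : grproj) : gr_iso P Q -> gr_code P `<=` gr_code Q.
Proof.
move=> [f [g [fK gK hf hg]]] [n [U G]] [phi /= [iphi <- eG]].
have [psi [ipsi epsi e]] := mod_iso_embed fK gK iphi.
exists psi; split=> //= m; rewrite -eG.
apply/seteqP; split=> _ [v hv <-] /=; first by exists (g v); [apply: hg|].
by exists (f v); [apply: hf|rewrite e fK].
Qed.

Lemma gr_iso_sym (P Q : grproj) : gr_iso P Q -> gr_iso Q P.
Proof. by move=> [f [g [? ? ? ?]]]; exists g, f. Qed.

Lemma gr_codeP (P Q : grproj) : gr_code P = gr_code Q <-> gr_iso P Q.
Proof.
split=> [e|h]; last first.
  by apply/seteqP; split; apply: gr_code_sub; last apply: gr_iso_sym.
have [n [phi iphi]] := fgproj_embed (fgproj_fg P) (fgproj_proj P).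
have : gr_code P (existT _ n (range phi, fun m => phi @` grdeg m)) by exists phi.
rewrite e => -[psi /= [ipsi epsi eG]].
have [f [g [fK gK ef eg]]] := embed_iso iphi ipsi (esym epsi).
exists f, g; split=> // m v hv.
- have : (phi @` grdeg m) (phi v) by exists v.
  by rewrite -eG -ef => -[w hw /ipsi <-].
- have : (psi @` grdeg m) (psi v) by exists v.
  by rewrite eG -eg => -[w hw /iphi <-].
Qed.

Lemma gr_sum_iso (P P' Q Q' : grproj) : gr_iso P P' -> gr_iso Q Q' ->
  gr_iso (gr_sum P Q) (gr_sum P' Q').
Proof.
move=> [f [g [fK gK hf hg]]] [f' [g' [fK' gK' hf' hg']]].
have l1 : linear (fun z : P * Q => (f z.1, f' z.2)).
  by move=> a u v; rewrite !linearP.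
have l2 : linear (fun z : P' * Q' => (g z.1, g' z.2)).
  by move=> a u v; rewrite !linearP.
exists (mklinear l1), (mklinear l2).
split=> [[u v]|[u v]|n [u v] []|n [u v] []] /=; rewrite ?fK ?fK' ?gK ?gK' //.
- by move=> /hf ? /hf'.
- by move=> /hg ? /hg'.
Qed.

Lemma gr_sumA (P Q S : grproj) :
  gr_iso (gr_sum P (gr_sum Q S)) (gr_sum (gr_sum P Q) S).
Proof.
have l1 : linear (fun z : P * (Q * S) => ((z.1, z.2.1), z.2.2)) by [].
have l2 : linear (fun z : P * Q * S => (z.1.1, (z.1.2, z.2))) by [].
exists (mklinear l1), (mklinear l2).
by split=> [[? []]|[[]]|n [? [? ?]] [? []]|n [[? ?] ?] [[]]].
Qed.

Lemma gr_sumC (P Q : grproj) : gr_iso (gr_sum P Q) (gr_sum Q P).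
Proof.
have l1 : linear (fun z : P * Q => (z.2, z.1)) by [].
have l2 : linear (fun z : Q * P => (z.2, z.1)) by [].
by exists (mklinear l1), (mklinear l2); split=> [[]|[]|n [? ?] []|n [? ?] []].
Qed.

Lemma gr_sum0 (P : grproj) : gr_iso (gr_sum gr_zero P) P.
Proof.
have l1 : linear (fun z : 'rV[A^c]_0 * P => z.2) by [].
have l2 : linear (fun p : P => (0 : 'rV[A^c]_0, p)).
  by move=> a u v; congr (_, _); rewrite /= scaler0 addr0.
exists (mklinear l1), (mklinear l2); split=> [[u v]||n [u v] []|] //=.
by congr (_, _); apply/rowP => -[].
Qed.

Definition gr_isoData : isoData :=
  IsoData gr_codeP gr_sum_iso gr_sumA gr_sumC gr_sum0.

Definition Vgr : nmodType := isoclass gr_isoData.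

Definition K0gr : zmodType := group_completion Vgr.

Definition Vgr_class (P : grproj) : Vgr := iclass (P : gr_isoData).

Definition K0gr_class (P : grproj) : K0gr := gc_of (Vgr_class P).

Definition K0gr_unit : K0gr := K0gr_class gr_regular.

(* The positive cone of the preorder of K0gr. *)
Definition K0gr_pos : set K0gr := range (@gc_of Vgr).

(** ** The action of Z[x, x^-1] *)

Lemma gr_shift_iso j (P Q : grproj) :
  gr_iso P Q -> gr_iso (gr_shift j P) (gr_shift j Q).
Proof.
by move=> [f [g [fK gK hf hg]]]; exists f, g; split=> // n v; [apply: hf|apply: hg].
Qed.

Lemma gr_shift_sum j (P Q : grproj) :
  gr_iso (gr_shift j (gr_sum P Q)) (gr_sum (gr_shift j P) (gr_shift j Q)).
Proof.
have l : linear (fun z : P * Q => z) by [].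
by exists (mklinear l), (mklinear l).
Qed.

Lemma gr_shift_zero j : gr_iso (gr_shift j gr_zero) gr_zero.
Proof.
have l : linear (fun z : 'rV[A^c]_0 => z) by [].
by exists (mklinear l), (mklinear l).
Qed.

Definition Vgr_shift (j : int) (X : Vgr) : Vgr :=
  Vgr_class (gr_shift j (irepr X)).

Lemma Vgr_surj (X : Vgr) : exists P, X = Vgr_class P.
Proof. by exists (irepr X); rewrite /Vgr_class ireprK. Qed.

Lemma Vgr_shiftE j (P : grproj) :
  Vgr_shift j (Vgr_class P) = Vgr_class (gr_shift j P).
Proof.
by apply/iclassP/gr_shift_iso/(@iclassP gr_isoData); rewrite ireprK.
Qed.

Lemma Vgr_shift_is_nmod_morphism j : nmod_morphism (Vgr_shift j).
Proof.
have E0 : Vgr_shift j 0 = Vgr_class (gr_shift j gr_zero) := Vgr_shiftE j gr_zero.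
have ED P Q : Vgr_shift j (Vgr_class P + Vgr_class Q) =
    Vgr_class (gr_shift j (gr_sum P Q)).
  by rewrite -Vgr_shiftE; congr Vgr_shift; apply: iaddE.
split=> [|X Y]; first by rewrite E0; apply/iclassP/gr_shift_zero.
have [P ->] := Vgr_surj X; have [Q ->] := Vgr_surj Y; rewrite ED !Vgr_shiftE.
transitivity (Vgr_class (gr_sum (gr_shift j P) (gr_shift j Q))).
  exact/iclassP/gr_shift_sum.
by symmetry; apply: iaddE.
Qed.

HB.instance Definition _ j :=
  GRing.isNmodMorphism.Build Vgr Vgr (Vgr_shift j) (Vgr_shift_is_nmod_morphism j).

(* Multiplication by x^j. *)
Definition K0gr_shift (j : int) : {additive K0gr -> K0gr} :=
  gc_map (Vgr_shift j).

Lemma K0gr_shift_class j (P : grproj) :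
  K0gr_shift j (K0gr_class P) = K0gr_class (gr_shift j P).
Proof. by rewrite /= gc_map_of /= Vgr_shiftE. Qed.

Lemma K0gr_surj (z : K0gr) : exists P Q, z = K0gr_class P - K0gr_class Q.
Proof.
elim/gc_ind: z => X Y; have [P ->] := Vgr_surj X; have [Q ->] := Vgr_surj Y.
by exists P, Q.
Qed.

Lemma K0gr_shift0 z : K0gr_shift 0 z = z.
Proof.
have [P [Q ->]] := K0gr_surj z; rewrite (raddfB (K0gr_shift 0)) !K0gr_shift_class.
have l (S : grproj) : linear (fun v : S => v) by [].
have E S : Vgr_class (gr_shift 0 S) = Vgr_class S.
  apply/iclassP; exists (mklinear (l S)), (mklinear (l S)).
  by split=> // n v /=; rewrite add0r.
by rewrite /K0gr_class !E.
Qed.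

Lemma K0gr_shiftD (i j : int) z : K0gr_shift (i + j) z = K0gr_shift i (K0gr_shift j z).
Proof.
have [P [Q ->]] := K0gr_surj z; have B k a b : K0gr_shift k (a - b) = K0gr_shift k a - K0gr_shift k b := raddfB _ a b.
rewrite (B (i + j)) (B j) (B i) !K0gr_shift_class.
have l (S : grproj) : linear (fun v : S => v) by [].
have E S : Vgr_class (gr_shift (i + j) S) = Vgr_class (gr_shift i (gr_shift j S)).
  apply/iclassP; exists (mklinear (l S)), (mklinear (l S)).
  by split=> // n v /=; rewrite addrA [j + i]addrC.
by rewrite /K0gr_class !E.
Qed.

End GradedModules.

(* Laurent polynomials, as finitely supported families of integer coefficients
   indexed by the exponents. *)
Definition laurent := {fsfun int -> int with 0}.

Definition laurent_scale (A : gradedRing) (p : laurent) (z : K0gr A) : K0gr A :=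
  \sum_(j <- finsupp p) K0gr_shift A j z *~ p j.

Definition laurent_linear (A B : gradedRing) (f : K0gr A -> K0gr B) : Prop :=
  forall p z, f (laurent_scale p z) = laurent_scale p (f z).

Definition order_preserving (A B : gradedRing) (f : K0gr A -> K0gr B) : Prop :=
  forall z, K0gr_pos z -> K0gr_pos (f z).

(** * Algebras presented by generators and relations *)

Section PresentedAlgebra.
Variables (K : fieldType) (X : Type).

(* Expressions denoting elements of the free unital K-algebra on X. *)
Inductive aterm : Type :=
| Gen of X
| Zero
| One
| Add of aterm & aterm
| Opp of aterm
| Mul of aterm & aterm
| Scale of K & aterm.

HB.instance Definition _ := gen_eqMixin aterm.
HB.instance Definition _ := gen_choiceMixin aterm.

Variable rels : aterm -> aterm -> Prop.

(* The smallest congruence containing [rels] and the axioms of unital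
   associative K-algebras. *)
Inductive acong : aterm -> aterm -> Prop :=
| ac_rel s t : rels s t -> acong s t
| ac_refl s : acong s s
| ac_sym s t : acong s t -> acong t s
| ac_trans s t u : acong s t -> acong t u -> acong s u
| ac_add s s' t t' : acong s s' -> acong t t' -> acong (Add s t) (Add s' t')
| ac_opp s s' : acong s s' -> acong (Opp s) (Opp s')
| ac_mul s s' t t' : acong s s' -> acong t t' -> acong (Mul s t) (Mul s' t')
| ac_scale a s s' : acong s s' -> acong (Scale a s) (Scale a s')
| ac_addA s t u : acong (Add s (Add t u)) (Add (Add s t) u)
| ac_addC s t : acong (Add s t) (Add t s)
| ac_add0 s : acong (Add Zero s) s
| ac_addN s : acong (Add (Opp s) s) Zero
| ac_mulA s t u : acong (Mul s (Mul t u)) (Mul (Mul s t) u)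
| ac_mul1l s : acong (Mul One s) s
| ac_mul1r s : acong (Mul s One) s
| ac_mulDl s t u : acong (Mul (Add s t) u) (Add (Mul s u) (Mul t u))
| ac_mulDr s t u : acong (Mul s (Add t u)) (Add (Mul s t) (Mul s u))
| ac_scaleA a b s : acong (Scale a (Scale b s)) (Scale (a * b) s)
| ac_scale1 s : acong (Scale 1 s) s
| ac_scaleDr a s t : acong (Scale a (Add s t)) (Add (Scale a s) (Scale a t))
| ac_scaleDl a b s : acong (Scale (a + b) s) (Add (Scale a s) (Scale b s))
| ac_scaleAl a s t : acong (Scale a (Mul s t)) (Mul (Scale a s) t)
| ac_scaleAr a s t : acong (Scale a (Mul s t)) (Mul s (Scale a t)).

Definition acongb s t := `[< acong s t >].

Lemma acongb_refl : reflexive acongb.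
Proof. by move=> s; apply/asboolP/ac_refl. Qed.

Lemma acongb_sym : symmetric acongb.
Proof. by move=> s t; apply/asboolP/asboolP; apply: ac_sym. Qed.

Lemma acongb_trans : transitive acongb.
Proof. by move=> t s u /asboolP h /asboolP h'; apply/asboolP/(ac_trans h). Qed.

Canonical acongb_equiv := EquivRel acongb acongb_refl acongb_sym acongb_trans.

Definition presented := {eq_quot acongb}.
HB.instance Definition _ := Choice.on presented.

Definition peval (s : aterm) : presented := \pi_{eq_quot acongb} s.
Definition prepr (x : presented) : aterm := repr x.

Lemma preprK x : peval (prepr x) = x. Proof. exact: reprK. Qed.

Lemma pevalP s t : peval s = peval t <-> acong s t.
Proof. by split=> [/eqmodP/asboolP|h] //; apply/eqmodP/asboolP. Qed.

Lemma prepr_cong s : acong (prepr (peval s)) s.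
Proof. by apply/pevalP; rewrite preprK. Qed.

Lemma psurj (x : presented) : exists s, x = peval s.
Proof. by exists (prepr x); rewrite preprK. Qed.

Definition padd x y := peval (Add (prepr x) (prepr y)).
Definition popp x := peval (Opp (prepr x)).
Definition pmul x y := peval (Mul (prepr x) (prepr y)).
Definition pscale a x := peval (Scale a (prepr x)).

Lemma paddE s t : padd (peval s) (peval t) = peval (Add s t).
Proof. by apply/pevalP/ac_add; apply: prepr_cong. Qed.
Lemma poppE s : popp (peval s) = peval (Opp s).
Proof. by apply/pevalP/ac_opp; apply: prepr_cong. Qed.
Lemma pmulE s t : pmul (peval s) (peval t) = peval (Mul s t).
Proof. by apply/pevalP/ac_mul; apply: prepr_cong. Qed.
Lemma pscaleE a s : pscale a (peval s) = peval (Scale a s).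
Proof. by apply/pevalP/ac_scale; apply: prepr_cong. Qed.

Let pE := (paddE, poppE, pmulE, pscaleE).

Ltac by_cong c := intros; repeat (let x := fresh in intro x);
  repeat match goal with x : presented |- _ =>
    let s := fresh in case: (psurj x) => s ->; clear x end;
  rewrite !pE; apply/pevalP; apply: c.

Lemma paddA : associative padd.
Proof. by by_cong ac_addA. Qed.
Lemma paddC : commutative padd.
Proof. by by_cong ac_addC. Qed.
Lemma padd0 : left_id (peval Zero) padd.
Proof. by by_cong ac_add0. Qed.
Lemma paddN : left_inverse (peval Zero) popp padd.
Proof. by by_cong ac_addN. Qed.

HB.instance Definition _ := GRing.isZmodule.Build presented paddA paddC padd0 paddN.

Lemma pmulA : associative pmul.
Proof. by by_cong ac_mulA. Qed.
Lemma pmul1l : left_id (peval One) pmul.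
Proof. by by_cong ac_mul1l. Qed.
Lemma pmul1r : right_id (peval One) pmul.
Proof. by by_cong ac_mul1r. Qed.
Lemma pmulDl : left_distributive pmul padd.
Proof. by by_cong ac_mulDl. Qed.
Lemma pmulDr : right_distributive pmul padd.
Proof. by by_cong ac_mulDr. Qed.

HB.instance Definition _ :=
  GRing.Zmodule_isPzRing.Build presented pmulA pmul1l pmul1r pmulDl pmulDr.

Lemma pscaleA a b x : pscale a (pscale b x) = pscale (a * b) x.
Proof. by by_cong ac_scaleA. Qed.
Lemma pscale1 : left_id 1 pscale.
Proof. by by_cong ac_scale1. Qed.
Lemma pscaleDr : right_distributive pscale padd.
Proof. by by_cong ac_scaleDr. Qed.
Lemma pscaleDl x : {morph pscale^~ x : a b / a + b >-> padd a b}.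
Proof. by by_cong ac_scaleDl. Qed.

HB.instance Definition _ :=
  GRing.Zmodule_isLmodule.Build K presented pscaleA pscale1 pscaleDr pscaleDl.

Lemma pscaleAl a x y : pscale a (pmul x y) = pmul (pscale a x) y.
Proof. by by_cong ac_scaleAl. Qed.
Lemma pscaleAr a x y : pscale a (pmul x y) = pmul x (pscale a y).
Proof. by by_cong ac_scaleAr. Qed.

(* [presented] may be the zero ring, so that it is not an [algType K]. *)
Lemma presented_scalerAl a (x y : presented) : a *: (x * y) = (a *: x) * y.
Proof. exact: pscaleAl. Qed.
Lemma presented_scalerAr a (x y : presented) : a *: (x * y) = x * (a *: y).
Proof. exact: pscaleAr. Qed.

(** ** The grading determined by degrees of the generators *)

Variable deg : X -> int.

(* Expressions all of whose monomials have degree n. Their values form the span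
   of the products of generators of total degree n. *)
Inductive homog : int -> aterm -> Prop :=
| hg_gen x : homog (deg x) (Gen x)
| hg_zero n : homog n Zero
| hg_one : homog 0 One
| hg_add n s t : homog n s -> homog n t -> homog n (Add s t)
| hg_opp n s : homog n s -> homog n (Opp s)
| hg_mul m n s t : homog m s -> homog n t -> homog (m + n) (Mul s t)
| hg_scale n a s : homog n s -> homog n (Scale a s).

Definition presented_comp (n : int) : set presented :=
  [set x | exists s, homog n s /\ x = peval s].

Hypothesis rels_homog : forall s t, rels s t -> exists n, homog n s /\ homog n t.

(* The homogeneous components of an expression, as a list of pairs of a degree
   and an element of that degree. *)
Fixpoint hcomps (s : aterm) : seq (int * presented) :=
  match s with
  | Gen x => [:: (deg x, peval (Gen x))]
  | Zero => [::]
  | One => [:: (0, 1)]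
  | Add s t => hcomps s ++ hcomps t
  | Opp s => [seq (x.1, - x.2) | x <- hcomps s]
  | Mul s t => [seq (x.1 + y.1, x.2 * y.2) | x <- hcomps s, y <- hcomps t]
  | Scale a s => [seq (x.1, a *: x.2) | x <- hcomps s]
  end.

Definition hcoef (n : int) (s : aterm) : presented :=
  \sum_(x <- hcomps s | x.1 == n) x.2.

Lemma hcoef_mull n s t :
  hcoef n (Mul s t) = \sum_(y <- hcomps t) hcoef (n - y.1) s * y.2.
Proof.
rewrite /hcoef /= big_mkcond big_allpairs_dep /= exchange_big; apply: eq_bigr => y _.
rewrite mulr_suml [RHS]big_mkcond; apply: eq_bigr => x _ /=.
by rewrite eq_sym -subr_eq eq_sym.
Qed.

Lemma hcoef_mulr n s t :
  hcoef n (Mul s t) = \sum_(x <- hcomps s) x.2 * hcoef (n - x.1) t.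
Proof.
rewrite /hcoef /= big_mkcond big_allpairs_dep /=; apply: eq_bigr => x _.
rewrite mulr_sumr [RHS]big_mkcond; apply: eq_bigr => y _ /=.
by rewrite [x.1 + _]addrC eq_sym -subr_eq eq_sym.
Qed.

Lemma hcoef_add n s t : hcoef n (Add s t) = hcoef n s + hcoef n t.
Proof. by rewrite /hcoef big_cat. Qed.

Lemma hcoef_opp n s : hcoef n (Opp s) = - hcoef n s.
Proof. by rewrite /hcoef big_map sumrN. Qed.

Lemma hcoef_scale n a s : hcoef n (Scale a s) = a *: hcoef n s.
Proof. by rewrite /hcoef big_map scaler_sumr. Qed.

Lemma hcomps_homog m s : homog m s -> {in hcomps s, forall x, x.1 = m}.
Proof.
elim=> //= [x y|y|n {}s t _ IHs _ IHt x|n {}s _ IHs _ /mapP[y ys ->]|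
  i j {}s t _ IHs _ IHt _ /allpairsP[[y z] [ys zs ->]]|n a {}s _ IHs _ /mapP[y ys ->]].
- by rewrite inE => /eqP->.
- by rewrite inE => /eqP->.
- by rewrite mem_cat => /orP[/IHs|/IHt].
- exact: (IHs _ ys).
- by rewrite /= (IHs _ ys) (IHt _ zs).
- exact: (IHs _ ys).
Qed.

Lemma sum_hcomps s : \sum_(x <- hcomps s) x.2 = peval s.
Proof.
elim: s => [x|||s IHs t IHt|s IHs|s IHs t IHt|a s IHs] /=.
- by rewrite big_seq1.
- by rewrite big_nil.
- by rewrite big_seq1.
- by rewrite big_cat /= IHs IHt [LHS]paddE.
- by rewrite big_map sumrN IHs [LHS]poppE.
- have -> : peval (Mul s t) = peval s * peval t by rewrite [RHS]pmulE.
  rewrite big_allpairs_dep /= -IHs -IHt.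
  by rewrite mulr_suml; apply: eq_bigr => x _; rewrite mulr_sumr.
- by rewrite big_map -scaler_sumr IHs [LHS]pscaleE.
Qed.

Lemma hcoef_homog m n s : homog m s ->
  hcoef n s = if m == n then peval s else 0.
Proof.
move=> /hcomps_homog h; rewrite /hcoef big_seq_cond -sum_hcomps.
case: eqVneq => [<-|mn].
  rewrite [RHS]big_seq; apply: eq_bigl => x.
  by case: (boolP (x \in _)) => //= /h->; rewrite eqxx.
by apply: big_pred0 => x; apply: contraNF mn => /andP[/h->].
Qed.

Lemma hcoef_cong s t : acong s t -> forall n, hcoef n s = hcoef n t.
Proof.
elim=> {s t}.
- move=> s t r n; have [m [hs ht]] := rels_homog r.
  rewrite (hcoef_homog _ hs) (hcoef_homog _ ht).
  by have -> : peval s = peval t by apply/pevalP/ac_rel.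
- by [].
- by move=> s t _ IH n; rewrite IH.
- by move=> s t u _ IH _ IH' n; rewrite IH IH'.
- by move=> s s' t t' _ IH _ IH' n; rewrite !hcoef_add IH IH'.
- by move=> s s' _ IH n; rewrite !hcoef_opp IH.
- move=> s s' t t' _ IH _ IH' n; transitivity (hcoef n (Mul s' t)).
    by rewrite !hcoef_mull; apply: eq_bigr => y _; rewrite IH.
  by rewrite !hcoef_mulr; apply: eq_bigr => y _; rewrite IH'.
- by move=> a s s' _ IH n; rewrite !hcoef_scale IH.
- by move=> s t u n; rewrite !hcoef_add addrA.
- by move=> s t n; rewrite !hcoef_add addrC.
- by move=> s n; rewrite !hcoef_add /hcoef big_nil add0r.
- by move=> s n; rewrite hcoef_add hcoef_opp addNr /hcoef big_nil.
- move=> s t u n; rewrite hcoef_mulr [RHS]hcoef_mull.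
  under eq_bigr => x _ do rewrite hcoef_mull mulr_sumr.
  rewrite exchange_big; apply: eq_bigr => y _; rewrite hcoef_mulr mulr_suml.
  by apply: eq_bigr => x _; rewrite mulrA addrAC.
- by move=> s n; rewrite hcoef_mulr big_seq1 mul1r subr0.
- by move=> s n; rewrite hcoef_mull big_seq1 mulr1 subr0.
- move=> s t u n; rewrite hcoef_add !hcoef_mull -big_split.
  by apply: eq_bigr => x _; rewrite hcoef_add mulrDl.
- move=> s t u n; rewrite hcoef_add !hcoef_mulr -big_split.
  by apply: eq_bigr => x _; rewrite hcoef_add mulrDr.
- by move=> a b s n; rewrite !hcoef_scale scalerA.
- by move=> s n; rewrite hcoef_scale scale1r.
- by move=> a s t n; rewrite !(hcoef_scale, hcoef_add) scalerDr.
- by move=> a b s n; rewrite !(hcoef_scale, hcoef_add) scalerDl.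
- move=> a s t n; rewrite hcoef_scale !hcoef_mull scaler_sumr.
  by apply: eq_bigr => x _; rewrite hcoef_scale presented_scalerAl.
- move=> a s t n; rewrite hcoef_scale !hcoef_mulr scaler_sumr.
  by apply: eq_bigr => x _; rewrite hcoef_scale presented_scalerAr.
Qed.

Definition pcoef n (x : presented) := hcoef n (prepr x).

Lemma pcoefE n s : pcoef n (peval s) = hcoef n s.
Proof. exact/hcoef_cong/prepr_cong. Qed.

Lemma pcoef_is_nmod_morphism n : nmod_morphism (pcoef n).
Proof.
split=> [|x y]; first by rewrite pcoefE /hcoef big_nil.
case: (psurj x) => s ->; case: (psurj y) => t ->.
by rewrite [X in pcoef n X]paddE !pcoefE hcoef_add.
Qed.

HB.instance Definition _ n :=
  GRing.isNmodMorphism.Build presented presented (pcoef n) (pcoef_is_nmod_morphism n).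

Lemma presented_comp_sub n x y :
  presented_comp n x -> presented_comp n y -> presented_comp n (x - y).
Proof.
move=> [s [hs ->]] [t [ht ->]]; exists (Add s (Opp t)).
by split; [apply/hg_add/hg_opp|rewrite [- _]poppE [LHS]paddE].
Qed.

Lemma presented_comp_hcomps s : {in hcomps s, forall x, presented_comp x.1 x.2}.
Proof.
elim: s => [x y|//|x|s IHs t IHt x|s IHs _ /mapP[y ys ->]|
  s IHs t IHt _ /allpairsP[[y z] [/IHs ys /IHt zs ->]]|a s IHs _ /mapP[y /IHs ys ->]] /=.
- by rewrite inE => /eqP-> /=; exists (Gen x); split=> //; apply: hg_gen.
- by rewrite inE => /eqP-> /=; exists One; split=> //; apply: hg_one.
- by rewrite mem_cat => /orP[/IHs|/IHt].
- by have [u [hu ->]] := IHs _ ys; exists (Opp u); split; [apply: hg_opp|rewrite [LHS]poppE].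
- have [u [hu ->]] := ys; have [v [hv ->]] := zs; exists (Mul u v).
  by split; [apply: hg_mul|rewrite [LHS]pmulE].
- by have [u [hu ->]] := ys; exists (Scale a u); split; [apply: hg_scale|rewrite [LHS]pscaleE].
Qed.

Lemma presented_is_grading : is_grading presented_comp.
Proof.
split=> [n|x|s f us hf e n ns].
- split; first by exists Zero; split=> //; apply: hg_zero.
  by move=> x y; apply: presented_comp_sub.
- have [s ->] := psurj x; exists (hcomps s); rewrite sum_hcomps.
  by split=> //; apply: presented_comp_hcomps.
- have := congr1 (pcoef n) e; rewrite raddf_sum raddf0 => <- /=.
  have E m : pcoef n (f m) = if m == n then f m else 0.
    by have [t [ht ->]] := hf m; rewrite pcoefE (hcoef_homog _ ht).
  rewrite (bigD1_seq n) //= E eqxx big1 ?addr0 // => m mn.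
  by rewrite E (negPf mn).
Qed.

Lemma presented_comp1 : presented_comp 0 1.
Proof. by exists One; split=> //; apply: hg_one. Qed.

Lemma presented_compM m n x y :
  presented_comp m x -> presented_comp n y -> presented_comp (m + n) (x * y).
Proof.
move=> [s [hs ->]] [t [ht ->]]; exists (Mul s t).
by split; [apply: hg_mul|rewrite [LHS]pmulE].
Qed.

Definition presented_graded : gradedRing :=
  GradedRing presented_is_grading presented_comp1 presented_compM.

End PresentedAlgebra.

Arguments Zero {K X}.
Arguments One {K X}.
Arguments Gen {K X}.

(** * Leavitt path algebras *)

Record finDigraph := FinDigraph {
  dvert : finType;
  dedge : finType;
  dsrc : dedge -> dvert;
  drng : dedge -> dvert
}.

Definition sink (E : finDigraph) (v : dvert E) : bool :=
  [forall e : dedge E, dsrc e != v].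

Section Leavitt.
Variables (K : fieldType) (E : finDigraph).

Inductive lpa_gen : Type :=
| Vert of dvert E
| Edge of dedge E
| Ghost of dedge E.

Local Notation term := (aterm K lpa_gen).
Local Notation vert v := (Gen (Vert v) : term).
Local Notation edge e := (Gen (Edge e) : term).
Local Notation ghost e := (Gen (Ghost e) : term).

Definition term_sum (s : seq term) : term := foldr (@Add K lpa_gen) Zero s.

Definition term_delta (b : bool) (t : term) : term := if b then t else Zero.

(* [lr_unit] makes the sum of the vertices the identity of the algebra; it does
   not follow from the other relations in the free unital algebra. *)
Inductive lpa_rel : term -> term -> Prop :=
| lr_unit : lpa_rel One (term_sum [seq vert v | v <- enum (dvert E)])
| lr_vert u v : lpa_rel (Mul (vert u) (vert v)) (term_delta (u == v) (vert u))
| lr_src e : lpa_rel (Mul (vert (dsrc e)) (edge e)) (edge e)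
| lr_rng e : lpa_rel (Mul (edge e) (vert (drng e))) (edge e)
| lr_ghost_rng e : lpa_rel (Mul (vert (drng e)) (ghost e)) (ghost e)
| lr_ghost_src e : lpa_rel (Mul (ghost e) (vert (dsrc e))) (ghost e)
| lr_ck1 e f :
    lpa_rel (Mul (ghost e) (edge f)) (term_delta (e == f) (vert (drng e)))
| lr_ck2 v : ~~ sink v ->
    lpa_rel (vert v)
      (term_sum [seq Mul (edge e) (ghost e) | e <- enum (dedge E) & dsrc e == v]).

Definition lpa_deg (x : lpa_gen) : int :=
  match x with Vert _ => 0 | Edge _ => 1 | Ghost _ => -1 end.

Lemma homog_sum n (s : seq term) : (forall t, t \in s -> homog lpa_deg n t) ->
  homog lpa_deg n (term_sum s).
Proof.
elim: s => [|t s IH] h /=; first exact: hg_zero.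
by apply: hg_add; [apply/h/mem_head|apply: IH => u us; apply: h; rewrite in_cons us orbT].
Qed.

Lemma lpa_rel_homog s t : lpa_rel s t ->
  exists n, homog lpa_deg n s /\ homog lpa_deg n t.
Proof.
have hv v : homog lpa_deg 0 (vert v) by apply: (hg_gen K lpa_deg (Vert v)).
have he e : homog lpa_deg 1 (edge e) by apply: (hg_gen K lpa_deg (Edge e)).
have hg e : homog lpa_deg (-1) (ghost e) by apply: (hg_gen K lpa_deg (Ghost e)).
have hd b v : homog lpa_deg 0 (term_delta b (vert v)).
  by case: b; [apply: hv|apply: hg_zero].
case=> {s t} [|u v|e|e|e|e|e f|v _].
- exists 0; split; first exact: hg_one.
  by apply: homog_sum => _ /mapP[v _ ->].
- by exists 0; split=> //; rewrite -[0]addr0; apply: hg_mul.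
- by exists 1; split=> //; rewrite -[1]add0r; apply: hg_mul.
- by exists 1; split=> //; rewrite -[1]addr0; apply: hg_mul.
- by exists (-1); split=> //; rewrite -[-1]add0r; apply: hg_mul.
- by exists (-1); split=> //; rewrite -[-1]addr0; apply: hg_mul.
- by exists 0; split=> //; rewrite -[0](addNr 1); apply: hg_mul.
- exists 0; split=> //; apply: homog_sum => _ /mapP[e _ ->].
  by rewrite -[0](addrN 1); apply: hg_mul.
Qed.

Definition leavitt : gradedRing := presented_graded lpa_rel_homog.

End Leavitt.

(* Main.v *)
(* K0(L(E)) is the quotient of K0gr(L(E)) by the shifts, so that an isomorphism of
   Z[x, x^-1]-modules induces the required one. To see this, let Q be the path
   algebra inside L = L(E) and J its edge ideal.
   - Every element of L is multiplied into Q by all paths of some length. Hence a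
     finitely generated projective L-module P, embedded in L^n, contains a
     generating Q-submodule of Q^n; the weak algorithm of Q turns its generators
     into an L-basis: elements m_i with P the direct sum of the m_i L, where m_i L
     is isomorphic to v_i L. If P is graded, the m_i can be taken homogeneous. So
     the classes of the v L generate K0(L), and their shifts generate K0gr(L).
   - If h(v) is the sum of the h(r(e)) over s(e) = v, then the sum of the h(v_i) is
     the same for all L-bases of P, so that h extends to K0(L). Indeed, passing
     from m_i to the m_i e does not change the sum, which reduces to L-bases
     spanning Q-submodules M <= M' with M' J^n <= M. Then one compares the
     dimensions at each vertex in MJ <= M <= M' and MJ <= M'J <= M', where
     M'J/MJ is determined by M'/M because J is free as a left Q-module. *)
From HB Require Import structures.
Require Import Defs.
From mathcomp Require Import all_boot all_order all_algebra.
From mathcomp Require Import boolp classical_sets finmap.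
From mathcomp Require Import zify.

Set Implicit Arguments.
Unset Strict Implicit.
Unset Printing Implicit Defensive.

Import GRing.Theory.
Local Open Scope ring_scope.
Local Open Scope classical_set_scope.


(** * Linear algebra modulo a subspace *)

(** The induced map and its inverse both come from a universal property of K0: the theorem takes for
    h(v) the ungraded class of the image of [vL] in the other group. The relation required of h
    holds because [vL] is the sum of the x^-1 [r(e)L] in K0gr and forgetting the grading forgets x.
    Two features of L stand in the way of h being well defined on K0. The cardinality of an L-basis
    is no invariant, and degrees in L are not bounded below, so that L itself has no division by
    leading forms. In Q degrees are lengths of words, and Q/J is a product of copies of K, one for
    each vertex, which turns ranks into dimensions. The absence of sinks gives 1 as the sum of all e
    e^*. Hence an element of L annihilated by all words of one length is zero, and relations over L
    can be tested over Q. Dimension counts also need v to be nonzero in L. A presentation does not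
    show this; an explicit module does. *)

Lemma exists_argmin (T : Type) (P : T -> Prop) (f : T -> nat) :
  (exists t, P t) -> exists2 t, P t & forall u, P u -> (f t <= f u)%N.
Proof.
move=> [t0 Pt0].
have ex : exists n, `[< exists2 t, P t & f t = n >].
  by exists (f t0); apply/asboolP; exists t0.
case: (ex_minnP ex) => m /asboolP[t Pt <-] mn; exists t => // u Pu.
by apply: mn; apply/asboolP; exists u.
Qed.

Lemma gradingD (V : zmodType) (G : int -> set V) n x y :
  is_grading G -> G n x -> G n y -> G n (x + y).
Proof.
move=> [/(_ n)[G0 GB] _ _] hx hy; rewrite -[y]opprK; apply: (GB) => //.
by rewrite -[- y]add0r; apply: GB.
Qed.

Section LinearAlgebra.
Variables (K : fieldType) (V : lmodType K).
Implicit Types (A B C : set V).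

Definition subspace A := A 0 /\ forall (c : K) u v, A u -> A v -> A (c *: u + v).

(** Independence in the quotient by [A]. Subspaces stay predicates, so that the quotients compared
    later, such as M'/MJ, never have to be constructed. *)
Definition free_mod A (I : finType) (D : pred I) (x : I -> V) :=
  forall c : I -> K, A (\sum_(i | D i) c i *: x i) -> forall i, D i -> c i = 0.

Definition span_mod A B (I : finType) (D : pred I) (x : I -> V) :=
  forall b, B b -> exists c : I -> K, A (b - \sum_(i | D i) c i *: x i).

Lemma subspaceD A u v : subspace A -> A u -> A v -> A (u + v).
Proof. by move=> [_ h] hu hv; rewrite -[u]scale1r; apply: h. Qed.

Lemma subspaceZ A (c : K) u : subspace A -> A u -> A (c *: u).
Proof. by move=> [h0 h] hu; rewrite -[_ *: _]addr0; apply: h. Qed.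

Lemma subspaceB A u v : subspace A -> A u -> A v -> A (u - v).
Proof. by move=> h hu hv; rewrite -scaleN1r; apply: subspaceD => //; apply: subspaceZ. Qed.

Lemma subspace_sum A (I : Type) (r : seq I) (D : pred I) (F : I -> V) :
  subspace A -> (forall i, D i -> A (F i)) -> A (\sum_(i <- r | D i) F i).
Proof. by move=> h hF; apply: (big_ind A) => // [|u v]; [case: h|apply: subspaceD]. Qed.

(** The matrix expressing the [x i] through the [x' j] modulo [A] has independent rows: a row vector
    annihilating it is a relation among the [x i] modulo [A]. *)
Lemma free_span_card A B (I I' : finType) (D : pred I) (D' : pred I') x x' :
  subspace A -> (forall i, D i -> B (x i)) ->
  free_mod A D x -> span_mod A B D' x' -> (#|D| <= #|D'|)%N.
Proof.
move=> sA xB xfree x'span.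
have [C hC] : {C : I -> I' -> K & forall i, D i -> A (x i - \sum_(j | D' j) C i j *: x' j)}.
  apply: (@choice _ _ (fun i c => D i -> A (x i - \sum_(j | D' j) c j *: x' j))) => i.
  have [Di|nD] := boolP (D i); last by exists (fun=> 0).
  by have [c hc] := x'span _ (xB _ Di); exists c.
pose M := \matrix_(i < #|D|, j < #|D'|) C (enum_val i) (enum_val j).
suff /eqP <- : row_free M by apply: rank_leq_col.
apply: inj_row_free => u uM.
pose c i := if [pick k | enum_val k == i :> I] is Some k then u 0 k else 0.
have cE (k : 'I_#|D|) : c (enum_val k) = u 0 k.
  by rewrite /c; case: pickP => [k' /eqP/enum_val_inj ->//|/(_ k)/eqP].
have sumE (W : zmodType) (F : I -> W) : \sum_(i | D i) F i = \sum_(k < #|D|) F (enum_val k).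
  by rewrite -(big_enum_val F).
have sumE' (W : zmodType) (F : I' -> W) : \sum_(i | D' i) F i = \sum_(k < #|D'|) F (enum_val k).
  by rewrite -(big_enum_val F).
apply/rowP => k; rewrite mxE -cE; apply: xfree; last exact: enum_valP.
(* Since [u] annihilates [M], the terms in [x'] cancel in total; subtracting them makes every
   summand an element of [A]. *)
have -> : \sum_(i | D i) c i *: x i =
   \sum_(i | D i) c i *: (x i - \sum_(j | D' j) C i j *: x' j).
  apply/eqP; rewrite -subr_eq0 -sumrB; apply/eqP.
  under eq_bigr => i _ do rewrite -scalerBr opprB addrC subrK scaler_sumr.
  rewrite exchange_big big1 // => j Dj; under eq_bigr => i _ do rewrite scalerA.
  rewrite -scaler_suml sumE; have := congr1 (fun m : 'rV_#|D'| => m 0 (enum_rank_in Dj j)) uM.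
  rewrite !mxE => e; rewrite [X in X *: _](_ : _ = 0) ?scale0r // -[RHS]e.
  by apply: eq_bigr => i _; rewrite mxE cE enum_rankK_in.
by apply: subspace_sum => // i Di; apply: subspaceZ => //; apply: hC.
Qed.

Lemma span_mod_free A B (I : finType) (D : pred I) (x : I -> V) :
  subspace A -> span_mod A B D x ->
  exists D' : pred I, [/\ subpred D' D, span_mod A B D' x & free_mod A D' x].
Proof.
move=> sA sp.
have [|D' [sD' spD'] mn] := @exists_argmin (pred I)
   (fun D' => subpred D' D /\ span_mod A B D' x) (fun D' => #|D'|).
  by exists D; split.
exists D'; split=> // c hc i Di; apply/eqP; apply: contraT => ci0.
suff /mn : subpred (predD1 D' i) D /\ span_mod A B (predD1 D' i) x.
  rewrite [X in (X <= _)%N](cardD1 i).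
  by rewrite (_ : i \in D' = true) // add1n ltnn.
split=> [j /andP[_ /sD']//|b hb].
have [a ha] := spD' _ hb.
(* The relation [c], divided by [c i], eliminates [x i]. *)
exists (fun j => a j - a i * (c i)^-1 * c j).
have := subspaceD sA ha (subspaceZ (a i / c i) sA hc).
congr (A _); rewrite -addrA; congr (_ + _).
rewrite scaler_sumr addrC -sumrB (bigD1 i) //= scalerA divfK // subrr add0r.
rewrite -sumrN; apply: eq_big => [j|j _]; first by rewrite andbC.
by rewrite scalerA -scalerBl -scaleNr opprB.
Qed.

End LinearAlgebra.

(** * The path algebra inside a Leavitt path algebra *)

(* The properties of L(E) that the proof uses. Working with a variable A keeps the
   presentation of L(E) from being unfolded during unification. *)
Record lpa_family (K : fieldType) (E : finDigraph) (A : gradedRing) := LpaFamily {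
  lsc : K -> A;
  lve : dvert E -> A;
  led : dedge E -> A;
  lgh : dedge E -> A;
  lcoef : int -> A -> A;
  lscD : {morph lsc : a b / a + b};
  lscM : {morph lsc : a b / a * b};
  lsc1 : lsc 1 = 1;
  lscC : forall c a, lsc c * a = a * lsc c;
  lve_sum : 1 = \sum_v lve v;
  lveM : forall u v, lve u * lve v = if u == v then lve u else 0;
  lve_neq0 : forall v, lve v <> 0;
  lsrcM : forall e, lve (dsrc e) * led e = led e;
  lrngM : forall e, led e * lve (drng e) = led e;
  lsrc_gh : forall e, lgh e * lve (dsrc e) = lgh e;
  lgh_ed : forall e f, lgh e * led f = if e == f then lve (drng e) else 0;
  lck2 : forall v, lve v = \sum_(e | dsrc e == v) led e * lgh e;
  lsc_comp : forall c, gcomp 0 (lsc c);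
  lve_comp : forall v, gcomp 0 (lve v);
  led_comp : forall e, gcomp 1 (led e);
  lcoefD : forall n, {morph lcoef n : a b / a + b};
  lcoefE : forall m n a, gcomp n a -> lcoef m a = if n == m then a else 0;
  lpa_ind : forall S : A -> Prop, (forall c, S (lsc c)) -> (forall v, S (lve v)) ->
    (forall e, S (led e)) -> (forall e, S (lgh e)) ->
    (forall a b, S a -> S b -> S (a + b)) -> (forall a b, S a -> S b -> S (a * b)) ->
    forall a, S a
}.

Section PathSpan.
Variables (K : fieldType) (E : finDigraph) (A : gradedRing) (L : lpa_family K E A).
Local Notation sc := (lsc L).
Local Notation ve := (lve L).
Local Notation ed := (led L).
Local Notation gh := (lgh L).
Local Notation E0 := (dvert E).
Local Notation E1 := (dedge E).

Lemma lsc0 : sc 0 = 0.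
Proof. by apply: (addIr (sc 0)); rewrite -lscD !add0r. Qed.

Lemma lscN c : sc (- c) = - sc c.
Proof. by apply: (addIr (sc c)); rewrite -lscD !addNr lsc0. Qed.

Lemma lsc_eq0 c v : sc c * ve v = 0 -> c = 0.
Proof.
move=> h; apply/eqP/contraT => c0; apply: False_ind; apply: (lve_neq0 (l:=L) (v:=v)).
by rewrite -[ve v]mul1r -(lsc1 L) -(mulVf c0) lscM -mulrA h mulr0.
Qed.

Lemma comp0 n : @gcomp A n 0.
Proof. by have [/(_ n)[]] := gcomp_grading A. Qed.
Lemma compB n a b : @gcomp A n a -> gcomp n b -> gcomp n (a - b).
Proof. by have [/(_ n)[_ h] _ _] := gcomp_grading A; apply: h. Qed.
Lemma compN n a : @gcomp A n a -> gcomp n (- a).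
Proof. by move=> h; rewrite -[- a]add0r; apply/compB/h/comp0. Qed.
Lemma compD n a b : @gcomp A n a -> gcomp n b -> gcomp n (a + b).
Proof. by move=> ha hb; rewrite -[b]opprK; apply/compB/compN. Qed.
Lemma lcoef0 n : lcoef L n 0 = 0.
Proof. by rewrite (lcoefE _ _ (comp0 n)) eqxx. Qed.

Lemma lcoefN n a : lcoef L n (- a) = - lcoef L n a.
Proof. by apply: (addIr (lcoef L n a)); rewrite -lcoefD !addNr lcoef0. Qed.

Lemma lcoef_sum n (I : Type) (r : seq I) (D : pred I) (F : I -> A) :
  lcoef L n (\sum_(i <- r | D i) F i) = \sum_(i <- r | D i) lcoef L n (F i).
Proof. by apply: big_morph; [apply: lcoefD|apply: lcoef0]. Qed.

(** Relation (4) summed over all vertices, none of which is a sink. *)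
Lemma sum_ed_gh : 1 = \sum_e ed e * gh e.
Proof.
rewrite (lve_sum L); under eq_bigr => v _ do rewrite (lck2 L).
rewrite (exchange_big_dep xpredT) //=; apply: eq_bigr => e _.
by rewrite (big_pred1 (dsrc e)) // => v; rewrite eq_sym.
Qed.

Lemma eq0_ed_right x : (forall e, x * ed e = 0) -> x = 0.
Proof.
move=> h; rewrite -[x]mulr1 sum_ed_gh mulr_sumr big1 // => e _.
by rewrite mulrA h mul0r.
Qed.

Lemma eq0_gh_left x : (forall e, gh e * x = 0) -> x = 0.
Proof.
move=> h; rewrite -[x]mul1r sum_ed_gh mulr_suml big1 // => e _.
by rewrite -mulrA h mulr0.
Qed.

Lemma ve_ed v e : ve v * ed e = if v == dsrc e then ed e else 0.
Proof.
rewrite -[in LHS](lsrcM L e) mulrA lveM.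
by case: eqP => [->|_]; rewrite ?mul0r ?lsrcM.
Qed.

Lemma ed_ve v e : ed e * ve v = if v == drng e then ed e else 0.
Proof.
rewrite -[in LHS](lrngM L e) -mulrA lveM eq_sym.
by case: eqP => _; rewrite ?mulr0 ?lrngM.
Qed.

Lemma gh_ve v e : gh e * ve v = if v == dsrc e then gh e else 0.
Proof.
rewrite -[in LHS](lsrc_gh L e) -mulrA lveM eq_sym.
by case: eqP => _; rewrite ?mulr0 ?lsrc_gh.
Qed.

Definition word (p : seq E1) : A := \prod_(e <- p) ed e.

Lemma word_nil : word [::] = 1. Proof. exact: big_nil. Qed.
Lemma word_cons e p : word (e :: p) = ed e * word p. Proof. exact: big_cons. Qed.
Lemma word_cat p q : word (p ++ q) = word p * word q. Proof. exact: big_cat. Qed.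
Lemma word_rcons p e : word (rcons p e) = word p * ed e.
Proof. by rewrite -cats1 word_cat word_cons word_nil mulr1. Qed.

(** Together with [ps_absorb], this reduces the vanishing of an element of L to identities in the
    path algebra. *)
Lemma eq0_word_right n x : (forall p, size p = n -> x * word p = 0) -> x = 0.
Proof.
elim: n x => [|n IH] x h; first by rewrite -[x]mulr1 -word_nil h.
apply: eq0_ed_right => e; apply: IH => p sp.
by rewrite -mulrA -word_cons h //= sp.
Qed.

(* For all S, this is the image of the path algebra: a word which is not a path
   evaluates to 0. *)
Implicit Type S : pred nat.

Inductive pspan (S : pred nat) : A -> Prop :=
| ps0 : pspan S 0
| psD a b : pspan S a -> pspan S b -> pspan S (a + b)
| ps_word c q v : S (size q) -> pspan S (sc c * (word q * ve v)).

Lemma ps_sum S (I : Type) (r : seq I) (D : pred I) (F : I -> A) :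
  (forall i, D i -> pspan S (F i)) -> pspan S (\sum_(i <- r | D i) F i).
Proof. by move=> h; apply: (big_ind (pspan S)) => // [|a b]; [apply: ps0|apply: psD]. Qed.

Lemma psZ S c a : pspan S a -> pspan S (sc c * a).
Proof.
elim=> [|x y _ hx _ hy|d q v h]; first by rewrite mulr0; apply: ps0.
- by rewrite mulrDr; apply: psD.
- by rewrite mulrA -lscM; apply: ps_word.
Qed.

Lemma psN S a : pspan S a -> pspan S (- a).
Proof. by move=> /(psZ (-1)); rewrite lscN lsc1 mulN1r. Qed.

Lemma ps_sub (S S' : pred nat) a : subpred S S' -> pspan S a -> pspan S' a.
Proof.
by move=> h; elim=> [|x y _ hx _ hy|d q v /h hq]; [apply: ps0|apply: psD|apply: ps_word].
Qed.

Lemma ve_word v q w : ve v * (word q * ve w) = word q * ve w \/ ve v * (word q * ve w) = 0.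
Proof.
case: q => [|e q]; first by rewrite word_nil mul1r lveM; case: eqP => [->|]; [left|right].
by rewrite word_cons !mulrA ve_ed; case: eqP; [left|right; rewrite !mul0r].
Qed.

Lemma ps_word1 (S : pred nat) c q : S (size q) -> pspan S (sc c * word q).
Proof.
move=> h; rewrite -[word q]mulr1 (lve_sum L) !mulr_sumr.
by apply: ps_sum => v _; apply: ps_word.
Qed.

(** The predicates bound the lengths of the words involved. The vertex between two words fixes or
    kills the second one, so only concatenations remain. *)
Lemma psM S S' S'' a b : (forall k k', S k -> S' k' -> S'' (k + k')%N) ->
  pspan S a -> pspan S' b -> pspan S'' (a * b).
Proof.
move=> h ha hb; elim: ha => {a} [|x y _ hx _ hy|c q v hq].
- by rewrite mul0r; apply: ps0.
- by rewrite mulrDl; apply: psD.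
elim: hb => {b} [|x y _ hx _ hy|d q' w hq'].
- by rewrite mulr0; apply: ps0.
- by rewrite mulrDr; apply: psD.
rewrite -mulrA; apply: psZ; rewrite [_ * ve v]lock mulrA -lscC -mulrA -lock; apply: psZ.
rewrite -mulrA; case: (ve_word v q' w) => -> ; last by rewrite mulr0; apply: ps0.
rewrite mulrA -word_cat -[_ * _]mul1r -(lsc1 L); apply: ps_word.
by rewrite size_cat; apply: h.
Qed.

Lemma ps_ve (S : pred nat) v : S 0%N -> pspan S (ve v).
Proof. by move=> h; rewrite -[ve v]mul1r -(lsc1 L) -[ve v]mul1r -word_nil; apply: ps_word. Qed.

Lemma ps_wordX (S : pred nat) q : S (size q) -> pspan S (word q).
Proof. by move=> h; rewrite -[word q]mul1r -(lsc1 L); apply: ps_word1. Qed.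

Lemma ps_ed (S : pred nat) e : S 1%N -> pspan S (ed e).
Proof. by move=> h; rewrite -[ed e]mulr1 -word_nil -word_cons; apply: ps_wordX. Qed.

Lemma ps_ve_mul S v a : pspan S a -> pspan S (ve v * a).
Proof. by apply: (@psM (pred1 0%N)) => [k k' /eqP->//|]; apply: ps_ve. Qed.
Lemma ps_mul_ve S v a : pspan S a -> pspan S (a * ve v).
Proof.
move=> ha; apply: (@psM _ (pred1 0%N) _ _ _ _ ha) => [k k' h /eqP->|]; last exact: ps_ve.
by rewrite addn0.
Qed.

(** Serves to discard components whose prescribed degree is the length of no admissible word. *)
Lemma ps_empty S a : S =1 xpred0 -> pspan S a -> a = 0.
Proof. by move=> h; elim=> [|x y _ -> _ ->|c q v]; rewrite ?addr0 // h. Qed.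

(** Elements without words of length 0 lie in the edge ideal; the last edge of each word is split
    off. The condition at the source of [e] is what makes the coefficients unique in
    [ps_ed_free]. *)
Lemma ps_strip S a : ~~ S 0%N -> pspan S a -> exists b : E1 -> A,
  [/\ a = \sum_e b e * ed e, forall e, pspan (fun k => S k.+1) (b e)
    & forall e, b e * ve (dsrc e) = b e].
Proof.
move=> S0; elim=> {a} [|x y _ [b [-> hb vb]] _ [b' [-> hb' vb']]|c q v].
- exists (fun=> 0); split=> [|e|e]; rewrite ?mul0r //; last exact: ps0.
  by rewrite big1 // => e _; rewrite mul0r.
- exists (fun e => b e + b' e); split=> [|e|e]; last by rewrite mulrDl vb vb'.
    by rewrite -big_split; apply: eq_bigr => e _; rewrite mulrDl.
  by apply: psD.
case: (lastP q) => [|{}q f]; first by rewrite (negPf S0).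
rewrite size_rcons => Sq.
exists (fun e => if e == f then if v == drng f then sc c * (word q * ve (dsrc f)) else 0 else 0).
split=> [|e|e].
- rewrite (bigD1 f) //= eqxx big1 ?addr0 => [|e /negPf->]; last by rewrite mul0r.
  rewrite word_rcons -!mulrA ed_ve; case: eqP => _; last by rewrite !mulr0 mul0r.
  by rewrite -!mulrA lsrcM.
- by case: ifP => _; [case: ifP => _; [apply: ps_word|apply: ps0]|apply: ps0].
- case: ifP => [/eqP->|_]; last by rewrite mul0r.
  by case: ifP => _; rewrite ?mul0r // -!mulrA lveM eqxx.
Qed.

Lemma ps_word_comp q : gcomp (size q)%:Z (word q).
Proof.
elim: q => [|e q IH]; first by rewrite word_nil; apply: gcomp1.
by rewrite word_cons /= -add1n PoszD; apply/gcompM/IH/led_comp.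
Qed.

Lemma ps_coef S z a : pspan S a -> pspan (fun k => S k && (k%:Z == z)) (lcoef L z a).
Proof.
elim=> [|x y _ hx _ hy|c q v h]; first by rewrite lcoef0; apply: ps0.
  by rewrite lcoefD; apply: psD.
rewrite (@lcoefE _ _ _ _ _ (size q)%:Z).
  by case: (boolP (_ == z)) => e; [apply: ps_word; rewrite h|apply: ps0].
rewrite -[X in gcomp X]add0r; apply: gcompM; first exact: lsc_comp.
rewrite -[X in gcomp X]addr0; apply: gcompM; first exact: ps_word_comp.
exact: lve_comp.
Qed.

Lemma ps_comp S z a : (forall k, S k -> k%:Z = z) -> pspan S a -> gcomp z a.
Proof.
move=> h; elim=> [|x y _ hx _ hy|c q v hq]; [exact: comp0|exact: compD|].
rewrite -[X in gcomp X]add0r; apply: gcompM; first exact: lsc_comp.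
rewrite -[X in gcomp X]addr0; apply: gcompM; last exact: lve_comp.
by rewrite -(h _ hq); apply: ps_word_comp.
Qed.

Lemma ps_bounded S a : pspan S a -> exists N, pspan (fun k => S k && (k < N)%N) a.
Proof.
elim=> [|x y _ [n hx] _ [m hy]|c q v h]; first by exists 0%N; apply: ps0.
- exists (maxn n m); apply: psD.
    by apply: ps_sub hx => k /andP[-> /= kn]; rewrite leq_max kn.
  by apply: ps_sub hy => k /andP[-> /= kn]; rewrite leq_max kn orbT.
- by exists (size q).+1; apply: ps_word; rewrite h /=.
Qed.

Lemma ps_sum_coef N a : pspan (fun k => k < N)%N a -> a = \sum_(n < N) lcoef L n%:Z a.
Proof.
elim=> [|x y _ {1}-> _ {1}->|c q v h].
- by rewrite big1 // => i _; rewrite lcoef0.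
- by rewrite -big_split; apply: eq_bigr => i _; rewrite lcoefD.
have hc : gcomp (size q)%:Z (sc c * (word q * ve v)).
  by apply: (@ps_comp (pred1 (size q))) => [k /eqP->//|]; apply: ps_word => /=.
rewrite (bigD1 (Ordinal h)) //= (lcoefE _ _ hc) eqxx big1 ?addr0 // => i ni.
rewrite (lcoefE _ _ hc); case: eqP => // -[e]; case/eqP: ni; exact: val_inj.
Qed.

Lemma ps_coef_eq0 S a : pspan S a -> (forall n : nat, lcoef L n%:Z a = 0) -> a = 0.
Proof.
move=> /ps_bounded[N ha] h; rewrite (@ps_sum_coef N a) ?big1 //.
by apply: ps_sub ha => k /andP[].
Qed.

(** The part of degree 0 of the path algebra is spanned by the orthogonal vertices. *)
Lemma ps_vertex S v a : (forall k, S k -> k = 0%N) -> pspan S a -> exists c, ve v * a = sc c * ve v.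
Proof.
move=> h; elim=> [|x y _ [c hx] _ [d hy]|c q w /h/size0nil->].
- by exists 0; rewrite lsc0 mulr0 mul0r.
- by exists (c + d); rewrite mulrDr hx hy lscD mulrDl.
- exists (if v == w then c else 0); rewrite mulrA -lscC -mulrA word_nil mul1r lveM.
  by case: eqP => [->//|_]; rewrite lsc0 mul0r mulr0.
Qed.

Lemma ps_vertexr S v a : (forall k, S k -> k = 0%N) -> pspan S a -> exists c, a * ve v = sc c * ve v.
Proof.
move=> h; elim=> [|x y _ [c hx] _ [d hy]|c q w /h/size0nil->].
- by exists 0; rewrite lsc0 !mul0r.
- by exists (c + d); rewrite mulrDl hx hy lscD mulrDl.
- exists (if w == v then c else 0); rewrite -mulrA word_nil mul1r lveM.
  by case: eqP => [->//|_]; rewrite lsc0 mul0r mulr0.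
Qed.

(** A ghost edge removes the first edge of a nonempty word or kills the word. *)
Lemma ps_gh S f a : ~~ S 0%N -> pspan S a -> pspan (fun k => S k.+1) (gh f * a).
Proof.
move=> S0; elim=> [|x y _ hx _ hy|c q v]; first by rewrite mulr0; apply: ps0.
  by rewrite mulrDr; apply: psD.
case: q => [|e q] hq; first by rewrite hq in S0.
rewrite mulrA -lscC -mulrA word_cons !mulrA -[_ * gh f * _]mulrA lgh_ed; apply: ps_mul_ve.
case: eqP => _; last by rewrite mulr0 mul0r; apply: ps0.
by rewrite -mulrA; apply/psZ/ps_ve_mul/ps_wordX.
Qed.

Lemma ps_word_compM S c q v : pspan S (sc c * (word q * ve v)) ->
  gcomp (size q)%:Z (sc c * (word q * ve v)).
Proof.
by move=> _; apply: (@ps_comp (pred1 (size q))) => [k /eqP->//|]; apply: ps_word => /=.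
Qed.

Lemma lcoefMr S z m a g : pspan S a -> gcomp m g -> lcoef L (z + m) (a * g) = lcoef L z a * g.
Proof.
move=> ha hg; elim: ha => {a} [|x y _ hx _ hy|c q v h].
- by rewrite mul0r !lcoef0 mul0r.
- by rewrite mulrDl !lcoefD hx hy mulrDl.
have hc := ps_word_compM (ps_word c v h).
rewrite (lcoefE _ _ hc) (lcoefE _ _ (gcompM hc hg)) (can_eq (addrK _)).
by case: eqP => // _; rewrite mul0r.
Qed.

(* The edge ideal is free on the edges as a left module over the path algebra. *)
Lemma ps_ed_free (b : E1 -> A) : (forall e, pspan predT (b e)) ->
  (forall e, b e * ve (dsrc e) = b e) -> \sum_e b e * ed e = 0 -> forall e, b e = 0.
Proof.
move=> hb vb sb e.
(* Taking components reduces the claim to coefficients of one common degree [n]. *)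
suff H n (b' : E1 -> A) : (forall e, pspan (pred1 n) (b' e)) ->
    (forall e, b' e * ve (dsrc e) = b' e) -> \sum_e b' e * ed e = 0 -> forall e, b' e = 0.
  apply: (ps_coef_eq0 (hb e)) => n; apply: (H n (fun e => lcoef L n%:Z (b e))) => [f|f|].
  - by apply: ps_sub (ps_coef n%:Z (hb f)).
  - by have := lcoefMr n%:Z (hb f) (lve_comp L (dsrc f)); rewrite vb addr0.
  - transitivity (lcoef L (n%:Z + 1) (\sum_e b e * ed e)); last by rewrite sb lcoef0.
    by rewrite lcoef_sum; apply: eq_bigr => g _; rewrite (lcoefMr _ (hb g) (led_comp L g)).
(* In degree 0 each coefficient is a scalar at the source of its edge, and the ghost of [f] isolates
   the one at [f]. In positive degree, ghosts on the left lower the degree and leave the last edges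
   untouched. *)
elim: n b' => [|n IH] b' hb' vb' sb' f.
  have cE g : exists c, b' g = sc c * ve (dsrc g).
    by rewrite -vb'; apply: ps_vertexr (hb' g) => k /eqP.
  have [c hc] := cE f.
  suff c0 : c = 0 by rewrite hc c0 lsc0 mul0r.
  apply: (@lsc_eq0 c (drng f)).
  have := congr1 (fun x => gh f * x) sb'; rewrite mulr0 => <-.
  rewrite mulr_sumr (bigD1 f) //= big1 => [|g /negPf gf].
    by rewrite addr0 hc -mulrA lsrcM mulrA -lscC -mulrA lgh_ed eqxx.
  have [d ->] := cE g.
  by rewrite -mulrA lsrcM mulrA -lscC -mulrA lgh_ed eq_sym gf mulr0.
apply: eq0_gh_left => g; apply: (IH (fun f => gh g * b' f)) => [h|h|].
- by apply: ps_sub (ps_gh g _ (hb' h)).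
- by rewrite -mulrA vb'.
- by under eq_bigr => h _ do rewrite -mulrA; rewrite -mulr_sumr sb' mulr0.
Qed.

End PathSpan.

(** * Absorption into the path algebra and the weak algorithm *)

Section WeakAlgorithm.
Variables (K : fieldType) (E : finDigraph) (A : gradedRing) (L : lpa_family K E A).
Local Notation sc := (lsc L).
Local Notation ve := (lve L).
Local Notation ed := (led L).
Local Notation gh := (lgh L).
Local Notation E0 := (dvert E).
Local Notation E1 := (dedge E).
Local Notation word := (word L).
Local Notation pspan := (pspan L).
Implicit Type S : pred nat.

Lemma ve_word1 v p : p != [::] -> ve v * word p = word p \/ ve v * word p = 0.
Proof.
case: p => // e p _; rewrite word_cons mulrA ve_ed.
by case: eqP => _; [left|right; rewrite mul0r].
Qed.

(** A word followed by a word of length n also begins with a word of length n, which is where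
    absorption from the left needs it. [T] is arbitrary so that the same argument serves elements of
    L and lattices in modules. *)
Lemma ps_mul_word (T : A -> Prop) n a p : T 0 -> (forall x y, T x -> T y -> T (x + y)) ->
  (forall q b, size q = n -> pspan predT b -> T (word q * b)) ->
  pspan predT a -> size p = n -> T (a * word p).
Proof.
move=> T0 TD TM ha sp; elim: ha => {a} [|x y _ hx _ hy|c q v _].
- by rewrite mul0r.
- by rewrite mulrDl; apply: TD.
have [p0|p0] := eqVneq p [::].
  rewrite p0 word_nil mulr1 -[_ * _]mul1r -(word_nil L).
  by apply: TM; [rewrite -sp p0|apply: ps_word].
rewrite -!mulrA; case: (ve_word1 v p0) => ->; last by rewrite !mulr0.
rewrite -word_cat -(cat_take_drop n (q ++ p)) word_cat mulrA lscC -mulrA.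
apply: TM; first by rewrite size_takel // size_cat sp leq_addl.
exact: ps_word1.
Qed.

(** Induction on the expression of [l]: a ghost edge is absorbed by one edge. For a product [a * b],
    the first [m] letters bring [b] into the path algebra, and [n] further letters, moved to the
    front by [ps_mul_word], absorb [a]. *)
Lemma ps_absorb l : exists n, forall p, (n <= size p)%N -> pspan predT (l * word p).
Proof.
have ext n x : (forall p, size p = n -> pspan predT (x * word p)) ->
    forall p, (n <= size p)%N -> pspan predT (x * word p).
  move=> h p np; rewrite -(cat_take_drop n p) word_cat mulrA.
  apply: (@psM _ _ _ _ predT predT) => //; last exact: ps_wordX.
  by apply: h; rewrite size_takel.
elim/(@lpa_ind _ _ _ L): l => [c|v|e|e|a b [n hn] [m hm]|a b [n hn] [m hm]].
- by exists 0%N => p _; apply: ps_word1.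
- by exists 0%N => p _; apply/ps_ve_mul/ps_wordX.
- by exists 0%N => p _; rewrite -word_cons; apply: ps_wordX.
- exists 1%N => -[|f p] // _; rewrite word_cons mulrA lgh_ed.
  by case: eqP => _; [apply/ps_ve_mul/ps_wordX|rewrite mul0r; apply: ps0].
- exists (maxn n m) => p; rewrite geq_max => /andP[np mp]; rewrite mulrDl.
  by apply: psD; [apply: hn|apply: hm].
exists (m + n)%N; apply: ext => p sp.
rewrite -(cat_take_drop m p) word_cat mulrA -[a * b * _]mulrA -mulrA.
apply: (@ps_mul_word (fun x => pspan predT (a * x)) n).
- by rewrite mulr0; apply: ps0.
- by move=> x y hx hy; rewrite mulrDr; apply: psD.
- move=> q y sq hy; rewrite mulrA; apply: (@psM _ _ _ _ predT predT) => //.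
  by apply: hn; rewrite sq.
- by apply: hm; rewrite size_takel // sp leq_addr.
- by rewrite size_drop sp addKn.
Qed.

Lemma ps_absorb_fin (I : finType) (l : I -> A) :
  exists n, forall i p, (n <= size p)%N -> pspan predT (l i * word p).
Proof.
have [n hn] := @choice _ _ (fun i n => forall p, (n <= size p)%N -> pspan predT (l i * word p))
  (fun i => ps_absorb (l i)).
exists (\max_i n i) => i p h; apply: hn; apply: leq_trans h.
exact: leq_bigmax.
Qed.

Lemma lcoef_ve z v S a : pspan S a -> lcoef L z (ve v * a) = ve v * lcoef L z a.
Proof.
elim=> [|x y _ hx _ hy|c q w h]; first by rewrite mulr0 !lcoef0 mulr0.
  by rewrite mulrDr !lcoefD hx hy mulrDr.
have hc := ps_word_compM (ps_word L c w h).
have hc' := gcompM (lve_comp L v) hc; rewrite add0r in hc'.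
by rewrite (lcoefE _ _ hc) (lcoefE _ _ hc'); case: eqP; rewrite ?mulr0.
Qed.

Lemma lcoef_out S n a : ~~ S n -> pspan S a -> lcoef L n%:Z a = 0.
Proof.
move=> nS /(ps_coef n%:Z)/ps_empty; apply=> k /=.
by case: eqP => [[->]|]; rewrite ?andbF ?andbT //; apply/negbTE.
Qed.

Lemma ps_drop_top n a : pspan (fun k => k < n.+1)%N a -> lcoef L n%:Z a = 0 ->
  pspan (fun k => k < n)%N a.
Proof.
move=> ha a0; rewrite (ps_sum_coef ha) big_ord_recr /= a0 addr0; apply: ps_sum => i _.
by apply: ps_sub (ps_coef _ ha) => k /andP[_ /eqP[->]].
Qed.

Lemma lcoef_top n m x y : pspan (fun k => k < n.+1)%N x -> pspan (fun k => k < m.+1)%N y ->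
  lcoef L (n + m)%N%:Z (x * y) = lcoef L n%:Z x * lcoef L m%:Z y.
Proof.
move=> hx hy.
have cy : gcomp m%:Z (lcoef L m%:Z y).
  by apply: ps_comp (ps_coef m%:Z hy) => k /andP[_ /eqP].
have py : pspan (fun k => k < m)%N (y - lcoef L m%:Z y).
  apply: ps_drop_top.
    by apply: psD => //; apply: psN; apply: ps_sub (ps_coef m%:Z hy) => k /andP[].
  apply: (@addIr _ (lcoef L m%:Z (lcoef L m%:Z y))).
  by rewrite -lcoefD subrK add0r (lcoefE _ _ cy) eqxx.
rewrite -[in LHS](subrK (lcoef L m%:Z y) y) mulrDr lcoefD.
rewrite [X in X + _](_ : _ = 0) ?add0r; first by rewrite PoszD (lcoefMr _ hx cy).
apply: (@lcoef_out (fun k => k < n + m)%N); first by rewrite ltnn.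
by apply: (psM _ hx py) => k k'; lia.
Qed.

(* The weak algorithm: a homogeneous relation is stripped of last edges until one
   coefficient becomes a scalar, which makes the corresponding f i redundant. *)
Lemma irreducible_free (I : finType) (D : pred I) (J : finType) (f : I -> J -> A)
    (v : I -> E0) (d : I -> int) :
  (forall i k, D i -> pspan predT (f i k)) ->
  (forall i k, D i -> f i k * ve (v i) = f i k) ->
  (forall i (b : I -> A), D i ->
     (forall j, D j -> pspan (fun k => k%:Z == d i - d j) (b j)) ->
     (forall k, f i k = \sum_(j | D j && (j != i)) f j k * b j) -> False) ->
  forall (z : int) (a : I -> A), (forall i, D i -> pspan (fun k => k%:Z == z - d i) (a i)) ->
  (forall k, \sum_(i | D i) f i k * a i = 0) -> forall i, D i -> ve (v i) * a i = 0.
Proof.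
move=> hf fv irr z a ha sa.
(* The induction is on a strict bound for the degrees [z - d i] of the coefficients; for [n = 0] no
   word has such a length. *)
have [n hn] : exists n : nat, forall i, D i -> (z - d i < n%:Z)%R.
  exists (\max_i `|(z - d i + 1)%R|%N) => i _.
  have := @leq_bigmax _ (fun i => `|(z - d i + 1)%R|%N) i; lia.
elim: n z a hn ha sa => [|n IH] z a hn ha sa i Di.
  by rewrite (ps_empty _ (ha i Di)) ?mulr0 // => k; have := hn i Di; lia.
(* If a coefficient of degree 0 survives, it is a nonzero scalar, and solving for [f j] contradicts
   [irr]. Otherwise all coefficients consist of nonempty words and can be stripped. *)
have [[j [Dj dj aj]]|H] := EM (exists j, [/\ D j, d j = z & ve (v j) * a j <> 0]).
  have [c hc] : exists c, ve (v j) * a j = sc c * ve (v j).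
    by apply: ps_vertex (ha j Dj) => k; rewrite dj; lia.
  have c0 : c != 0 by apply/eqP => c0; apply: aj; rewrite hc c0 lsc0 mul0r.
  case: (@irr j (fun i => sc (- c^-1) * a i) Dj) => [l Dl|k].
    by apply: psZ; rewrite dj; apply: ha.
  have := sa k; rewrite (bigD1 j) //= -[f j k]fv // -mulrA hc => /(congr1 (fun x => sc c^-1 * x)).
  rewrite mulr0 mulrDr mulrA [sc _ * f _ _]lscC -mulrA.
  rewrite [sc _ * (sc _ * _)]mulrA -lscM mulVf // lsc1 mul1r fv //.
  move=> /eqP; rewrite addr_eq0 => /eqP->; rewrite mulr_sumr -sumrN.
  by apply: eq_bigr => l _; rewrite lscN mulNr mulrN !mulrA lscC.
have ha' j : D j -> pspan (fun k => (k%:Z == z - d j) && (k != 0)%N) (ve (v j) * a j).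
  move=> Dj; have [e|ne] := eqVneq (d j) z.
    have -> : ve (v j) * a j = 0 by apply/eqP/contraT => /eqP h; case: H; exists j.
    exact: ps0.
  by apply: ps_ve_mul; apply: ps_sub (ha j Dj) => k; lia.
have [b hb] : {b : I -> E1 -> A & forall j, D j -> [/\ ve (v j) * a j = \sum_e b j e * ed e,
    forall e, pspan (fun k => k.+1%:Z == z - d j) (b j e) & forall e, b j e * ve (dsrc e) = b j e]}.
  apply: (@choice _ _ (fun j b => D j -> [/\ ve (v j) * a j = \sum_e b e * ed e,
    forall e, pspan (fun k => k.+1%:Z == z - d j) (b e) & forall e, b e * ve (dsrc e) = b e])) => j.
  have [Dj|nDj] := boolP (D j); last by exists (fun=> 0).
  have [|b [e hb vb]] := ps_strip _ (ha' j Dj); first by rewrite eqxx andbF.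
  by exists b; split=> // e'; apply: ps_sub (hb e') => k /andP[].
(* By freeness of the edge ideal, every last edge [e] gives a relation of its own, of degree
   [z - 1]. *)
have fb0 e k : \sum_(j | D j) f j k * b j e = 0.
  move: e; apply: ps_ed_free => [e|e|].
  - apply: ps_sum => j Dj; have [_ h _] := hb j Dj.
    by apply: (@psM _ _ _ _ predT predT) => //; [apply: hf|apply: ps_sub (h e)].
  - by rewrite mulr_suml; apply: eq_bigr => j Dj; have [_ _ h] := hb j Dj; rewrite -mulrA h.
  - under eq_bigr => e _ do rewrite mulr_suml.
    rewrite exchange_big -[RHS](sa k); apply: eq_bigr => j Dj /=.
    rewrite -(fv j k Dj) -mulrA; have [-> _ _] := hb j Dj.
    by rewrite mulr_sumr; apply: eq_bigr => e _; rewrite fv // mulrA.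
have b0 e j : D j -> ve (v j) * b j e = 0.
  apply: (IH (z - 1) (fun j => b j e)) => [l Dl|l Dl|k //]; first by have := hn l Dl; lia.
  by have [_ h _] := hb l Dl; apply: ps_sub (h e) => k; lia.
have [e _ _] := hb i Di.
have -> : ve (v i) * a i = ve (v i) * (ve (v i) * a i) by rewrite mulrA lveM eqxx.
by rewrite e mulr_sumr big1 // => e' _; rewrite mulrA b0 // mul0r.
Qed.

End WeakAlgorithm.

(** * Families of generators and bases *)

(** Keeps the scalars in [R], so that their products are those of [R] and not of the converse
    ring. *)
Definition ract (R : pzRingType) (P : lmodType R^c) (x : P) (a : R) : P := (a : R^c) *: x.
Notation "x ∙ a" := (ract x a) (at level 40, left associativity).

Section RightAction.
Variables (R : pzRingType) (P : lmodType R^c).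
Implicit Types (x y : P) (a b : R).

Lemma ractM x a b : x ∙ a ∙ b = x ∙ (a * b).
Proof. exact: scalerA. Qed.
Lemma ract1 x : x ∙ 1 = x.
Proof. exact: scale1r. Qed.
Lemma ractDl x y a : (x + y) ∙ a = x ∙ a + y ∙ a.
Proof. exact: scalerDr. Qed.
Lemma ractDr x a b : x ∙ (a + b) = x ∙ a + x ∙ b.
Proof. exact: scalerDl. Qed.
Lemma ract0 x : x ∙ 0 = 0.
Proof. exact: scale0r. Qed.
Lemma ract0l a : (0 : P) ∙ a = 0.
Proof. exact: scaler0. Qed.
Lemma ractNr x a : x ∙ (- a) = - (x ∙ a).
Proof. exact: scaleNr. Qed.
Lemma ractBl x y a : (x - y) ∙ a = x ∙ a - y ∙ a.
Proof. exact: scalerBr. Qed.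
Lemma ract_suml (I : Type) (r : seq I) (D : pred I) (F : I -> P) a :
  (\sum_(i <- r | D i) F i) ∙ a = \sum_(i <- r | D i) F i ∙ a.
Proof. exact: scaler_sumr. Qed.
Lemma ract_sumr (I : Type) (r : seq I) (D : pred I) (F : I -> R) x :
  x ∙ (\sum_(i <- r | D i) F i) = \sum_(i <- r | D i) x ∙ F i.
Proof. exact: scaler_suml. Qed.
Lemma linear_ract (Q : lmodType R^c) (f : {linear P -> Q}) x a : f (x ∙ a) = f x ∙ a.
Proof. exact: linearZ. Qed.
Lemma row_ract n (x : 'rV[R^c]_n) a i j : (x ∙ a) i j = (x i j : R) * a.
Proof. by rewrite mxE. Qed.
End RightAction.

(* Only the indices in fD count, so that dropping a redundant member changes fD
   alone. The field fd is meaningful only where homogeneity is assumed. *)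
Record fam (E : finDigraph) (P : Type) := Fam {
  fI : finType;
  fD : pred fI;
  fm : fI -> P;
  fv : fI -> dvert E;
  fd : fI -> int
}.

Arguments fD {E P} f i : rename.
Arguments fm {E P} f i : rename.
Arguments fv {E P} f i : rename.
Arguments fd {E P} f i : rename.

Section Families.
Variables (K : fieldType) (E : finDigraph) (A : gradedRing) (L : lpa_family K E A).
Local Notation sc := (lsc L).
Local Notation ve := (lve L).
Local Notation ed := (led L).
Local Notation gh := (lgh L).
Local Notation E0 := (dvert E).
Local Notation E1 := (dedge E).
Local Notation word := (word L).
Local Notation pspan := (pspan L).
Variable P : lmodType A^c.
Local Notation fam := (fam E P).
Implicit Type F : fam.

Definition fcomb F (l : fI F -> A) : P := \sum_(i | fD F i) fm F i ∙ l i.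
Definition fam_wf F := forall i, fD F i -> fm F i ∙ ve (fv F i) = fm F i.
Definition in_span F x := exists l, x = @fcomb F l.
Definition generates F := forall x, in_span F x.
(** Only [ve (fv F i) * l i] can be expected to vanish: the i-th member is fixed by its vertex and
    sees no other part of [l i]. The condition says that the sum map from the modules v_i L is
    injective. *)
Definition independent F := forall l, @fcomb F l = 0 -> forall i, fD F i -> ve (fv F i) * l i = 0.
Definition is_basis F := [/\ fam_wf F, generates F & independent F].

Lemma in_span0 F : in_span F 0.
Proof. by exists (fun=> 0); rewrite /fcomb big1 // => i _; rewrite ract0. Qed.

Lemma in_spanD F x y : in_span F x -> in_span F y -> in_span F (x + y).
Proof.
move=> [l ->] [l' ->]; exists (fun i => l i + l' i).
by rewrite /fcomb -big_split; apply: eq_bigr => i _; rewrite ractDr.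
Qed.

Lemma in_span_act F x a : in_span F x -> in_span F (x ∙ a).
Proof.
move=> [l ->]; exists (fun i => l i * a); rewrite /fcomb ract_suml.
by apply: eq_bigr => i _; rewrite ractM.
Qed.

Lemma in_span_sum F (I : Type) (r : seq I) (D : pred I) (G : I -> P) :
  (forall i, D i -> in_span F (G i)) -> in_span F (\sum_(i <- r | D i) G i).
Proof.
by move=> h; apply: (big_ind (in_span F)) => //; [apply: in_span0|apply: in_spanD].
Qed.

Lemma in_span_fm F i : fD F i -> in_span F (fm F i).
Proof.
move=> Di; exists (fun j => if j == i then 1 else 0); rewrite /fcomb (bigD1 i) //= eqxx ract1.
by rewrite big1 ?addr0 // => j /andP[_ /negPf->]; rewrite ract0.
Qed.

Lemma generates_sub F F' : generates F -> (forall i, fD F i -> in_span F' (fm F i)) -> generates F'.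
Proof.
move=> gF h x; have [l ->] := gF x.
by apply: in_span_sum => i Di; apply/in_span_act/h.
Qed.

Definition fam_sum (H : zmodType) (h : E0 -> H) F : H := \sum_(i | fD F i) h (fv F i).

(** Applies to every member the decomposition of vL into the submodules e e^* L, each isomorphic to
    r(e)L. Degrees rise by one with the edge. *)
Definition refine1 F : fam :=
  @Fam E P (fI F * E1)%type (fun x => fD F x.1 && (dsrc x.2 == fv F x.1))
    (fun x => fm F x.1 ∙ ed x.2) (fun x => drng x.2) (fun x => fd F x.1 + 1).

Lemma refine1_comb F (l : fI (refine1 F) -> A) :
  fcomb l = \sum_(i | fD F i) fm F i ∙ \sum_(e | dsrc e == fv F i) ed e * l (i, e).
Proof.
transitivity (\sum_(x | fD F x.1 && (dsrc x.2 == fv F x.1)) fm F x.1 ∙ ed x.2 ∙ l (x.1, x.2)).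
  by apply: eq_bigr => -[i e].
rewrite -(pair_big_dep (fD F) (fun i e => dsrc e == fv F i)
  (fun i e => fm F i ∙ ed e ∙ l (i, e))) /=.
by apply: eq_bigr => i _; rewrite ract_sumr; apply: eq_bigr => e _; rewrite ractM.
Qed.

Lemma refine1_wf F : fam_wf (refine1 F).
Proof. by move=> i _ /=; rewrite ractM lrngM. Qed.

Lemma refine1_gen F : fam_wf F -> generates F -> generates (refine1 F).
Proof.
move=> wF gF; apply: (generates_sub gF) => i Di.
exists (fun x => if x.1 == i then gh x.2 else 0); rewrite refine1_comb.
rewrite (bigD1 i) //= [X in _ + X]big1 ?addr0 => [|j /andP[_ /negPf ji]]; last first.
  by rewrite big1 ?ract0 // => e _; rewrite ji mulr0.
rewrite -{1}wF // (lck2 L); congr (_ ∙ _); apply: eq_bigr => e _; by rewrite eqxx.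
Qed.

Lemma refine1_indep F : independent F -> independent (refine1 F).
Proof.
move=> iF l; rewrite refine1_comb => /iF h [i e] /= /andP[Di /eqP se].
have := congr1 (fun x => gh e * x) (h i Di); rewrite mulr0 mulrA gh_ve se eqxx.
rewrite mulr_sumr (bigD1 e) ?se //= big1 => [|f /andP[_ /negPf fe]].
  by rewrite addr0 mulrA lgh_ed eqxx.
by rewrite mulrA lgh_ed eq_sym fe mul0r.
Qed.

Lemma refine1_sum (H : zmodType) (h : E0 -> H) F :
  (forall v, h v = \sum_(e | dsrc e == v) h (drng e)) ->
  fam_sum h (refine1 F) = fam_sum h F.
Proof.
move=> hh; rewrite /fam_sum /= -(pair_big_dep (fD F) (fun i e => dsrc e == fv F i)
  (fun i e => h (drng e))) /=.
by apply: eq_bigr => i _; rewrite -hh.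
Qed.

Definition refine n F := iter n refine1 F.

Lemma refineP n F (i : fI (refine n F)) : fD (refine n F) i -> exists (j : fI F) p,
  [/\ fD F j, size p = n, fm (refine n F) i = fm F j ∙ word p
    & fd (refine n F) i = fd F j + n%:Z].
Proof.
elim: n i => [|n IH] i; first by exists i, [::]; rewrite word_nil ract1 addr0.
case: i => i e /= /andP[/IH[j [p [Dj sp -> ->]]] _].
exists j, (rcons p e); split=> //; first by rewrite size_rcons sp.
  by rewrite word_rcons ractM.
by rewrite -addrA -PoszD addn1.
Qed.

Lemma refine_wf n F : fam_wf F -> fam_wf (refine n F).
Proof. by case: n => // n _; apply: refine1_wf. Qed.
Lemma refine_gen n F : fam_wf F -> generates F -> generates (refine n F).
Proof. by move=> wF gF; elim: n => //= n; apply/refine1_gen/refine_wf. Qed.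
Lemma refine_basis n F : is_basis F -> is_basis (refine n F).
Proof.
move=> [wF gF iF]; split; [exact: refine_wf|exact: refine_gen|].
by elim: n => //= n; apply: refine1_indep.
Qed.
Lemma refine_sum (H : zmodType) (h : E0 -> H) n F :
  (forall v, h v = \sum_(e | dsrc e == v) h (drng e)) ->
  fam_sum h (refine n F) = fam_sum h F.
Proof. by move=> hh; elim: n => //= n <-; apply: refine1_sum. Qed.

(** Cuts arbitrary generators into their parts at the vertices, as [fam_wf] asks each member to be
    fixed by a vertex. *)
Definition with_vertices (I : finType) (x : I -> P) (d : I -> int) : fam :=
  @Fam E P (I * E0)%type xpredT (fun y => x y.1 ∙ ve y.2) (fun y => y.2) (fun y => d y.1).

Lemma with_vertices_wf I x d : fam_wf (@with_vertices I x d).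
Proof. by move=> [i v] _ /=; rewrite ractM lveM eqxx. Qed.

Lemma with_vertices_span I x d i : in_span (@with_vertices I x d) (x i).
Proof.
rewrite -[x i]ract1 (lve_sum L) ract_sumr; apply: in_span_sum => v _.
exact: (@in_span_fm (with_vertices x d) (i, v)).
Qed.

Variables (n : nat) (phi : {linear P -> 'rV[A^c]_n}).
Hypothesis iphi : injective phi.

Lemma phi_comb F (l : fI F -> A) k :
  phi (fcomb l) 0 k = \sum_(i | fD F i) (phi (fm F i) 0 k : A) * l i.
Proof.
rewrite /fcomb raddf_sum summxE; apply: eq_bigr => i _ /=.
by rewrite (linear_ract phi) row_ract.
Qed.

Definition path_valued F := forall i k, fD F i -> pspan predT (phi (fm F i) 0 k).

(** Refinement multiplies the members by words of a given length, and long words absorb their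
    finitely many coordinates. *)
Lemma refine_path_valued F : exists n, path_valued (refine n F).
Proof.
have [N hN] := ps_absorb_fin L (fun x : fI F * 'I_n => (phi (fm F x.1) 0 x.2 : A)).
exists N => i k /refineP[j [p [_ sp -> _]]].
by rewrite (linear_ract phi) row_ract; apply: (hN (j, k)); rewrite sp.
Qed.

(** A relation over L times any long word is a relation over the path algebra, and the long words
    together detect zero. *)
Lemma indep_path F : fam_wf F -> (forall a : fI F -> A, (forall i, fD F i -> pspan predT (a i)) ->
    fcomb a = 0 -> forall i, fD F i -> ve (fv F i) * a i = 0) -> independent F.
Proof.
move=> wF h l sl i Di; have [N hN] := ps_absorb_fin L l.
apply: (@eq0_word_right _ _ _ L N) => p sp; rewrite -mulrA.
apply: (h (fun i => l i * word p)) => // [j _|]; first by apply: hN; rewrite sp.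
rewrite -(ract0l P (word p)) -sl /fcomb ract_suml.
by apply: eq_bigr => j _; rewrite ractM.
Qed.

End Families.

(** * Existence of bases and of homogeneous bases *)

Section BasisExists.
Variables (K : fieldType) (E : finDigraph) (A : gradedRing) (L : lpa_family K E A).
Local Notation sc := (lsc L).
Local Notation ve := (lve L).
Local Notation ed := (led L).
Local Notation gh := (lgh L).
Local Notation E0 := (dvert E).
Local Notation E1 := (dedge E).
Local Notation word := (word L).
Local Notation pspan := (pspan L).
Variable P : lmodType A^c.
Local Notation fam := (fam E P).
Local Notation path_valued := (path_valued L).
Implicit Type F : fam.
Variables (n : nat) (phi : {linear P -> 'rV[A^c]_n}).
Hypothesis iphi : injective phi.

Lemma phi_eq x y : (forall k, phi x 0 k = phi y 0 k) -> x = y.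
Proof. by move=> h; apply/iphi/rowP. Qed.

Lemma phi_ve F i k : fam_wf L F -> fD F i ->
  (phi (fm F i) 0 k : A) * ve (fv F i) = phi (fm F i) 0 k.
Proof. by move=> wF Di; rewrite -row_ract -linear_ract wF. Qed.

(* In a generating family minimizing the sum of the degree bounds c i, the leading
   forms satisfy no relation: it would lower one of the bounds. *)
Lemma basis_exists F0 : generates F0 -> path_valued phi F0 -> fam_wf L F0 ->
  exists F, is_basis L F.
Proof.
move=> gF0 pF0 wF0.
pose T := {F : fam & fI F -> nat}.
pose ok (t : T) := let: existT F c := t in [/\ fam_wf L F, generates F &
  forall i k, fD F i -> pspan (fun k => k < c i)%N (phi (fm F i) 0 k)].
pose cost (t : T) := let: existT F c := t in (\sum_(i | fD F i) c i)%N.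
(* The bounds are strict: a member with [c i = 0] is zero, and the leading form of any other has
   degree [c i - 1]. *)
have [|[F c] [wF gF cF] mn] := @exists_argmin T ok cost.
  have bd (i : fI F0) : exists N, fD F0 i -> forall k, pspan (fun k => k < N)%N (phi (fm F0 i) 0 k).
    have [Di|nDi] := boolP (fD F0 i); last by exists 0%N.
    have [N hN] := @choice _ _ (fun k N => pspan (fun k => k < N)%N (phi (fm F0 i) 0 k))
      (fun k => let: ex_intro N h := ps_bounded (pF0 i k Di) in
         ex_intro _ N (ps_sub (fun k h => proj2 (andP h)) h)).
    exists (\max_k N k)%N => _ k; apply: ps_sub (hN k) => m /= h.
    by apply: leq_trans h _; apply: leq_bigmax.
  have [c hc] := @choice _ _ _ bd.
  by exists (existT _ F0 c); split=> // i k Di; apply: hc.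
pose D' := [pred i | fD F i && (0 < c i)%N].
pose F' : fam := @Fam E P (fI F) D' (fm F) (fv F) (fd F).
have m0 i : fD F i -> ~~ D' i -> fm F i = 0.
  move=> Di; rewrite /= Di -eqn0Ngt => /eqP c0; apply: phi_eq => k.
  by rewrite raddf0 mxE (ps_empty _ (cF i k Di)) // => m; rewrite c0.
have pos (i : fI F) : D' i -> exists m, c i = m.+1.
  by move=> /andP[_]; case: (c i) => // m _; exists m.
exists F'; split.
- by move=> i /andP[Di _]; apply: wF.
- apply: (generates_sub gF) => i Di; have [D'i|nD'i] := boolP (D' i).
    exact: (@in_span_fm _ _ _ F').
  by rewrite m0 //; apply: in_span0.
pose ld i k : A := lcoef L (c i).-1%:Z (phi (fm F i) 0 k).
have irr i (b : fI F -> A) : D' i ->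
   (forall j, D' j -> pspan (fun k => k%:Z == (c i)%:Z - (c j)%:Z) (b j)) ->
   (forall k, ld i k = \sum_(j | D' j && (j != i)) ld j k * b j) -> False.
  move=> D'i hb e; have [Di _] := andP D'i.
  (* Subtracting the relation cancels the leading form and lowers the bound by one; the vertex
     factor keeps the member at its vertex. *)
  pose m' := (fm F i - \sum_(j | D' j && (j != i)) fm F j ∙ b j) ∙ ve (fv F i).
  pose G : fam := @Fam E P (fI F) (fD F) (fun j => if j == i then m' else fm F j) (fv F) (fd F).
  pose c' j := if j == i then (c i).-1 else c j.
  suff /mn : ok (existT _ G c').
    rewrite /cost (bigD1 i) //= [X in (_ <= X)%N](bigD1 i) //= /c' eqxx.
    rewrite [X in (_ <= _ + X)%N](eq_bigr c) => [|j /andP[_ /negPf->] //].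
    by rewrite leq_add2r; have [m ->] := pos i D'i; rewrite ltnn.
  split.
  - move=> j Dj /=; case: eqP => [->|_]; last exact: wF.
    by rewrite ractM lveM eqxx.
  - apply: (generates_sub gF) => j Dj; have [->|ji] := eqVneq j i; last first.
      by have := @in_span_fm _ _ _ G j Dj; rewrite /= (negPf ji).
    rewrite -(wF i Di) -[X in X ∙ _](subrK (\sum_(j | D' j && (j != i)) fm F j ∙ b j)).
    rewrite ractDl; apply: in_spanD.
      by have := @in_span_fm _ _ _ G i Di; rewrite /= eqxx.
    apply/in_span_act/in_span_sum => l /andP[/andP[Dl _] li]; apply: in_span_act.
    by have := @in_span_fm _ _ _ G l Dl; rewrite /= (negPf li).
  - move=> j k Dj; rewrite /c' /=; case: eqP => [_|_]; last exact: cF.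
    have [m cm] := pos i D'i.
    rewrite cm /= linear_ract row_ract; apply: ps_mul_ve.
    rewrite raddfB raddf_sum /= !mxE summxE.
    under eq_bigr => l _ do rewrite linear_ract row_ract.
    have bm l : D' l && (l != i) -> exists m', [/\ c l = m'.+1, fD F l & D' l].
      by case/andP=> D'l _; have [m'' ?] := pos l D'l; exists m''; split=> //; case/andP: D'l.
    apply: ps_drop_top.
      apply: psD; first by rewrite -cm; apply: cF.
      apply/psN/ps_sum => l /bm[m'' [cl Dl D'l]].
      apply: (@psM _ _ _ _ _ _ _ _ _ _ (cF l k Dl) (hb l D'l)) => x y.
      rewrite cl cm; lia.
    rewrite lcoefD; apply/eqP; rewrite addr_eq0; apply/eqP.
    have := e k; rewrite {1}/ld cm /= => ->.
    rewrite -sumrN lcoef_sum -sumrN; apply: eq_bigr => l /bm[m'' [cl Dl D'l]].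
    rewrite lcoefN opprK /ld cl /=.
    have bc : gcomp ((c i)%:Z - (c l)%:Z) (b l) by apply: ps_comp (hb l D'l) => x /eqP.
    by rewrite -(lcoefMr _ (cF l k Dl) bc) cl cm; congr (lcoef _ _ _); lia.
apply: indep_path => [i /andP[Di _]|a ha sa i Di]; first exact: wF.
have bnd N (a' : fI F -> A) : (forall i, D' i -> pspan (fun k => k + c i <= N)%N (a' i)) ->
    (forall k, \sum_(i | D' i) (phi (fm F i) 0 k : A) * a' i = 0) ->
    forall i, D' i -> ve (fv F i) * a' i = 0.
  elim: N a' => [|N IH] a' ha' sa' j D'j.
    by rewrite (ps_empty _ (ha' j D'j)) ?mulr0 // => x; have [m ->] := pos j D'j; lia.
  (* The part of the coefficient that meets the leading form, of degree [c i - 1], in total degree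
     [N], the highest one possible. *)
  pose t i := lcoef L (N.+1%:Z - (c i)%:Z) (a' i).
  have ht l : D' l -> pspan (fun k => k%:Z == N.+1%:Z - (c l)%:Z) (t l).
    by move=> D'l; apply: ps_sub (ps_coef _ (ha' l D'l)) => x /andP[].
  have t0 l : D' l -> ve (fv F l) * t l = 0.
    move: l; apply: (@irreducible_free _ _ _ L _ D' _ ld (fv F) (fun l => (c l)%:Z) _ _ irr N.+1%:Z t ht).
    - move=> l k /andP[Dl _]; apply: ps_sub (ps_coef _ (cF l k Dl)) => //.
    - move=> l k /andP[Dl _]; have := lcoefMr (c l).-1%:Z (cF l k Dl) (lve_comp L (fv F l)).
      by rewrite addr0 phi_ve.
    - move=> k; transitivity (lcoef L N%:Z (\sum_(i | D' i) (phi (fm F i) 0 k : A) * a' i)); last first.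
        by rewrite sa' lcoef0.
      rewrite lcoef_sum.
      apply: eq_bigr => l D'l; have [m cl] := pos l D'l; have [Dl _] := andP D'l.
      have hf := cF l k Dl; rewrite cl in hf.
      have [lN|Nl] := leqP m N.
        have := @lcoef_top _ _ _ L m (N - m) _ (a' l) hf.
        rewrite /ld /t cl subnKC // => ->; first by congr (_ * lcoef _ _ _); lia.
        by apply: ps_sub (ha' l D'l) => x; rewrite cl; lia.
      rewrite /t (ps_empty _ (ha' l D'l)) => [|x]; last by rewrite cl; lia.
      by rewrite lcoef0 !mulr0 lcoef0.
  (* By [t0] the coefficients lose their top parts once multiplied by their vertices, so the
     induction hypothesis is applied to these products. *)
  have -> : ve (fv F j) * a' j = ve (fv F j) * (ve (fv F j) * a' j) by rewrite mulrA lveM eqxx.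
  apply: (IH (fun l => ve (fv F l) * a' l)) => // [l D'l|k]; last first.
    rewrite -[RHS](sa' k); apply: eq_bigr => l /andP[Dl _].
    by rewrite mulrA phi_ve.
  have [m cl] := pos l D'l.
  have vl : pspan (fun k => k + c l <= N.+1)%N (ve (fv F l) * a' l) by apply/ps_ve_mul/ha'.
  have [lN|Nl] := leqP m N; last first.
    by rewrite (ps_empty _ vl) => [|x]; [apply: ps0|rewrite cl; lia].
  apply: (@ps_sub _ _ _ _ (fun k => k < N - m)%N) => [x|]; first by rewrite cl; lia.
  apply: ps_drop_top; first by apply: ps_sub vl => x; rewrite cl; lia.
  rewrite (lcoef_ve _ _ (ha' l D'l)) -[RHS](t0 l D'l) /t cl; congr (_ * lcoef _ _ _); lia.
have sa' k : \sum_(i | D' i) (phi (fm F i) 0 k : A) * a i = 0.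
  by rewrite -(phi_comb phi (F := F') a k) sa raddf0 mxE.
have bd j : exists N, D' j -> pspan (fun k => k + c j <= N)%N (a j).
  have [D'j|nD'j] := boolP (D' j); last by exists 0%N.
  have [N hN] := ps_bounded (ha j D'j); exists (N + c j)%N => _.
  by apply: ps_sub hN => x /= h; lia.
have [b hb] := @choice _ _ _ bd.
apply: (bnd (\max_i b i)%N a) => // j D'j; apply: ps_sub (hb j D'j) => x /= h.
by apply: leq_trans h _; apply: leq_bigmax.
Qed.

Variable G : int -> set P.
Hypothesis gG : is_grading G.
Hypothesis GZ : forall m n x a, G m x -> gcomp n a -> G (m + n) (x ∙ a).

Definition homogeneous F := forall i, fD F i -> G (fd F i) (fm F i).

Lemma grading_sum (I : Type) (r : seq I) (D : pred I) m (x : I -> P) :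
  (forall i, D i -> G m (x i)) -> G m (\sum_(i <- r | D i) x i).
Proof.
move=> h; apply: (big_ind (G m)) => // [|y z]; last exact: gradingD.
by have [/(_ m)[]] := gG.
Qed.

(** No leading forms are needed here: a minimal generating subfamily of homogeneous members is a
    basis, because relations split along the grading of [P]. The embedding [phi] need not respect
    any grading. *)
Lemma homogeneous_basis_exists F0 : generates F0 -> path_valued phi F0 -> fam_wf L F0 ->
  homogeneous F0 -> exists F, is_basis L F /\ homogeneous F.
Proof.
move=> gF0 pF0 wF0 hF0.
pose sub (D : pred (fI F0)) : fam := @Fam E P (fI F0) D (fm F0) (fv F0) (fd F0).
have [|D [sD gD] mn] := @exists_argmin (pred (fI F0))
   (fun D => subpred D (fD F0) /\ generates (sub D)) (fun D => #|D|).
  by exists (fD F0); split=> //; apply: (generates_sub gF0) => i; apply: (@in_span_fm _ _ _ (sub _)).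
exists (sub D); split; last by move=> i /sD; apply: hF0.
split=> //; first by move=> i /sD; apply: wF0.
apply: indep_path => [i /sD|a ha sa i Di]; first exact: wF0.
pose f i k : A := phi (fm F0 i) 0 k.
have irr j (b : fI F0 -> A) : D j ->
   (forall l, D l -> pspan (fun k => k%:Z == fd F0 j - fd F0 l) (b l)) ->
   (forall k, f j k = \sum_(l | D l && (l != j)) f l k * b l) -> False.
  move=> Dj _ e.
  suff /mn : subpred [predD1 D & j] (fD F0) /\ generates (sub [predD1 D & j]).
    by rewrite [X in (X <= _)%N](cardD1 j) (_ : j \in D = true) // add1n ltnn.
  split=> [l /andP[_ /sD]//|].
  apply: (generates_sub gD) => l Dl; have [->|lj] := eqVneq l j; last first.
    by apply: (@in_span_fm _ _ _ (sub _)); apply/andP.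
  exists b; apply: phi_eq => k; rewrite phi_comb /= -/(f j k) e.
  by apply: eq_bigl => i'; rewrite andbC.
have [N hN] : exists N, forall i, D i -> pspan (fun k => k < N)%N (a i).
  have bd j : exists N, D j -> pspan (fun k => k < N)%N (a j).
    have [Dj|nDj] := boolP (D j); last by exists 0%N.
    by have [N hN] := ps_bounded (ha j Dj); exists N => _; apply: ps_sub hN.
  have [b hb] := @choice _ _ _ bd.
  exists (\max_i b i)%N => j Dj; apply: ps_sub (hb j Dj) => x /= h.
  by apply: leq_trans h _; apply: leq_bigmax.
(* The component of degree [z] of the relation, with respect to [G]; the sum being direct, each of
   them vanishes. *)
pose y z := \sum_(i | D i) fm F0 i ∙ lcoef L (z - fd F0 i) (a i).
have Gy z : G z (y z).
  apply: grading_sum => j Dj.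
  have cz : gcomp (z - fd F0 j) (lcoef L (z - fd F0 j) (a j)).
    by apply: ps_comp (ps_coef _ (ha j Dj)) => x /andP[_ /eqP].
  by have := GZ (hF0 j (sD j Dj)) cz; rewrite addrC subrK.
(* All degrees in which a term of the relation can have a nonzero component. *)
pose s := undup [seq fd F0 i + k%:Z | i <- enum (fI F0), k <- iota 0 N].
have ys : \sum_(z <- s) y z = 0.
  rewrite -[RHS]sa exchange_big; apply: eq_bigr => j Dj; rewrite -ract_sumr; congr (_ ∙ _).
  rewrite [RHS](ps_sum_coef (hN j Dj)).
  pose t := [seq fd F0 j + k%:Z | k <- iota 0 N].
  have inj : injective (fun k : nat => fd F0 j + k%:Z) by move=> k l /addrI[].
  have ut : uniq t by rewrite map_inj_uniq // iota_uniq.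
  have ts : perm_eq [seq z <- s | z \in t] t.
    apply: uniq_perm => //; first by rewrite filter_uniq ?undup_uniq.
    move=> z; rewrite mem_filter; case: (boolP (z \in t)) => //= /mapP[k kN ->].
    by rewrite mem_undup; apply/allpairsP; exists (j, k); rewrite mem_enum.
  rewrite (bigID (fun z => z \in t)) /= [X in _ + X]big1 ?addr0 => [|z zt]; last first.
    apply: (ps_empty _ (ps_coef _ (hN j Dj))) => k; apply/negbTE.
    apply: contra zt => /andP[kN /eqP e]; apply/mapP; exists k; first by rewrite mem_iota.
    by rewrite e addrC subrK.
  rewrite -big_filter (perm_big _ ts) big_map -{1}[N]subn0 big_mkord.
  by apply: eq_bigr => k _; rewrite addrC addrA addNr add0r.
have y0 z : y z = 0.
  have [zs|zs] := boolP (z \in s).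
    by have [_ _ h] := gG; apply: (h s y (undup_uniq _) Gy ys).
  rewrite /y big1 // => j Dj; rewrite [X in _ ∙ X](_ : _ = 0) ?ract0 //.
  apply: (ps_empty _ (ps_coef _ (hN j Dj))) => k; apply/negbTE.
  apply: contra zs => /andP[kN /eqP e].
  rewrite mem_undup; apply/allpairsP; exists (j, k); rewrite mem_enum mem_iota kN e.
  by split=> //; rewrite addrC subrK.
apply: (@ps_coef_eq0 _ _ _ L predT) => [|k]; first exact/ps_ve_mul/ha.
rewrite (lcoef_ve _ _ (ha i Di)) -[k%:Z](addrK (fd F0 i)).
apply: (@irreducible_free _ _ _ L _ D _ f (fv F0) (fd F0) _ _ irr (k%:Z + fd F0 i)
  (fun j => lcoef L (k%:Z + fd F0 i - fd F0 j) (a j))) => //.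
- by move=> l k' /sD; apply: pF0.
- by move=> l k' /sD; apply: phi_ve.
- by move=> l Dl; apply: ps_sub (ps_coef _ (ha l Dl)).
move=> k'; have := congr1 (fun v : 'rV_n => v 0 k') (congr1 phi (y0 (k%:Z + fd F0 i))).
rewrite raddf0 mxE; apply: etrans; symmetry.
exact: (phi_comb phi (F := sub D) (fun j => lcoef L (k%:Z + fd F0 i - fd F0 j) (a j))).
Qed.

End BasisExists.

(** * Invariance of the vertices of a basis *)

Section Restriction.
Variables (K : fieldType) (E : finDigraph) (A : gradedRing) (L : lpa_family K E A).
Variable P : lmodType A^c.

(** The phantom argument selects the embedding [lsc L] of the field along which scalars are
    restricted. *)
Definition kmod of lpa_family K E A : Type := P.
Local Notation kP := (kmod L).
HB.instance Definition _ := GRing.Zmodule.on kP.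

Definition kscale (c : K) (x : kP) : kP := (x : P) ∙ lsc L c.

Fact kscaleA a b x : kscale a (kscale b x) = kscale (a * b) x.
Proof. by rewrite /kscale ractM -lscM mulrC. Qed.
Fact kscale1 : left_id 1 kscale.
Proof. by move=> x; rewrite /kscale lsc1 ract1. Qed.
Fact kscaleDr : right_distributive kscale +%R.
Proof. by move=> c x y; apply: ractDl. Qed.
Fact kscaleDl x : {morph kscale^~ x : a b / a + b}.
Proof. by move=> a b; rewrite /kscale lscD; apply: ractDr. Qed.
HB.instance Definition _ :=
  GRing.Zmodule_isLmodule.Build K kP kscaleA kscale1 kscaleDr kscaleDl.

Lemma kscaleE (c : K) (x : kP) : c *: x = (x : P) ∙ lsc L c.
Proof. by []. Qed.

Local Notation ve := (lve L).
Local Notation ed := (led L).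
Local Notation gh := (lgh L).
Local Notation E0 := (dvert E).
Local Notation E1 := (dedge E).
Local Notation word := (word L).
Local Notation pspan := (pspan L).
Local Notation fam := (fam E P).
Implicit Types (F : fam) (B C : set P).

Definition path_submodule B := [/\ B 0, forall x y, B x -> B y -> B (x + y),
  forall c x, B x -> B (x ∙ lsc L c), forall v x, B x -> B (x ∙ ve v) &
  forall e x, B x -> B (x ∙ ed e)].

Lemma path_submodule_sum B (I : Type) (r : seq I) (D : pred I) (x : I -> P) :
  path_submodule B -> (forall i, D i -> B (x i)) -> B (\sum_(i <- r | D i) x i).
Proof. by move=> [B0 BD _ _ _] h; apply: big_ind. Qed.

Lemma path_submodule_subspace B : path_submodule B -> subspace (B : set kP).
Proof. by move=> [B0 BD BZ _ _]; split=> // c u v hu hv; apply: BD => //; apply: BZ. Qed.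

Lemma path_submodule_word B x p : path_submodule B -> B x -> B (x ∙ word p).
Proof.
move=> [_ _ _ _ Be]; elim: p x => [|e p IH] x hx; first by rewrite word_nil ract1.
by rewrite word_cons -ractM; apply/IH/Be.
Qed.

Lemma path_submodule_act B S x a : path_submodule B -> pspan S a -> B x -> B (x ∙ a).
Proof.
move=> sB ha hx; have [B0 BD BZ Bv _] := sB; elim: ha => [|b c _ hb _ hc|c q v _].
- by rewrite ract0.
- by rewrite ractDr; apply: BD.
- by rewrite -ractM -ractM; apply: Bv; apply: path_submodule_word => //; apply: BZ.
Qed.

Lemma ract_sc x c a : x ∙ lsc L c ∙ a = x ∙ a ∙ lsc L c :> P.
Proof. by rewrite !ractM lscC. Qed.

Lemma fm_ve F i v : fam_wf L F -> fD F i -> fm F i ∙ ve v = if fv F i == v then fm F i else 0.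
Proof.
move=> wF Di; rewrite -{1}(wF i Di) ractM lveM; case: eqP => _; first exact: wF.
by rewrite ract0.
Qed.

(* A basis of B / C over K whose members are located at vertices. *)
Definition kbasis C B F := [/\ fam_wf L F, forall i, fD F i -> B (fm F i),
  @free_mod K kP C _ (fD F) (fm F) & @span_mod K kP C B _ (fD F) (fm F)].

(** Right multiplication by [ve v] cuts B / C down to its part at [v]: it fixes the members located
    at [v] and kills the others. *)
Lemma kbasis_count C B F F' v : path_submodule C -> kbasis C B F -> kbasis C B F' ->
  (#|[pred i | fD F i && (fv F i == v)]| <= #|[pred i | fD F' i && (fv F' i == v)]|)%N.
Proof.
move=> sC [wF BF fF _] [wF' BF' _ sF']; have [C0 CD CZ Cv _] := sC.
apply: (@free_span_card K kP C [set x | B x /\ x ∙ ve v = x]) (path_submodule_subspace sC) _ _ _.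
- by move=> i /andP[Di /eqP iv]; split; [apply: BF|rewrite -iv; apply: wF].
- move=> c hc i /= /andP[Di iv].
  have /(_ _ i Di) := fF (fun i => if fv F i == v then c i else 0).
  rewrite iv; apply; move: hc; congr (C _); rewrite big_mkcondr.
  by apply: eq_bigr => j _; case: eqP => // _; rewrite scale0r.
- move=> b [Bb bv]; have [c hc] := sF' b Bb; exists c.
  have := Cv v _ hc; rewrite ractBl bv ract_suml; congr (C (_ - _)).
  rewrite [RHS]big_mkcondr; apply: eq_bigr => i Di.
  rewrite kscaleE ract_sc fm_ve //; case: eqP => // _; exact: ract0l.
Qed.

Lemma kbasis_sum (H : zmodType) (h : E0 -> H) C B F F' : path_submodule C ->
  kbasis C B F -> kbasis C B F' -> fam_sum h F = fam_sum h F'.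
Proof.
move=> sC bF bF'.
have cE G : fam_sum h G = \sum_v h v *+ #|[pred i | fD G i && (fv G i == v)]|.
  rewrite /fam_sum (partition_big (fv G) xpredT) //=; apply: eq_bigr => v _.
  by rewrite -sumr_const; apply: eq_bigr => i /andP[_ /eqP->].
rewrite !cE; apply: eq_bigr => v _; congr (_ *+ _).
by apply/eqP; rewrite eqn_leq; apply/andP; split; apply: (@kbasis_count C B).
Qed.

Definition fam_cat F F' : fam :=
  @Fam E P (fI F + fI F')%type
    (fun x => match x with inl i => fD F i | inr j => fD F' j end)
    (fun x => match x with inl i => fm F i | inr j => fm F' j end)
    (fun x => match x with inl i => fv F i | inr j => fv F' j end)
    (fun x => match x with inl i => fd F i | inr j => fd F' j end).

Lemma fam_cat_sum (H : zmodType) (h : E0 -> H) F F' :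
  fam_sum h (fam_cat F F') = fam_sum h F + fam_sum h F'.
Proof. by rewrite /fam_sum big_sumType. Qed.

Lemma fam_cat_wf F F' : fam_wf L F -> fam_wf L F' -> fam_wf L (fam_cat F F').
Proof. by move=> wF wF' [i|i] /=; [apply: wF|apply: wF']. Qed.

Lemma fam_cat_span C B B' F F' : path_submodule C -> (forall i, fD F' i -> B' (fm F' i)) ->
  @span_mod K kP C B _ (fD F) (fm F) -> @span_mod K kP B B' _ (fD F') (fm F') ->
  @span_mod K kP C B' _ (fD (fam_cat F F')) (fm (fam_cat F F')).
Proof.
move=> sC BF' sF sF' b /sF'[c' /sF[c hc]].
exists (fun x => match x with inl i => c i | inr j => c' j end).
by rewrite big_sumType /= opprD addrA addrAC.
Qed.

Lemma kbasis_cat C B B' F F' :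
  path_submodule C -> path_submodule B -> path_submodule B' -> C `<=` B -> B `<=` B' ->
  kbasis C B F -> kbasis B B' F' -> kbasis C B' (fam_cat F F').
Proof.
move=> sC sB sB' CB BB' [wF BF fF sF] [wF' BF' fF' sF']; split.
- exact: fam_cat_wf.
- by move=> [i|i] /= Di; [apply/BB'/BF|apply: BF'].
- move=> c; rewrite big_sumType /= => hc.
  have BFs : B (\sum_(i | fD F i) c (inl i) *: (fm F i : kP)).
    by have [_ _ BZ _ _] := sB; apply: (@path_submodule_sum B) => // i Di; apply/BZ/BF.
  have c2 i : fD F' i -> c (inr i) = 0.
    apply: (fF' (fun i => c (inr i))).
    have := subspaceB (path_submodule_subspace sB) (CB _ hc) BFs.
    by rewrite addrAC subrr add0r.
  move: hc; rewrite [X in _ + X]big1 => [|i Di]; last by rewrite c2 // scale0r.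
  rewrite addr0 => hc [i|i] Di; last exact: c2.
  exact: (fF (fun i => c (inl i))).
- exact: fam_cat_span sF sF'.
Qed.

(** The product BJ with the edge ideal, in the normal form suggested by the freeness of J on the
    edges: the coefficient of [e] is located at the source of [e]. *)
Definition jmul B : set P := [set x | exists y : E1 -> P,
  [/\ forall e, B (y e), forall e, y e ∙ ve (dsrc e) = y e & x = \sum_e y e ∙ ed e]].

(** Uniqueness of the normal form in [jmul], or injectivity of the multiplication map from the
    tensor product of B and J over Q. *)
Definition edge_free B := forall y : E1 -> P, (forall e, B (y e)) ->
  (forall e, y e ∙ ve (dsrc e) = y e) -> \sum_e y e ∙ ed e = 0 -> forall e, y e = 0.

Lemma jmul_ed B e x : path_submodule B -> B x -> jmul B (x ∙ ed e).
Proof.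
move=> [B0 _ _ Bv _] Bx; exists (fun f => if f == e then x ∙ ve (dsrc e) else 0).
split=> [f|f|]; first by case: ifP => // _; apply: Bv.
  by case: eqP => [->|_]; rewrite ?ract0l // ractM lveM eqxx.
rewrite (bigD1 e) //= eqxx big1 => [|f /negPf->]; last by rewrite ract0l.
by rewrite ractM lsrcM addr0.
Qed.

Lemma path_submodule_jmul B : path_submodule B -> path_submodule (jmul B).
Proof.
move=> sB; have [B0 BD BZ Bv Be] := sB.
have JD x y : jmul B x -> jmul B y -> jmul B (x + y).
  move=> [u [Bu vu ->]] [w [Bw vw ->]]; exists (fun e => u e + w e); split=> [e|e|].
  - exact: BD.
  - by rewrite ractDl vu vw.
  - by rewrite -big_split; apply: eq_bigr => e _; rewrite ractDl.
have J0 : jmul B 0.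
  exists (fun=> 0); split=> // [e|]; first by rewrite ract0l.
  by rewrite big1 // => e _; rewrite ract0l.
have Jact a x : (forall e y, B y -> jmul B (y ∙ (ed e * a))) -> jmul B x -> jmul B (x ∙ a).
  move=> h [u [Bu _ ->]]; rewrite ract_suml; apply: (big_ind (jmul B)) => // e _.
  by rewrite ractM; apply: h.
split=> // [c x|v x|e x]; apply: Jact => f y By.
- by rewrite -lscC -ractM; apply/jmul_ed/BZ.
- by rewrite ed_ve; case: eqP => _; [apply: jmul_ed|rewrite ract0].
- by rewrite -ractM; apply/jmul_ed/Be.
Qed.

Lemma jmul_sub B : path_submodule B -> jmul B `<=` B.
Proof.
move=> sB _ [y [By _ ->]]; apply: path_submodule_sum => // e _.
by have [_ _ _ _ Be] := sB; apply: Be.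
Qed.

Lemma jmulS B C : B `<=` C -> jmul B `<=` jmul C.
Proof. by move=> BC x [y [By vy e]]; exists y; split=> // f; apply: BC. Qed.

Lemma span_refine1 C B F : path_submodule C -> fam_wf L F ->
  @span_mod K kP C B _ (fD F) (fm F) ->
  @span_mod K kP (jmul C) (jmul B) _ (fD (refine1 L F)) (fm (refine1 L F)).
Proof.
move=> sC wF sF _ [y [By vy ->]].
have [_ _ _ Cv _] := sC.
have [c hc] := @choice _ _ (fun e c => C (y e - \sum_(i | fD F i) c i *: (fm F i : kP)))
  (fun e => sF (y e) (By e)).
exists (fun x => c x.2 x.1).
rewrite [X in _ - X](_ : _ =
    \sum_e (\sum_(i | fD F i && (dsrc e == fv F i)) c e i *: (fm F i : kP)) ∙ ed e).
  rewrite -sumrB.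
  exists (fun e => (y e - \sum_(i | fD F i) c e i *: (fm F i : kP)) ∙ ve (dsrc e)); split=> [e|e|].
  - exact: Cv.
  - by rewrite ractM lveM eqxx.
  - apply: eq_bigr => e _; rewrite -ractBl; congr (_ ∙ _).
    rewrite ractBl vy ract_suml; congr (_ - _).
    rewrite big_mkcondr; apply: eq_bigr => i Di.
    by rewrite kscaleE ract_sc fm_ve // eq_sym; case: eqP => // _; rewrite ract0l.
under [RHS]eq_bigr => e _ do rewrite ract_suml.
rewrite (exchange_big_dep (fD F)) => [|e i _ /andP[]//] /=.
rewrite pair_big_dep /=.
apply: eq_big => [[i e]|[i e] _] /=; first by case: (fD F i).
by rewrite !kscaleE ract_sc.
Qed.

(** This is how B / C determines BJ / CJ: by [edge_free], an element of CJ has all its edge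
    coefficients in [C], so a relation splits into one relation modulo [C] for each edge. *)
Lemma kbasis_refine1 C B F : path_submodule C -> path_submodule B -> C `<=` B -> edge_free B ->
  kbasis C B F -> kbasis (jmul C) (jmul B) (refine1 L F).
Proof.
move=> sC sB CB eB [wF BF fF sF]; split.
- exact: refine1_wf.
- by move=> [i e] /= /andP[Di _]; apply/jmul_ed/BF.
- move=> c [y [Cy vy]].
  pose z e : P := \sum_(i | fD F i && (dsrc e == fv F i)) c (i, e) *: (fm F i : kP).
  rewrite [LHS](_ : _ = \sum_e z e ∙ ed e); last first.
    under [RHS]eq_bigr => e _ do rewrite ract_suml.
    rewrite (exchange_big_dep (fD F)) => [|e i _ /andP[]//] /=.
    rewrite pair_big_dep /=.
    by apply: eq_big => [[i e]|[i e] _] /=; [case: (fD F i)|rewrite !kscaleE ract_sc].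
  move=> ezy; have zy e : z e - y e = 0.
    move: e; apply: eB => [e|e|].
    + apply: (@subspaceB K kP B _ _ (path_submodule_subspace sB)); last exact: CB.
      apply: (@path_submodule_sum B) => // i /andP[Di _].
      by have [_ _ BZ _ _] := sB; apply/BZ/BF.
    + rewrite ractBl vy; congr (_ - _); rewrite ract_suml; apply: eq_bigr => i /andP[Di /eqP->].
      by rewrite kscaleE ract_sc wF.
    + by under eq_bigr => e _ do rewrite ractBl; rewrite sumrB ezy subrr.
  move=> [i e] /= /andP[Di se].
  have := fF (fun i => if dsrc e == fv F i then c (i, e) else 0).
  rewrite [X in C X -> _](_ : _ = z e) => [|]; last first.
    by rewrite /z big_mkcondr; apply: eq_bigr => j _; case: eqP => // _; rewrite scale0r.
  by move/eqP: (zy e); rewrite subr_eq0 => /eqP-> /(_ (Cy e) i Di); rewrite se.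
- exact: span_refine1.
Qed.

Definition lattice F : set P :=
  [set x | exists a : fI F -> A, (forall i, pspan predT (a i)) /\ x = fcomb a].

Lemma path_submodule_lattice F : path_submodule (lattice F).
Proof.
have act b x : pspan predT b -> lattice F x -> lattice F (x ∙ b).
  move=> hb [a [ha ->]]; exists (fun i => a i * b); split=> [i|].
    by apply: (@psM _ _ _ _ predT predT).
  by rewrite /fcomb ract_suml; apply: eq_bigr => i _; rewrite ractM.
split=> [|x y [a [ha ->]] [b [hb ->]]|c x|v x|e x].
- exists (fun=> 0); split=> [i|]; first exact: ps0.
  by rewrite /fcomb big1 // => i _; rewrite ract0.
- exists (fun i => a i + b i); split=> [i|]; first exact: psD.
  by rewrite /fcomb -big_split; apply: eq_bigr => i _; rewrite ractDr.
- by apply: act; rewrite -[lsc L c]mulr1 -(word_nil L); apply: ps_word1.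
- by apply: act; apply: ps_ve.
- by apply: act; apply: ps_ed.
Qed.

Lemma lattice_fm F i : fD F i -> lattice F (fm F i).
Proof.
move=> Di; exists (fun j => if j == i then 1 else 0); split=> [j|].
  case: ifP => _; last exact: ps0.
  by rewrite -(word_nil L); apply: ps_wordX.
rewrite /fcomb (bigD1 i) //= eqxx ract1 big1 ?addr0 // => j /andP[_ /negPf->].
by rewrite ract0.
Qed.

Lemma lattice_min F B : path_submodule B -> (forall i, fD F i -> B (fm F i)) -> lattice F `<=` B.
Proof.
move=> sB h _ [a [ha ->]]; apply: path_submodule_sum => // i Di.
exact: (path_submodule_act sB (ha i) (h i Di)).
Qed.

(** Independence over L splits a relation into its coordinates, which lie in the path algebra, where
    [ps_ed_free] applies. *)
Lemma lattice_edge_free F : is_basis L F -> edge_free (lattice F).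
Proof.
move=> [wF _ iF] y hy vy sy.
have [a ha] := @choice _ _ _ hy.
have s0 : fcomb (fun i => \sum_e a e i * ed e) = 0 :> P.
  rewrite -[RHS]sy /fcomb; under eq_bigr => i _ do rewrite ract_sumr.
  rewrite exchange_big; apply: eq_bigr => e _; have [_ {1}->] := ha e.
  by rewrite /fcomb ract_suml; apply: eq_bigr => i _; rewrite ractM.
have a0 i e : fD F i -> ve (fv F i) * a e i * ve (dsrc e) = 0.
  move=> Di; move: e; apply: (@ps_ed_free _ _ _ L) => [e|e|].
  - by apply/ps_mul_ve/ps_ve_mul; have [] := ha e.
  - by rewrite -mulrA lveM eqxx.
  - rewrite -[RHS](iF _ s0 i Di) mulr_sumr; apply: eq_bigr => e _.
    by rewrite -mulrA lsrcM mulrA.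
move=> e; rewrite -vy; have [_ ->] := ha e.
rewrite /fcomb ract_suml big1 // => i Di.
by rewrite -(wF i Di) !ractM mulrA a0 // ract0.
Qed.

Lemma ps_split v a : pspan predT a -> exists c (b : E1 -> A),
  (forall e, pspan predT (b e)) /\ ve v * a = lsc L c * ve v + \sum_e b e * ed e.
Proof.
elim=> [|x y _ [c [b [hb ex]]] _ [c' [b' [hb' ey]]]|c q w _].
- exists 0, (fun=> 0); split=> [e|]; first exact: ps0.
  by rewrite mulr0 lsc0 mul0r add0r big1 // => e _; rewrite mul0r.
- exists (c + c'), (fun e => b e + b' e); split=> [e|]; first exact: psD.
  rewrite mulrDr ex ey lscD mulrDl addrACA -big_split; congr (_ + _).
  by apply: eq_bigr => e _; rewrite mulrDl.
have [q0|q0] := eqVneq (size q) 0%N.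
  have [||d hd] := @ps_vertex _ _ _ L (pred1 0%N) v (lsc L c * (word q * ve w)).
  - by move=> k /eqP.
  - by apply: ps_word; apply/eqP.
  exists d, (fun=> 0); split=> [e|]; first exact: ps0.
  by rewrite hd big1 ?addr0 // => e _; rewrite mul0r.
have [||b [eb hb _]] := @ps_strip _ _ _ L (predC1 0%N) (ve v * (lsc L c * (word q * ve w))).
- by [].
- by apply: ps_ve_mul; apply: ps_word.
exists 0, b; split=> [e|]; last by rewrite lsc0 mul0r add0r.
by apply: ps_sub (hb e).
Qed.

(** The lattice M is the direct sum of copies of the v_i Q, and v_i Q / v_i J is the line spanned by
    v_i. *)
Lemma basis_kbasis F : is_basis L F -> kbasis (jmul (lattice F)) (lattice F) F.
Proof.
move=> [wF gF iF]; have sM := path_submodule_lattice F; split=> //.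
- exact: lattice_fm.
- move=> c [y [hy vy e]] i Di; have [a ha] := @choice _ _ _ hy.
  have s0 : fcomb (fun i => lsc L (c i) - \sum_e a e i * ed e) = 0 :> P.
    rewrite /fcomb; under eq_bigr => j _ do rewrite ractDr ractNr.
    rewrite big_split sumrN /= [X in X - _]e; apply/eqP; rewrite subr_eq0; apply/eqP.
    under [RHS]eq_bigr => j _ do rewrite ract_sumr.
    rewrite exchange_big; apply: eq_bigr => f _; have [_ {1}->] := ha f.
    by rewrite /fcomb ract_suml; apply: eq_bigr => j _; rewrite ractM.
  have p1 : pspan (predC1 0%N) (ve (fv F i) * \sum_e a e i * ed e).
    apply/ps_ve_mul/ps_sum => f _.
    apply: (@psM _ _ _ _ predT (pred1 1%N)) => [k k' _ /eqP->| |]; first by rewrite addn1.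
      by have [] := ha f.
    exact: ps_ed.
  (* The edge part has no component of degree 0, so only [c i] times the vertex remains. *)
  have := congr1 (lcoef L 0) (iF _ s0 i Di); rewrite mulrBr lcoefD lcoefN.
  rewrite (@lcoef_out _ _ _ L _ 0 _ _ p1) // subr0 lcoef0 -lscC.
  rewrite (@lcoefE _ _ _ _ _ 0) ?eqxx; first exact: lsc_eq0.
  by rewrite -[X in gcomp X]addr0; apply: gcompM; [apply: lsc_comp|apply: lve_comp].
- move=> _ [a [ha ->]].
  have [c hc] := @choice _ _ _ (fun i => @ps_split (fv F i) (a i) (ha i)).
  have [b hb] := @choice _ _ _ hc.
  exists c.
  rewrite (_ : _ - _ = \sum_e (\sum_(i | fD F i) fm F i ∙ b i e) ∙ ed e :> P).
    have sJ := path_submodule_jmul sM.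
    apply: path_submodule_sum => // e _; apply: jmul_ed => //.
    apply: path_submodule_sum => // i Di; have [hbi _] := hb i.
    exact: (path_submodule_act sM (hbi e) (lattice_fm Di)).
  rewrite /fcomb -sumrB; under [RHS]eq_bigr => e _ do rewrite ract_suml.
  rewrite exchange_big; apply: eq_bigr => i Di; have [_ e] := hb i.
  rewrite -{1}(wF i Di) ractM e ractDr lscC -ractM wF // kscaleE addrC addKr ract_sumr.
  by apply: eq_bigr => f _; rewrite ractM.
Qed.

(** [T] is arbitrary because the induction passes to the elements sent into [T] by an edge. *)
Lemma iter_jmul_sub (B T : set P) n : T 0 -> (forall x y, T x -> T y -> T (x + y)) ->
  (forall y p, B y -> size p = n -> T (y ∙ word p)) -> iter n jmul B `<=` T.
Proof.
elim: n T => [|n IH] T T0 TD h x; first by move=> Bx; rewrite -[x]ract1 -(word_nil L); apply: h.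
move=> [y [hy _ ->]]; apply: (big_ind T) => // e _.
apply: (IH [set z | T (z ∙ ed e)]) (hy e) => /=.
- by rewrite ract0l.
- by move=> u w hu hw; rewrite ractDl; apply: TD.
- by move=> z p Bz sp; rewrite ractM -word_rcons; apply: h; rewrite ?size_rcons ?sp.
Qed.

Lemma lattice_absorb F F' : is_basis L F ->
  exists n, forall y p, lattice F' y -> (n <= size p)%N -> lattice F (y ∙ word p).
Proof.
move=> [_ gF _]; have sM := path_submodule_lattice F.
have [l hl] := @choice _ _ _ (fun j => gF (fm F' j)).
have [n hn] := ps_absorb_fin L (fun x : fI F' * fI F => l x.1 x.2).
have hm j q : (n <= size q)%N -> lattice F (fm F' j ∙ word q).
  move=> nq; exists (fun i => l j i * word q); split=> [i|]; first exact: (hn (j, i)).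
  by rewrite hl /fcomb ract_suml; apply: eq_bigr => i _; rewrite ractM.
exists n => _ p [a [ha ->]] np; rewrite /fcomb ract_suml; apply: path_submodule_sum => // j _.
rewrite ractM; apply: (@ps_mul_word _ _ _ L (fun x => lattice F (fm F' j ∙ x)) (size p) (a j)) => //.
- by rewrite ract0; have [] := sM.
- by have [_ D _ _ _] := sM; move=> x y hx hy; rewrite ractDr; apply: D.
- by move=> q b sq hb; rewrite -ractM; apply: (path_submodule_act sM hb); apply: hm; rewrite sq.
Qed.

(** Makes M'/M finite-dimensional once M contains M'J^n. A spanning family modulo BJ^n, multiplied
    by edges, spans BJ modulo BJ^(n+1), and [F] accounts for B / BJ. *)
Lemma spanning_exists B n F : path_submodule B -> kbasis (jmul B) B F -> exists F', [/\ fam_wf L F',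
  forall i, fD F' i -> B (fm F' i) & @span_mod K kP (iter n jmul B) B _ (fD F') (fm F')].
Proof.
move=> sB [wF BF _ sF].
have sJ k : path_submodule (iter k jmul B) by elim: k => //= k; apply: path_submodule_jmul.
elim: n => [|n [F' [wF' BF' sF']]].
  exists (@Fam E P void xpredT (of_void _) (of_void _) (of_void _)).
  by split=> [[]|[]|b hb]; exists (fun=> 0); rewrite big1 ?subr0 // => -[].
exists (fam_cat (refine1 L F') F); split.
- by apply: fam_cat_wf => //; apply: refine1_wf.
- move=> [[i e]|i] /=; last exact: BF.
  by case/andP => /BF' hi _; have [_ _ _ _ Be] := sB; apply: Be.
- apply: (@fam_cat_span _ (jmul B)) => //.
  by apply: span_refine1; [apply: sJ| |].
Qed.

(* Both m + x and m' + x e are bases of M' / M J, where x is a basis of M' / M. *)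
Lemma basis_sum_aux (H : zmodType) (h : E0 -> H) F F' :
  (forall v, h v = \sum_(e | dsrc e == v) h (drng e)) ->
  is_basis L F -> is_basis L F' -> (forall i, fD F i -> lattice F' (fm F i)) ->
  fam_sum h F = fam_sum h F'.
Proof.
move=> hh bF bF' FF'.
have sM := path_submodule_lattice F; have sM' := path_submodule_lattice F'.
have MM' : lattice F `<=` lattice F' by apply: lattice_min.
have [n hn] := lattice_absorb F' bF.
have [G [wG BG sG]] := spanning_exists n sM' (basis_kbasis bF').
have JM : iter n jmul (lattice F') `<=` lattice F.
  apply: iter_jmul_sub; [by have [] := sM|by have [] := sM|].
  by move=> y p hy sp; apply: hn => //; rewrite sp.
have sG' : @span_mod K kP (lattice F) (lattice F') _ (fD G) (fm G).
  by move=> b /sG[c hc]; exists c; apply: JM.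
have [D [sD spD fD']] := span_mod_free (path_submodule_subspace sM) sG'.
pose X : fam := @Fam E P (fI G) D (fm G) (fv G) (fd G).
have bX : kbasis (lattice F) (lattice F') X.
  by split=> // i /sD; [apply: wG|apply: BG].
have b1 := kbasis_cat (path_submodule_jmul sM) sM sM' (@jmul_sub _ sM) MM' (basis_kbasis bF) bX.
have b2 := kbasis_cat (path_submodule_jmul sM) (path_submodule_jmul sM') sM' (jmulS MM') (@jmul_sub _ sM')
  (kbasis_refine1 sM sM' MM' (lattice_edge_free bF') bX) (basis_kbasis bF').
have := kbasis_sum h (path_submodule_jmul sM) b1 b2.
(* The family x and its refinement x e contribute equally to the two sums and cancel. *)
by rewrite !fam_cat_sum refine1_sum // addrC => /addrI.
Qed.

(** Refining [F] often enough, which keeps the sum, moves its members into the lattice of [F']. *)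
Lemma basis_sum (H : zmodType) (h : E0 -> H) F F' :
  (forall v, h v = \sum_(e | dsrc e == v) h (drng e)) ->
  is_basis L F -> is_basis L F' -> fam_sum h F = fam_sum h F'.
Proof.
move=> hh bF bF'; have [n hn] := lattice_absorb F bF'.
rewrite -(refine_sum L n F hh).
apply: basis_sum_aux => //; first exact: refine_basis.
move=> i /refineP[j [p [Dj sp -> _]]]; apply: hn; rewrite ?sp //.
exact: lattice_fm.
Qed.

End Restriction.

(** * The modules generated by vertices *)

Section GradedMaps.
Variables (U V : zmodType) (G : int -> set U) (H : int -> set V).
Hypotheses (gG : is_grading G) (gH : is_grading H).

(** The components of [u] outside degree [z] go to components of [f u] outside degree [z], hence to
    0. This makes the inverse of a graded bijection graded. *)
Lemma grading_reflect (f : {additive U -> V}) : injective f ->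
  (forall n u, G n u -> H n (f u)) -> forall n u, H n (f u) -> G n u.
Proof.
move=> fi fGH z u Hu.
have [G0 GE _] := gG; have [H0 _ HU] := gH.
have [l [hl ul]] := GE u.
pose g n := \sum_(x <- l | x.1 == n) x.2.
have Gg n : G n (g n).
  rewrite /g big_seq_cond; apply: (big_ind (G n)); [by have [] := G0 n|move=> x y; exact: gradingD|].
  by move=> x /andP[/hl hx /eqP <-].
pose s := undup (z :: [seq x.1 | x <- l]).
have us : u = \sum_(n <- s) g n.
  rewrite {1}ul /g (exchange_big_dep xpredT) //=; apply: eq_big_seq => x xl.
  rewrite big_mkcond (bigD1_seq x.1) ?undup_uniq //=; last first.
    by rewrite mem_undup inE map_f ?orbT.
  by rewrite eqxx big1 ?addr0 // => n; rewrite eq_sym => /negPf->.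
have zs : z \in s by rewrite mem_undup mem_head.
have f0 n : n \in s -> n != z -> g n = 0.
  move=> ns nz; apply: fi; rewrite raddf0.
  pose k n := f (g n) - (if n == z then f u else 0).
  suff : k n = 0 by rewrite /k (negPf nz) subr0.
  apply: (HU s k (undup_uniq _)) => // [m|].
    have [H00 HB] := H0 m; apply: HB; first exact: fGH.
    by case: eqP => [->|].
  rewrite sumrB -raddf_sum -us [X in _ - X](bigD1_seq z) ?undup_uniq //= eqxx big1 => [|m /negPf->//].
  by rewrite addr0 subrr.
rewrite us (bigD1_seq z) ?undup_uniq //= big1_seq ?addr0 // => m /andP[mz ms].
exact: f0.
Qed.

End GradedMaps.

Section IdempotentModule.
Variables (R : pzRingType) (a : R).

(** The left module R a for an idempotent [a]. Over the converse ring of A, with [a] a vertex v, it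
    is the right module vA. *)
Definition idem_pred : {pred R^o} := [pred x : R | x * a == x].

Fact idem_submod_closed : GRing.submod_closed idem_pred.
Proof.
split; first by rewrite inE mul0r.
by move=> c x y; rewrite !inE => /eqP hx /eqP hy; rewrite mulrDl -[c *: x]/(c * x) -mulrA hx hy.
Qed.

HB.instance Definition _ := GRing.isSubmodClosed.Build R R^o idem_pred idem_submod_closed.

Definition idem_mod : Type := {x : R^o | x \in idem_pred}.
HB.instance Definition _ := SubChoice.on idem_mod.
HB.instance Definition _ := [SubChoice_isSubLmodule of idem_mod by <:].

Lemma idem_val (x : idem_mod) : (val x : R) * a = val x.
Proof. exact/eqP/(valP x). Qed.

Hypothesis aa : a * a = a.

Fact idem_in (x : R) : (x * a : R^o) \in idem_pred.
Proof. by rewrite inE -mulrA aa. Qed.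

Definition idem_proj (x : R) : idem_mod := Sub (x * a : R^o) (idem_in x).

Lemma idem_gen (x : idem_mod) : x = (val x : R) *: idem_proj 1.
Proof. by apply: val_inj; rewrite /= mul1r -[_ *: _]/(_ * _) idem_val. Qed.

Lemma idem_fg : finitely_generated idem_mod.
Proof.
exists 1%N, (fun=> idem_proj 1) => v; exists (fun=> val v : R).
by rewrite big_ord1 -idem_gen.
Qed.

Lemma idem_projective : projective idem_mod.
Proof.
move=> M N g f gs; have [m em] := gs (f (idem_proj 1)).
have l : linear (fun x : idem_mod => (val x : R) *: m).
  by move=> c u v; rewrite scalerA -scalerDl.
exists (mklinear l) => v /=.
by rewrite linearZ em -linearZ -idem_gen.
Qed.

Definition idem_fgproj := FGProj idem_fg idem_projective.

End IdempotentModule.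

Section VertexModules.
Variables (K : fieldType) (E : finDigraph) (A : gradedRing) (L : lpa_family K E A).
Local Notation sc := (lsc L).
Local Notation ve := (lve L).
Local Notation ed := (led L).
Local Notation gh := (lgh L).
Local Notation E0 := (dvert E).
Local Notation E1 := (dedge E).

Fact ve_idem v : (ve v : A^c) * ve v = ve v.
Proof. by rewrite [LHS](lveM L) eqxx. Qed.

Definition pv v : fgproj A^c := idem_fgproj (ve_idem v).

Definition pval v (x : pv v) : A := val x.

Lemma pval_ve v (x : pv v) : ve v * pval x = pval x.
Proof. exact: (idem_val x). Qed.

Lemma pvalD v (x y : pv v) : pval (x + y) = pval x + pval y.
Proof. by []. Qed.

Lemma pval_act v (x : pv v) a : pval (x ∙ a) = pval x * a.
Proof. by []. Qed.

Lemma pval_inj v : injective (@pval v).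
Proof. exact: val_inj. Qed.

Lemma pval_surj v a : ve v * a = a -> exists x : pv v, pval x = a.
Proof. by move=> h; exists (idem_proj (ve_idem v) a); apply: h. Qed.

Program Definition gpv v : grproj A :=
  @GrProj A (pv v) (fun n => [set x : pv v | gcomp n (pval x)]) _ _.
Next Obligation.
have [A0 AE AU] := gcomp_grading A; split=> [n|x|s f us hf e n ns].
- have [A0n AB] := A0 n; split=> // x y; exact: AB.
- have [l [hl xl]] := AE (pval x).
  exists [seq (y.1, idem_proj (ve_idem v) y.2) | y <- l]; split.
    move=> _ /mapP[y yl ->]; rewrite /= -[y.1]add0r.
    by apply: gcompM; [apply: lve_comp|apply: hl].
  rewrite big_map; apply: pval_inj; rewrite -pval_ve xl mulr_sumr.
  have pv0 : pval (0 : pv v) = 0 by [].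
  by rewrite (big_morph _ (@pvalD v) pv0).
- apply: pval_inj; apply: (AU s (fun n => pval (f n))) => //.
  have pv0 : pval (0 : pv v) = 0 by [].
  by rewrite -(big_morph _ (@pvalD v) pv0) e.
Qed.
Next Obligation. exact: gcompM. Qed.

Definition gdsum (s : seq (int * E0)) : grproj A :=
  foldr (fun x Q => gr_sum (gr_shift x.1 (gpv x.2)) Q) (gr_zero A) s.

Section BasisIso.
Variables (P : lmodType A^c) (F : fam E P) (G : int -> set P).
Hypotheses (wF : fam_wf L F) (G0 : forall n, G n 0)
  (GD : forall n x y, G n x -> G n y -> G n (x + y))
  (GZ : forall m n x a, G m x -> gcomp n a -> G (m + n) (x ∙ a))
  (hF : forall i, fD F i -> G (fd F i) (fm F i)).

(** As P(j)_n = P_(j+n), the shift by [- fd F i] puts the generator of v_i L in degree [fd F i]. The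
    coordinates are normalised by their vertices because [independent] controls nothing else. [G]
    need not be a grading, so the ungraded case is included. *)
Lemma gdsum_map (r : seq (fI F)) : all (fD F) r -> uniq r ->
  exists psi : {linear gdsum [seq (- fd F i, fv F i) | i <- r] -> P},
  [/\ forall l : fI F -> A, exists t, psi t = \sum_(i <- r) fm F i ∙ l i,
      forall t, exists l, [/\ forall i, ve (fv F i) * l i = l i,
        psi t = \sum_(i <- r) fm F i ∙ l i & (forall i, i \in r -> l i = 0) -> t = 0]
    & forall n t, grdeg n t -> G n (psi t)].
Proof.
elim: r => [|i r IH] /=.
  move=> _ _; have l : linear (fun _ : gdsum [::] => 0 : P) by move=> c u v; rewrite scaler0 addr0.
  exists (mklinear l); split=> [a|t|n t _] //.
  - by exists 0; rewrite big_nil.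
  - exists (fun=> 0); split=> [i||_]; rewrite ?mulr0 ?big_nil //.
    by apply/rowP => -[].
move=> /andP[Di Dr] /andP[ir ur]; have [psi [psiS psiI psiG]] := IH Dr ur.
pose f (t : gdsum ((- fd F i, fv F i) :: [seq (- fd F i, fv F i) | i <- r])) : P :=
  fm F i ∙ pval (t.1 : pv (fv F i)) + psi t.2.
have lf : linear f.
  move=> c u v; rewrite /f /= linearP pvalD ractDr scalerDr addrACA; congr (_ + _ + _).
  exact: (esym (ractM _ _ _)).
exists (mklinear lf); split.
- move=> l; have [t et] := psiS l.
  have [x ex] : exists x : pv (fv F i), pval x = ve (fv F i) * l i.
    by apply: pval_surj; rewrite mulrA lveM eqxx.
  by exists (x, t); rewrite big_cons /= /f /= ex et -ractM wF.
- move=> [x t]; have [l [vl et lt]] := psiI t.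
  exists (fun j => if j == i then pval (x : pv (fv F i)) else l j); split.
  + by move=> j; case: eqP => [->|_]; rewrite ?pval_ve.
  + rewrite big_cons eqxx /= /f /= et; congr (_ + _); apply: eq_big_seq => j jr.
    by case: eqP => // ji; rewrite -ji jr in ir.
  + move=> h; congr (_, _); last first.
      apply: lt => j jr; have := h j; rewrite in_cons jr orbT => /(_ isT).
      by case: eqP => // ji; rewrite -ji jr in ir.
    by apply: pval_inj; have := h i; rewrite mem_head eqxx => /(_ isT).
- move=> n [x t] [/= hx ht]; rewrite /f /=; apply: GD; last exact: psiG.
  by rewrite -[n](subrK (fd F i)) addrC [n - _]addrC; apply: GZ => //; apply: hF.
Qed.

Lemma gdsum_iso : is_basis L F ->
  exists (psi : {linear gdsum [seq (- fd F i, fv F i) | i <- enum (fD F)] -> P}) (psi' : P -> _),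
  [/\ cancel psi psi', cancel psi' psi & forall n t, grdeg n t -> G n (psi t)].
Proof.
move=> [_ gF iF].
have [|psi [psiS psiI psiG]] := @gdsum_map (enum (fD F)) _ (enum_uniq _).
  by apply/allP => i; rewrite mem_enum.
have inj : injective psi.
  move=> t u e; apply/eqP; rewrite -subr_eq0; apply/eqP.
  have [l [vl el]] := psiI (t - u); apply => i; rewrite mem_enum => Di.
  have e0 : psi (t - u) = 0 by rewrite linearB e subrr.
  by rewrite -vl; apply: iF => //; rewrite -e0 el big_enum.
have [psi' psiK] : {g : P -> _ & forall x, psi (g x) = x}.
  apply: (@choice _ _ (fun x t => psi t = x)) => x; have [l ->] := gF x.
  by have [t et] := psiS l; exists t; rewrite et big_enum.
by exists psi, psi'; split=> // t; apply: inj; rewrite psiK.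
Qed.

End BasisIso.

End VertexModules.

(** * Group completions and the forgetful map *)

Section GroupCompletionLift.
Variables (M : nmodType) (H : zmodType) (f : M -> H).
Hypotheses (f0 : f 0 = 0) (fD : {morph f : x y / x + y}).

Definition gc_lift (z : group_completion M) : H := f (repr z).1 - f (repr z).2.

Lemma gc_lift_pi (x : M * M) : gc_lift (\pi_(group_completion M)%qT x) = f x.1 - f x.2.
Proof.
have [k /(congr1 f)] := gc_reprP x; rewrite !fD => /addIr e.
by apply/eqP; rewrite subr_eq addrAC eq_sym subr_eq e.
Qed.

Lemma gc_lift_of a : gc_lift (gc_of a) = f a.
Proof. by rewrite gc_lift_pi /= f0 subr0. Qed.

Lemma gc_lift_is_nmod_morphism : nmod_morphism gc_lift.
Proof.
split; first by rewrite -gc_of0 gc_lift_of f0.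
move=> z1 z2; have [x ->] := gc_surj z1; have [y ->] := gc_surj z2.
rewrite [X in gc_lift X]gc_addE !gc_lift_pi /=.
by rewrite !fD opprD addrACA.
Qed.

Definition gc_lift_additive : {additive group_completion M -> H} :=
  HB.pack gc_lift (GRing.isNmodMorphism.Build _ _ _ gc_lift_is_nmod_morphism).
End GroupCompletionLift.

Section Classes.
Variable A : gradedRing.
Implicit Types (P Q : fgproj A^c) (X Y : grproj A).

Lemma K0_classD P Q : K0_class (fgproj_sum P Q) = K0_class P + K0_class Q.
Proof. by rewrite -gc_ofD; congr gc_of; symmetry; apply: (@iaddE (fgproj_isoData A^c)). Qed.

Lemma K0_class_iso P Q : mod_iso P Q -> K0_class P = K0_class Q.
Proof. by move=> h; congr gc_of; apply/(@iclassP (fgproj_isoData A^c)). Qed.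

Lemma K0gr_classD X Y : K0gr_class (gr_sum X Y) = K0gr_class X + K0gr_class Y.
Proof. by rewrite -gc_ofD; congr gc_of; symmetry; apply: (@iaddE (gr_isoData A)). Qed.

Lemma K0gr_class_iso X Y : gr_iso X Y -> K0gr_class X = K0gr_class Y.
Proof. by move=> h; congr gc_of; apply/(@iclassP (gr_isoData A)). Qed.

Lemma K0_ind (S : K0 A -> Prop) : (forall P Q, S (K0_class P - K0_class Q)) -> forall z, S z.
Proof.
move=> h; elim/gc_ind => X Y; rewrite -(ireprK X) -(ireprK Y); exact: h.
Qed.

Definition forgetV (X : Vgr A) : K0 A := K0_class (irepr X : grproj A).

Lemma forgetV_class X : forgetV (Vgr_class X) = K0_class X.
Proof.
apply: K0_class_iso.
have /(@iclassP (gr_isoData A))[f [g [? ? _ _]]] : Vgr_class (irepr (Vgr_class X)) = Vgr_class X.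
  by rewrite /Vgr_class ireprK.
by exists f, g.
Qed.

Lemma forgetV0 : forgetV 0 = 0.
Proof. exact: (forgetV_class (gr_zero A)). Qed.

Lemma forgetVD : {morph forgetV : X Y / X + Y}.
Proof.
move=> x y; have [X ->] := Vgr_surj x; have [Y ->] := Vgr_surj y.
have -> : Vgr_class X + Vgr_class Y = Vgr_class (gr_sum X Y).
  exact: (@iaddE (gr_isoData A)).
by rewrite !forgetV_class; apply: K0_classD.
Qed.

Definition forget : {additive K0gr A -> K0 A} := gc_lift_additive forgetV0 forgetVD.

Lemma forget_class X : forget (K0gr_class X) = K0_class X.
Proof. by rewrite /= (gc_lift_of forgetV0 forgetVD) forgetV_class. Qed.

Lemma forget_shift j z : forget (K0gr_shift A j z) = forget z.
Proof.
have [X [Y ->]] := K0gr_surj z.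
by rewrite !(raddfB (K0gr_shift A j)) !K0gr_shift_class !(raddfB forget) !forget_class.
Qed.

End Classes.

(** * The universal property of K0 *)

Section K0Leavitt.
Variables (K : fieldType) (E : finDigraph) (A : gradedRing) (L : lpa_family K E A).
Local Notation sc := (lsc L).
Local Notation ve := (lve L).
Local Notation ed := (led L).
Local Notation gh := (lgh L).
Local Notation E0 := (dvert E).
Local Notation E1 := (dedge E).
Local Notation pv := (pv L).
Local Notation gpv := (gpv L).

Lemma K0_gdsum s : K0_class (gdsum L s) = \sum_(x <- s) K0_class (pv x.2).
Proof.
elim: s => [|x s IH]; first by rewrite big_nil.
by rewrite big_cons -IH -K0_classD.
Qed.

Lemma K0gr_gdsum s :
  K0gr_class (gdsum L s) = \sum_(x <- s) K0gr_shift A x.1 (K0gr_class (gpv x.2)).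
Proof.
elim: s => [|x s IH]; first by rewrite big_nil.
by rewrite big_cons -IH K0gr_shift_class -K0gr_classD.
Qed.

Lemma K0_basis (P : fgproj A^c) (F : fam E P) : is_basis L F ->
  K0_class P = fam_sum (fun v => K0_class (pv v)) F.
Proof.
move=> bF; have [wF _ _] := bF.
(* With [setT] in every degree, the conditions on degrees become trivial. *)
have [||||psi [psi' [psiK psi'K _]]] := @gdsum_iso _ _ _ L P F (fun=> setT) wF _ _ _ _ bF; try by [].
transitivity (K0_class (gdsum L [seq (- fd F i, fv F i) | i <- enum (fD F)])).
  apply/esym/K0_class_iso; exists psi, (mklinear (can2_linear psiK psi'K)).
  by [].
by rewrite K0_gdsum big_map big_enum.
Qed.

Lemma K0gr_basis (X : grproj A) (F : fam E X) : is_basis L F -> homogeneous (@grdeg _ X) F ->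
  K0gr_class X = \sum_(i | fD F i) K0gr_shift A (- fd F i) (K0gr_class (gpv (fv F i))).
Proof.
move=> bF hF; have [wF _ _] := bF.
have gX := grdeg_grading X; have [X0 _ _] := gX.
have [|||psi [psi' [psiK psi'K psiG]]] := @gdsum_iso _ _ _ L X F (@grdeg _ X) wF _ _ _ hF bF.
- by move=> n; have [] := X0 n.
- by move=> n x y; apply: gradingD.
- by move=> m n x a; apply: grdegZ.
transitivity (K0gr_class (gdsum L [seq (- fd F i, fv F i) | i <- enum (fD F)])).
  apply/esym/K0gr_class_iso; exists psi, (mklinear (can2_linear psiK psi'K)).
  split=> // n x hx /=; apply: (grading_reflect (grdeg_grading _) gX (f := psi)) => //.
    exact: can_inj psiK.
  by move: hx; rewrite -{1}(psi'K x).
by rewrite K0gr_gdsum big_map big_enum.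
Qed.

Lemma fgproj_basis_exists (P : fgproj A^c) : exists F : fam E P, is_basis L F.
Proof.
have [n [phi iphi]] := fgproj_embed (fgproj_fg P) (fgproj_proj P).
have [k [x hx]] := fgproj_fg P.
pose F0 := with_vertices L x (fun=> 0).
have wF0 : fam_wf L F0 by apply: with_vertices_wf.
have gF0 : generates F0.
  move=> y; have [a ->] := hx y; apply: in_span_sum => i _.
  exact/(@in_span_act _ _ _ F0)/with_vertices_span.
have [N hN] := refine_path_valued L phi F0.
by apply: (basis_exists iphi (refine_gen N wF0 gF0) hN); apply: refine_wf.
Qed.

Lemma grproj_basis_exists (X : grproj A) : exists F : fam E X,
  is_basis L F /\ homogeneous (@grdeg _ X) F.
Proof.
have gX := grdeg_grading X; have [_ XE _] := gX.
have GZ m n (x : X) (a : A) : grdeg m x -> gcomp n a -> grdeg (m + n) (x ∙ a) by apply: grdegZ.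
have [n [phi iphi]] := fgproj_embed (fgproj_fg X) (fgproj_proj X).
have [k [x hx]] := fgproj_fg X.
have [l hl] := @choice _ _ _ (fun i => XE (x i)).
(* The homogeneous components of all generators, in one list. *)
pose ss := flatten [seq l i | i <- enum 'I_k].
pose y (i : 'I_(size ss)) := nth (0, 0) ss i.
have hy i : grdeg (y i).1 (y i).2.
  have : y i \in ss by apply: mem_nth.
  by move=> /flattenP[_ /mapP[j _ ->]]; have [h _] := hl j; apply: h.
pose F0 := with_vertices L (fun i => (y i).2) (fun i => (y i).1).
have wF0 : fam_wf L F0 by apply: with_vertices_wf.
have gF0 : generates F0.
  move=> z; have [a ->] := hx z; apply: in_span_sum => i _.
  apply: (@in_span_act _ _ _ F0); have [_ ->] := hl i.
  rewrite big_seq; apply: in_span_sum => u ul.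
  have us : u \in ss.
    by apply/flattenP; exists (l i) => //; apply/mapP; exists i; rewrite ?mem_enum.
  have := us; rewrite -index_mem => ui; rewrite -(nth_index (0, 0) us).
  exact: (with_vertices_span L (fun i => (y i).2) (fun i => (y i).1) (Ordinal ui)).
have [N hN] := refine_path_valued L phi F0.
apply: (homogeneous_basis_exists iphi gX GZ (refine_gen N wF0 gF0) hN); first exact: refine_wf.
move=> i /refineP[[j v] [p [_ sp -> ->]]] /=; rewrite -sp.
apply: (GZ); last exact: ps_word_comp.
by rewrite -[(y j).1]addr0; apply: GZ => //; apply: lve_comp.
Qed.

Lemma gpv_generator v : exists x : gpv v, pval x = ve v.
Proof. by apply: pval_surj; rewrite lveM eqxx. Qed.

Lemma pval_sum v (I : Type) (r : seq I) (D : pred I) (x : I -> pv v) :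
  pval (\sum_(i <- r | D i) x i) = \sum_(i <- r | D i) pval (x i).
Proof. by apply: (big_morph _ (@pvalD _ _ _ L v)). Qed.

(** The edges leaving [v] form a basis of vL, homogeneous of degree 1; this degree is the origin of
    the shift by -1. *)
Lemma K0gr_vertex v : K0gr_class (gpv v) =
  \sum_(e | dsrc e == v) K0gr_shift A (-1) (K0gr_class (gpv (drng e))).
Proof.
have [m hm] : {m : E1 -> gpv v & forall e, pval (m e) = if dsrc e == v then ed e else 0}.
  apply: (@choice _ _ (fun e (x : gpv v) => pval x = if dsrc e == v then ed e else 0)) => e.
  by apply: pval_surj; case: eqP => [<-|]; rewrite ?lsrcM ?mulr0.
pose F : fam E (gpv v) := @Fam E _ E1 (fun e => dsrc e == v) m (@drng E) (fun=> 1).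
apply: (@K0gr_basis (gpv v) F); last first.
  by move=> e /= /eqP se; rewrite hm se eqxx; apply: led_comp.
split.
- by move=> e /= /eqP se; apply: pval_inj; rewrite pval_act hm se eqxx lrngM.
- move=> x; exists (fun e => gh e * pval x); apply: pval_inj.
  rewrite pval_sum -[LHS]pval_ve (lck2 L) mulr_suml; apply: eq_bigr => e /eqP se.
  by rewrite pval_act hm se eqxx mulrA.
- move=> l l0 e /= /eqP se.
  have h : pval (fcomb l : pv v) = 0 by rewrite l0.
  rewrite pval_sum in h.
  have := congr1 (fun x => gh e * x) h; rewrite mulr0 mulr_sumr (bigD1 e) /= ?se //.
  rewrite pval_act hm se eqxx mulrA lgh_ed eqxx big1 ?addr0 // => f /andP[/eqP sf /negPf fe].
  by rewrite pval_act hm sf eqxx mulrA lgh_ed eq_sym fe mul0r.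
Qed.

Lemma K0_vertex_ind (S : K0 A -> Prop) : S 0 -> (forall x y, S x -> S y -> S (x - y)) ->
  (forall v, S (K0_class (pv v))) -> forall z, S z.
Proof.
move=> S0 SB Sv; have SD x y : S x -> S y -> S (x + y).
  by move=> hx hy; rewrite -[y]opprK -[- y]add0r; apply/SB/SB.
have hP P : S (K0_class P).
  by have [F /K0_basis ->] := fgproj_basis_exists P; apply: (big_ind S).
by elim/K0_ind => P Q; apply: SB.
Qed.

Lemma K0gr_vertex_ind (S : K0gr A -> Prop) : S 0 -> (forall x y, S x -> S y -> S (x - y)) ->
  (forall j v, S (K0gr_shift A j (K0gr_class (gpv v)))) -> forall z, S z.
Proof.
move=> S0 SB Sv; have SD x y : S x -> S y -> S (x + y).
  by move=> hx hy; rewrite -[y]opprK -[- y]add0r; apply/SB/SB.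
have hP X : S (K0gr_class X).
  by have [F [bF /(K0gr_basis bF) ->]] := grproj_basis_exists X; apply: (big_ind S).
by move=> z; have [X [Y ->]] := K0gr_surj z; apply: SB.
Qed.

Section Universal.
Variables (H : zmodType) (h : E0 -> H).
Hypothesis hh : forall v, h v = \sum_(e | dsrc e == v) h (drng e).

Definition basis_of (P : fgproj A^c) : fam E P := projT1 (cid (fgproj_basis_exists P)).
Lemma basis_ofP P : is_basis L (basis_of P).
Proof. by rewrite /basis_of; case: cid. Qed.

Definition chiV (X : Vmon A) : H := fam_sum h (basis_of (irepr X)).

Lemma is_basis_iso (P Q : fgproj A^c) (f : {linear P -> Q}) (g : {linear Q -> P}) (F : fam E P) :
  cancel f g -> cancel g f -> is_basis L F ->
  is_basis L (@Fam E Q (fI F) (fD F) (fun i => f (fm F i)) (fv F) (fd F)).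
Proof.
move=> fK gK [wF gF iF].
have fc (l : fI F -> A) : \sum_(i | fD F i) f (fm F i) ∙ l i = f (fcomb l).
  by rewrite raddf_sum; apply: eq_bigr => i _; rewrite /= linear_ract.
split=> [i Di|x|l].
- by rewrite /= -linear_ract wF.
- by have [l el] := gF (g x); exists l; rewrite [RHS]fc -el gK.
- by rewrite /fcomb /= fc => e; apply: iF; rewrite -[LHS]fK e raddf0.
Qed.

(** Independence of the chosen representative and basis: a basis is transported along an
    isomorphism, and [basis_sum] compares it with the chosen one. *)
Lemma chiV_class (P : fgproj A^c) (F : fam E P) :
  is_basis L F -> chiV (iclass (P : fgproj_isoData A^c)) = fam_sum h F.
Proof.
move=> bF; rewrite /chiV; set Q : fgproj A^c := @irepr (fgproj_isoData A^c) _.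
have /(@iclassP (fgproj_isoData A^c))[f [g [fK gK]]] :
    iclass (P : fgproj_isoData A^c) = iclass (Q : fgproj_isoData A^c).
  by rewrite ireprK.
have bF' := is_basis_iso fK gK bF.
exact: (basis_sum hh (basis_ofP Q) bF').
Qed.

Lemma chiVD : {morph chiV : X Y / X + Y}.
Proof.
move=> X Y; rewrite -(ireprK X) -(ireprK Y).
set P : fgproj A^c := irepr X; set Q : fgproj A^c := irepr Y.
have [F bF] := fgproj_basis_exists P; have [F' bF'] := fgproj_basis_exists Q.
rewrite (chiV_class bF) (chiV_class bF').
pose FF : fam E (fgproj_sum P Q) := @Fam E (fgproj_sum P Q) (fI F + fI F')%type
    (fun x => match x with inl i => fD F i | inr j => fD F' j end)
    (fun x => match x with inl i => (fm F i, 0) | inr j => (0, fm F' j) end)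
    (fun x => match x with inl i => fv F i | inr j => fv F' j end)
    (fun x => match x with inl i => fd F i | inr j => fd F' j end).
have [wF gF iF] := bF; have [wF' gF' iF'] := bF'.
have FFc (l : fI FF -> A) : fcomb l = (fcomb (fun i => l (inl i)), fcomb (fun i => l (inr i))) :> P * Q.
  rewrite /fcomb big_sumType /=.
  rewrite (eq_bigr (fun i => (fm F i ∙ l (inl i), 0))) => [|i _]; last first.
    by congr (_, _); apply: ract0l.
  rewrite [X in _ + X](eq_bigr (fun i => (0, fm F' i ∙ l (inr i)))) => [|i _]; last first.
    by congr (_, _); apply: ract0l.
  rewrite [LHS]surjective_pairing /=; congr (_, _).
    by rewrite !(raddf_sum fst) /= [X in _ + X]big1 ?addr0.
  by rewrite !(raddf_sum snd) /= [X in X + _]big1 ?add0r.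
have bFF : is_basis L FF.
  split.
  - move=> [i|i] Di; rewrite /FF /=; congr (_, _); rewrite /= ?scaler0 //.
      exact: wF.
    exact: wF'.
  - move=> [x y]; have [l ->] := gF x; have [l' ->] := gF' y.
    by exists (fun x => match x with inl i => l i | inr j => l' j end); rewrite FFc.
  - by move=> l; rewrite FFc => -[e e'] [i|i] Di; [apply: (iF _ e)|apply: (iF' _ e')].
transitivity (chiV (iclass (fgproj_sum P Q : fgproj_isoData A^c))).
  by congr chiV; apply: (@iaddE (fgproj_isoData A^c)).
by rewrite (chiV_class bFF) /fam_sum big_sumType.
Qed.

Lemma chiV0 : chiV 0 = 0.
Proof. by apply: (addIr (chiV 0)); rewrite -chiVD !add0r. Qed.

Definition chi : {additive K0 A -> H} := gc_lift_additive chiV0 chiVD.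

Lemma chi_vertex v : chi (K0_class (pv v)) = h v.
Proof.
rewrite /= (gc_lift_of chiV0 chiVD).
have [x hx] := gpv_generator v.
pose F : fam E (pv v) := @Fam E _ 'I_1 xpredT (fun=> x) (fun=> v) (fun=> 0).
rewrite (@chiV_class _ F); first by rewrite /fam_sum big_ord1.
split.
- by move=> u _; apply: pval_inj; rewrite pval_act hx lveM eqxx.
- move=> y; exists (fun=> pval y); apply: pval_inj.
  by rewrite pval_sum big_ord1 pval_act hx pval_ve.
- move=> l l0 i _; rewrite (ord1 i).
  have : pval (fcomb l : pv v) = 0 by rewrite l0.
  by rewrite pval_sum big_ord1 pval_act hx.
Qed.

End Universal.
End K0Leavitt.

(** * The Leavitt path algebra of a graph without sinks *)

Section Representation.
Variables (K : fieldType) (E : finDigraph).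
Local Notation E0 := (dvert E).
Local Notation E1 := (dedge E).
Local Notation term := (aterm K (lpa_gen E)).

Definition out (v : E0) : seq E1 := enum [pred e | dsrc e == v].
Definition outi (e : E1) : nat := index e (out (dsrc e)).

Lemma outi_lt e : (outi e < size (out (dsrc e)))%N.
Proof. by rewrite index_mem mem_enum inE. Qed.

Lemma nth_outi e0 e : nth e0 (out (dsrc e)) (outi e) = e.
Proof. by rewrite nth_index // mem_enum inE. Qed.

(* A right L(E)-module in which every vertex acts nontrivially. Its part at v is a copy of
   K^nat, which is split among the edges leaving v by the residues modulo their number. *)
Definition rep := E0 -> nat -> K.

(** With k edges leaving the source of [e] and i the index of [e] among them, n |-> n k + i
    identifies nat with a residue class. The edge pulls functions back along this map; the ghost
    inverts this and extends by 0. *)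
Definition gen_act (x : lpa_gen E) (F : rep) : rep := fun w n =>
  match x with
  | Vert v => if w == v then F w n else 0
  | Edge e => if w == drng e then F (dsrc e) (n * size (out (dsrc e)) + outi e)%N else 0
  | Ghost e => if (w == dsrc e) && (n %% size (out w) == outi e)%N
               then F (drng e) (n %/ size (out w))%N else 0
  end.

Fixpoint term_act (s : term) (F : rep) : rep :=
  match s with
  | Gen x => gen_act x F
  | Zero => fun _ _ => 0
  | One => F
  | Add s t => fun w n => term_act s F w n + term_act t F w n
  | Opp s => fun w n => - term_act s F w n
  | Mul s t => term_act t (term_act s F)
  | Scale a s => fun w n => a * term_act s F w n
  end.

(** Operators compose in the order of a right action, so the congruence rules for a sum or a scalar
    multiple in the left factor require the operator of the right factor to be linear. *)
Lemma term_act_linear s (a : K) (F G : rep) :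
  term_act s (fun w n => a * F w n + G w n) = fun w n => a * term_act s F w n + term_act s G w n.
Proof.
elim: s F G => [x|||s IHs t IHt|s IHs|s IHs t IHt|b s IHs] F G /=.
- apply/funext => w; apply/funext => n; rewrite /gen_act.
  by case: x => [v|e|e]; case: ifP => _ //; rewrite mulr0 addr0.
- by apply/funext => w; apply/funext => n; rewrite mulr0 addr0.
- by [].
- apply/funext => w; apply/funext => n; rewrite IHs IHt.
  by rewrite addrACA -mulrDr.
- by apply/funext => w; apply/funext => n; rewrite IHs opprD mulrN.
- by rewrite IHs IHt.
- by apply/funext => w; apply/funext => n; rewrite IHs mulrDr mulrCA.
Qed.

Lemma term_act_sum (l : seq term) F w n :
  term_act (term_sum l) F w n = \sum_(t <- l) term_act t F w n.
Proof. by elim: l => [|t l IH]; rewrite ?big_nil ?big_cons //= IH. Qed.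

Lemma lpa_rel_act s t : lpa_rel s t -> term_act s = term_act t.
Proof.
case=> [|u v|e|e|e|e|e f|v nv]; apply/funext => F; apply/funext => w; apply/funext => n /=.
- rewrite term_act_sum big_map big_enum (bigD1 w) //= eqxx big1 ?addr0 // => v.
  by rewrite eq_sym => /negPf->.
- case: (eqVneq u v) => [->|uv] /=; first by case: (w == v).
  by case: eqP => // ->; rewrite eq_sym (negPf uv).
- by rewrite eqxx.
- by case: (w == _).
- by rewrite eqxx.
- by case: (w == _).
- case: (eqVneq e f) => [->|ef] /=.
    rewrite eqxx modnMDl modn_small ?outi_lt // eqxx /=.
    case: ifP => // /eqP->; rewrite divnMDl ?divn_small ?outi_lt ?addn0 //.
    by apply: leq_trans (outi_lt f).
  case: ifP => // _; case: eqP => //= sfe.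
  rewrite modnMDl modn_small ?outi_lt //; case: eqP => // ei; case/eqP: ef.
  by rewrite -(nth_outi f e) -ei -sfe nth_outi.
- rewrite term_act_sum big_map big_filter big_enum_cond /=.
  case: (eqVneq w v) => [->|wv]; last first.
    rewrite big1 // => e /eqP se; rewrite se.
    by rewrite (negPf wv).
  have [e0 se0] : exists e0 : E1, dsrc e0 = v.
    by move: nv; rewrite negb_forall => /existsP[e]; rewrite negbK => /eqP; exists e.
  have kv : (0 < size (out v))%N by rewrite -se0; apply: leq_trans (outi_lt e0).
  (* The edge whose residue class contains [n]; it is the only one contributing to the sum at
     [n]. *)
  pose e1 := nth e0 (out v) (n %% size (out v)).
  have se1 : dsrc e1 = v.
    by have := mem_nth e0 (ltn_pmod n kv); rewrite mem_enum inE => /eqP.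
  have i1 : outi e1 = (n %% size (out v))%N.
    by rewrite /outi se1 index_uniq ?enum_uniq ?ltn_pmod.
  rewrite (bigD1 e1) /=; last by rewrite se1 eqxx.
  rewrite se1 i1 !eqxx /= -divn_eq big1 ?addr0 // => e /andP[/eqP se ee1].
  rewrite se eqxx /=; case: eqP => // ei; case/eqP: ee1.
  by rewrite /e1 ei -[in LHS](nth_outi e0 e) se.
Qed.

Lemma acong_act s t : acong (@lpa_rel K E) s t -> term_act s = term_act t.
Proof.
have fx (F G : rep) : (forall w n, F w n = G w n) -> F = G.
  by move=> h; apply/funext => w; apply/funext.
elim=> {s t} //=.
- by move=> s t; apply: lpa_rel_act.
- by move=> s t u _ -> _ ->.
- by move=> s s' t t' _ -> _ ->.
- by move=> s s' _ ->.
- by move=> s s' t t' _ -> _ ->.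
- by move=> a s s' _ ->.
- by move=> s t u; apply/funext => F; apply: fx => w n; rewrite addrA.
- by move=> s t; apply/funext => F; apply: fx => w n; rewrite addrC.
- by move=> s; apply/funext => F; apply: fx => w n; rewrite add0r.
- by move=> s; apply/funext => F; apply: fx => w n; rewrite addNr.
- move=> s t u; apply/funext => F.
  have := term_act_linear u 1 (term_act s F) (term_act t F).
  by under eq_fun do under eq_fun do rewrite mul1r; move=> ->; apply: fx => w n; rewrite mul1r.
- by move=> a b s; apply/funext => F; apply: fx => w n; rewrite mulrA.
- by move=> s; apply/funext => F; apply: fx => w n; rewrite mul1r.
- by move=> a s t; apply/funext => F; apply: fx => w n; rewrite mulrDr.
- by move=> a b s; apply/funext => F; apply: fx => w n; rewrite mulrDl.
- move=> a s t; apply/funext => F.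
  (* Writes a X as (a - 1) X + X, the shape to which [term_act_linear] applies without a zero
     function. *)
  have e (X : rep) : (fun w n => (a - 1) * X w n + X w n) = fun w n => a * X w n.
    by apply: fx => w n; rewrite mulrBl mul1r subrK.
  by rewrite -!e term_act_linear.
Qed.

Lemma vertex_neq0 (v : E0) : peval (@lpa_rel K E) (Gen (Vert v)) <> 0.
Proof.
move=> /pevalP/acong_act h.
have := congr1 (fun f => f (fun _ _ => 1) v 0%N) h.
by rewrite /= eqxx => /eqP; rewrite oner_eq0.
Qed.

End Representation.

(** * The structure of the Leavitt path algebra used above *)

Section LeavittFamily.
Variables (K : fieldType) (E : finDigraph).
Local Notation A := (leavitt K E).
Local Notation rel := (@lpa_rel K E).

Definition lv_sc (c : K) : A := c *: (1 : presented rel).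
Definition lv_ve v : A := peval rel (Gen (Vert v)).
Definition lv_ed e : A := peval rel (Gen (Edge e)).
Definition lv_gh e : A := peval rel (Gen (Ghost e)).
Definition lv_coef (n : int) (a : A) : A := pcoef (@lpa_deg E) n (a : presented rel).

Lemma lv_scE c (a : presented rel) : (lv_sc c : presented rel) * a = c *: a.
Proof. by rewrite -[_ * a]presented_scalerAl mul1r. Qed.

Lemma pevalM s t : peval rel (Mul s t) = peval rel s * peval rel t :> presented rel.
Proof. by rewrite [RHS]pmulE. Qed.
Lemma pevalD s t : peval rel (Add s t) = peval rel s + peval rel t :> presented rel.
Proof. by rewrite [RHS]paddE. Qed.
Lemma peval_sum l : peval rel (term_sum l) = \sum_(t <- l) peval rel t :> presented rel.
Proof. by elim: l => [|t l IH]; rewrite ?big_nil ?big_cons //= pevalD IH. Qed.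
Lemma peval_rel s t : rel s t -> peval rel s = peval rel t.
Proof. by move=> h; apply/pevalP/ac_rel. Qed.

Hypothesis ns : forall v : dvert E, ~~ sink v.

Definition leavitt_family : lpa_family K E A.
Proof.
apply: (@LpaFamily K E A lv_sc lv_ve lv_ed lv_gh lv_coef).
- by move=> a b; apply: scalerDl.
- by move=> a b; rewrite [RHS]lv_scE [RHS]scalerA.
- exact: scale1r.
- move=> c a; rewrite [LHS]lv_scE -[RHS]presented_scalerAr; congr (_ *: _).
  by rewrite [RHS]mulr1.
- transitivity (peval rel One); first by [].
  by rewrite (peval_rel (lr_unit K E)) peval_sum big_map big_enum.
- move=> u v; rewrite -[LHS]pevalM (peval_rel (lr_vert K u v)).
  by case: eqP.
- exact: vertex_neq0.
- by move=> e; rewrite -[LHS]pevalM (peval_rel (lr_src K e)).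
- by move=> e; rewrite -[LHS]pevalM (peval_rel (lr_rng K e)).
- by move=> e; rewrite -[LHS]pevalM (peval_rel (lr_ghost_src K e)).
- by move=> e f; rewrite -[LHS]pevalM (peval_rel (lr_ck1 K e f)); case: eqP.
(* The absence of sinks makes relation (4) available at every vertex. *)
- move=> v; rewrite [LHS](peval_rel (lr_ck2 K (ns v))) peval_sum big_map big_filter big_enum_cond.
  by apply: eq_bigr => e _; apply: pevalM.
- by move=> c; exists (Scale c One); split; [apply/hg_scale/hg_one|apply: pscaleE].
- by move=> v; exists (Gen (Vert v)); split=> //; apply: (hg_gen K (@lpa_deg E) (Vert v)).
- by move=> e; exists (Gen (Edge e)); split=> //; apply: (hg_gen K (@lpa_deg E) (Edge e)).
- by move=> n; have [_ D] := pcoef_is_nmod_morphism (@lpa_rel_homog K E) n; apply: D.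
- move=> m n a [s [hs ->]]; rewrite /lv_coef.
  by rewrite (pcoefE (@lpa_rel_homog K E)) (hcoef_homog _ _ hs).
- move=> S Sc Sv Se Sg SD SM a; have [s ->] := psurj (a : presented rel).
  elim: s => [[v|e|e]|||s IHs t IHt|s IHs|s IHs t IHt|c s IHs].
  + exact: Sv.
  + exact: Se.
  + exact: Sg.
  + have -> : peval rel Zero = lv_sc 0 by rewrite /lv_sc scale0r.
    exact: Sc.
  + have -> : peval rel One = lv_sc 1 by rewrite /lv_sc scale1r.
    exact: Sc.
  + by rewrite pevalD; apply: SD.
  + have -> : peval rel (Opp s) = (lv_sc (-1) : presented rel) * peval rel s.
      by rewrite lv_scE scaleN1r [RHS]poppE.
    exact: SM.
  + by rewrite pevalM; apply: SM.
  + have -> : peval rel (Scale c s) = (lv_sc c : presented rel) * peval rel s.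
      by rewrite lv_scE [RHS]pscaleE.
    exact: SM.
Qed.

End LeavittFamily.

(** * From maps of graded Grothendieck groups to maps of ungraded ones *)

Lemma laurent_linear_shift (A B : gradedRing) (f : K0gr A -> K0gr B) j z :
  laurent_linear f -> f (K0gr_shift A j z) = K0gr_shift B j (f z).
Proof.
pose p : laurent := [fsfun [fsfun] with j |-> 1].
have E C (w : K0gr C) : laurent_scale p w = K0gr_shift C j w.
  rewrite /laurent_scale finsupp_with oner_eq0 finsupp0 fsetU0 big_seq_fset1.
  by rewrite fsfun_with.
by move=> h; have := h p z; rewrite !E.
Qed.

Section Transfer.
Variables (K : fieldType) (E F : finDigraph) (A B : gradedRing).
Variables (L : lpa_family K E A) (M : lpa_family K F B).

Definition transfer (f : K0gr A -> K0gr B) v : K0 B := forget B (f (K0gr_class (gpv L v))).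

(** Linearity carries the shift in [K0gr_vertex] through [f], and [forget] then removes it. *)
Lemma transfer_rel (f : {additive K0gr A -> K0gr B}) v : laurent_linear f ->
  transfer f v = \sum_(e | dsrc e == v) transfer f (drng e).
Proof.
move=> hf; rewrite /transfer {1}K0gr_vertex (raddf_sum f) (raddf_sum (forget B)); apply: eq_bigr => e _.
by rewrite -(@forget_shift B (-1)) -laurent_linear_shift.
Qed.

Lemma transfer_exists (f : {additive K0gr A -> K0gr B}) : laurent_linear f ->
  exists g : {additive K0 A -> K0 B}, forall z, g (forget A z) = forget B (f z).
Proof.
move=> hf; pose g := chi L (fun v => transfer_rel v hf); exists g.
apply: (@K0gr_vertex_ind _ _ _ L (fun z => g (forget A z) = forget B (f z))) => [|x y ex ey|j v].
- by rewrite !raddf0.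
- rewrite (raddfB (forget A)) (raddfB g) ex ey.
  by rewrite (raddfB f) (raddfB (forget B)).
by rewrite forget_shift laurent_linear_shift // forget_shift forget_class chi_vertex.
Qed.

End Transfer.

(** The vertex classes generate K0 and come from graded modules, so the image of [forget] is all
    that has to be tested. *)
Lemma forget_cancel (K : fieldType) (E : finDigraph) (A : gradedRing) (L : lpa_family K E A)
    (H : zmodType) (g : {additive K0 A -> H}) (g' : {additive H -> K0 A}) :
  (forall z, g' (g (forget A z)) = forget A z) -> cancel g g'.
Proof.
move=> h; apply: (@K0_vertex_ind _ _ _ L (fun z => g' (g z) = z)) => [|x y ex ey|v]; first by rewrite !raddf0.
  by rewrite (raddfB g) (raddfB g') ex ey.
by rewrite -(forget_class (gpv L v)).
Qed.

Theorem theorem3 (K : fieldType) (E F : finDigraph)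
    (hE : forall v : dvert E, ~~ sink v) (hF : forall v : dvert F, ~~ sink v)
    (hgr : exists f : {additive K0gr (leavitt K E) -> K0gr (leavitt K F)},
       [/\ bijective f, laurent_linear f, order_preserving f
         & f (K0gr_unit (leavitt K E)) = K0gr_unit (leavitt K F)]) :
  exists g : {additive K0 (leavitt K E) -> K0 (leavitt K F)},
    bijective g /\ g (K0_unit (leavitt K E)) = K0_unit (leavitt K F).
Proof.
move: hgr (leavitt_family K hE) (leavitt_family K hF).
set A := leavitt K E; set B := leavitt K F.
move: A B => A B [f [[f' fK f'K] lf _ f1]] L M.
have f'D : nmod_morphism f'.
  by split=> [|x y]; apply: (can_inj fK); rewrite ?raddf0 ?raddfD !f'K.
pose f'a : {additive K0gr B -> K0gr A} := HB.pack f' (GRing.isNmodMorphism.Build _ _ f' f'D).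
have lf' : laurent_linear f'a.
  by move=> p z; apply: (can_inj fK); rewrite lf /= !f'K.
have [g hg] := transfer_exists L lf.
have [g' hg'] := transfer_exists M lf'.
exists g; split.
  exists g'; first by apply: (forget_cancel L) => z; rewrite hg hg' [f'a _]fK.
  by apply: (forget_cancel M) => z; rewrite hg' hg [f (f'a _)]f'K.
have uE (C : gradedRing) : forget C (K0gr_unit C) = K0_unit C by apply: forget_class.
by rewrite -!uE hg f1.
Qed.
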